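(* Let $\mu\in M_4(\mathbb{R})$ and $S=D\mu D^T\in M_4(\mathbb{R})$. The Pauli diagonal map $\Pi^{(2)}_\mu:\mathcal{M}_4\to\mathcal{M}_4$ is decomposable if and only if for all permutations $\sigma_1,\sigma_2\in S_4$: $S_{\sigma_1(1)\sigma_2(1)}+S_{\sigma_1(1)\sigma_2(2)}+S_{\sigma_1(2)\sigma_2(1)}+S_{\sigma_1(2)\sigma_2(2)}\ge0$, $S_{\sigma_1(1)\sigma_2(1)}+S_{\sigma_1(2)\sigma_2(2)}+S_{\sigma_1(3)\sigma_2(3)}+S_{\sigma_1(4)\sigma_2(4)}\ge0$, $S_{\sigma_1(1)\sigma_2(1)}+S_{\sigma_1(2)\sigma_2(2)}+S_{\sigma_1(3)\sigma_2(3)}+S_{\sigma_1(4)\sigma_2(1)}+S_{\sigma_1(4)\sigma_2(2)}+S_{\sigma_1(4)\sigma_2(3)}\ge0$, $S_{\sigma_1(1)\sigma_2(1)}+S_{\sigma_1(2)\sigma_2(2)}+S_{\sigma_1(3)\sigma_2(3)}+S_{\sigma_1(1)\sigma_2(4)}+S_{\sigma_1(2)\sigma_2(4)}+S_{\sigma_1(3)\sigma_2(4)}\ge0$. Moreover, if $\Pi^{(2)}_\mu$ is positive, then the first two families of inequalities hold automatically.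
   Context: Pauli matrices $\sigma_1=I_2$, $\sigma_2=\begin{pmatrix}0&1\\1&0\end{pmatrix}$, $\sigma_3=\begin{pmatrix}1&0\\0&-1\end{pmatrix}$, $\sigma_4=\begin{pmatrix}0&-i\\i&0\end{pmatrix}$; $\Pi^{(2)}_\mu(X)=\sum_{i,j}\frac{\mu_{ij}}4\mathrm{Tr}[(\sigma_i\otimes\sigma_j)X]\sigma_i\otimes\sigma_j$ on $\mathcal{M}_2\otimes\mathcal{M}_2\cong\mathcal{M}_4$. $D=\frac12\begin{pmatrix}1&1&1&1\\1&1&-1&-1\\1&-1&1&-1\\1&-1&-1&1\end{pmatrix}$; the entries of $S=D\mu D^T$ are the eigenvalues of the Choi matrix of $\Pi^{(2)}_\mu$ (''spectral matrix''). Decomposable means $T+\vartheta\circ S'$ with $T,S'$ completely positive and $\vartheta$ the transpose. *)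

(* Defs.v *)
From HB Require Import structures.
From mathcomp Require Import all_boot all_order all_algebra all_fingroup.
From mathcomp Require Import reals.
From mathcomp Require Import complex mxtens.
Set Implicit Arguments. Unset Strict Implicit. Unset Printing Implicit Defensive.
Import Order.TTheory GRing.Theory Num.Theory.
Local Open Scope ring_scope.

Section Defs.
Variable R : realType.
Local Notation C := (R[i]).

Definition adjmx m n (A : 'M[C]_(m, n)) : 'M[C]_(n, m) := (map_mx Num.conj A)^T.

Definition psd n (A : 'M[C]_n) : Prop :=
  adjmx A = A /\ forall v : 'cV[C]_n, 0 <= (adjmx v *m A *m v) 0 0.

Definition positive_map n (Phi : 'M[C]_n -> 'M[C]_n) : Prop :=
  forall X, psd X -> psd (Phi X).

Definition blockmx k n (X : 'M[C]_(k * n)) (a b : 'I_k) : 'M[C]_n :=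
  \matrix_(i, j) X (mxtens_index (a, i)) (mxtens_index (b, j)).

Definition ampl k n (Phi : 'M[C]_n -> 'M[C]_n) (X : 'M[C]_(k * n)) : 'M[C]_(k * n) :=
  \matrix_(p, q)
     Phi (blockmx X (mxtens_unindex p).1 (mxtens_unindex q).1)
         (mxtens_unindex p).2 (mxtens_unindex q).2.

Definition completely_positive n (Phi : 'M[C]_n -> 'M[C]_n) : Prop :=
  forall k : nat, positive_map (@ampl k n Phi).

Definition decomposable n (Phi : 'M[C]_n -> 'M[C]_n) : Prop :=
  exists T S' : 'M[C]_n -> 'M[C]_n,
    [/\ linear T, linear S', completely_positive T, completely_positive S'
      & forall X, Phi X = T X + (S' X)^T].

Definition mx_of_seq (K : nzRingType) m n (L : seq (seq K)) : 'M[K]_(m, n) :=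
  \matrix_(i, j) nth 0 (nth [::] L i) j.

(* Pauli matrices sigma_1 = I, sigma_2 = X, sigma_3 = Z, sigma_4 = Y,
   indexed by 'I_4 = {0,1,2,3} (index k stands for sigma_(k+1)) *)
Definition pauli (k : 'I_4) : 'M[C]_2 :=
  match val k with
  | 0 => mx_of_seq 2 2 [:: [:: 1; 0]; [:: 0; 1]]
  | 1 => mx_of_seq 2 2 [:: [:: 0; 1]; [:: 1; 0]]
  | 2 => mx_of_seq 2 2 [:: [:: 1; 0]; [:: 0; -1]]
  | _ => mx_of_seq 2 2 [:: [:: 0; - 'i]; [:: 'i; 0]]
  end.

Definition pauli_map (mu : 'M[R]_4) (X : 'M[C]_(2 * 2)) : 'M[C]_(2 * 2) :=
  \sum_(i < 4) \sum_(j < 4)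
     ((real_complex R (mu i j) / 4) * \tr ((pauli i *t pauli j) *m X))
       *: (pauli i *t pauli j).

Definition Dmx : 'M[R]_4 :=
  2^-1 *: mx_of_seq 4 4 [:: [:: 1; 1; 1; 1]; [:: 1; 1; -1; -1];
                           [:: 1; -1; 1; -1]; [:: 1; -1; -1; 1]].

Definition spectral (mu : 'M[R]_4) : 'M[R]_4 := Dmx *m mu *m Dmx^T.

End Defs.

(* o k : the element k of 'I_4 = {0,1,2,3}; paper index j corresponds to o (j-1) *)
Definition o (k : nat) : 'I_4 := inord k.

(* Main.v *)
Require Import Defs.
From HB Require Import structures.
From mathcomp Require Import all_boot all_order all_algebra all_fingroup.
From mathcomp Require Import reals.
From mathcomp Require Import complex mxtens.
From mathcomp Require Import ring lra.
Set Implicit Arguments. Unset Strict Implicit. Unset Printing Implicit Defensive.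
Import Order.TTheory GRing.Theory Num.Theory.
Local Open Scope ring_scope.

(** Writing the map as X |-> sum_kl (S_kl / 4) P_kl X P_kl, with P_kl the
    two-qubit Pauli matrices, it is completely positive iff S >= 0, and composing
    it with the transpose turns S into B(S) up to a relabelling, where
    B(Q)_kl = Q_kl + (sum of Q) / 4 - (row sum k + column sum l) / 2.
    Averaging Choi forms over Paulis shows that decomposability means
    S = P + B(Q) with P, Q >= 0.  By Farkas' lemma this says that S is
    nonnegative on the cone of all W >= 0 with B(W) >= 0.

    The 16 entries of W and the 16 entries of B(W) are the points and the blocks
    of the 16_6 Kummer configuration.  The cone is generated by 60 Goepel tetrads
    (rectangles and permutation matrices) and 192 Weber hexads (the patterns of
    the last two inequalities).  To see this, subtract from W the largest possible
    multiple of a suitable generator: a new coordinate vanishes, and one recurses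
    on a smaller face.  Modulo the symmetry group, of order 23040, this recursion
    visits 206 faces, which are listed in [certificate].

    A positive map is tested against stabilizer states: for commuting Paulis P, Q
    the operators (1 +- P)(1 +- Q) are positive, and pairing two of them through
    the map gives exactly the first two families of inequalities. *)

(** * Pauli matrices *)

(** Transposition changes the sign of sigma_4 only, and D diag(1, 1, 1, -1) D = J/2 - R, where J is
    the all-one matrix and R reverses the four indices. So the relabelling is this reversal, and B
    is the tensor square of J/2 - 1, a symmetric involution. By symmetry, the condition dual to the
    one on P and Q has the same shape, in terms of W and B(W). As B is an involution, points and
    blocks play equal roles, and symmetries may exchange the two halves of the 32 coordinates.
    Necessity of the inequalities is short, since B carries the indicator of each pattern to the
    indicator of a pattern. The difficulty is sufficiency: a cone in dimension 16 with 32
    inequalities must be shown to have no further extreme rays. The recursion is arranged so that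
    its verification is pure counting. A face is known by its vanishing coordinates, the only
    equations are the 60 equalities between the point sum and the block sum of a tetrad, and rays
    have entries 0 and 1. Being settled is a statement about functionals, so no coefficients of
    conic combinations are recorded. *)

Definition anticomm (i k : 'I_4) : bool := [&& i != 0, k != 0 & i != k].

(** Over any commutative ring and with [I] as a parameter, so that the case analysis below ends in
    goals for [ring]; the only fact about the imaginary unit is [I * I = -1]. *)
Definition pauli_entry (K : comNzRingType) (I : K) (k a b : nat) : K :=
  nth 0 (nth [::] (nth [::] [:: [:: [:: 1; 0]; [:: 0; 1]]; [:: [:: 0; 1]; [:: 1; 0]];
     [:: [:: 1; 0]; [:: 0; -1]]; [:: [:: 0; - I]; [:: I; 0]]] k) a) b.

(** Since sigma_k commutes or anticommutes with each sigma_i, expanding in the Pauli basis gives 2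
    sigma_k X sigma_k = sum_i +-Tr(sigma_i X) sigma_i. The two sides here are the coefficients of X
    at (c, d) in the entry (a, b) of that identity. *)
Lemma pauli_entry_fierz (K : comNzRingType) (I : K) (k : 'I_4) (a b c d : 'I_2) :
  I * I = -1 ->
  2 * (pauli_entry I k a c * pauli_entry I k d b) =
  \sum_(i < 4) (-1) ^+ anticomm k i * (pauli_entry I i d c * pauli_entry I i a b).
Proof.
move=> II; rewrite !big_ord_recl big_ord0.
case: k => [[|[|[|[|k]]]] lt_k] //;
case: a => [[|[|a]] lt_a] //; case: b => [[|[|b]] lt_b] //;
case: c => [[|[|c]] lt_c] //; case: d => [[|[|d]] lt_d] //;
rewrite /pauli_entry /anticomm /= -?val_eqE /= ?(expr0, expr1)
  ?(mul0r, mulr0, mul1r, mulr1, mulrN, mulNr, II, oppr0, addr0, add0r, opprK);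
by ring.
Qed.

Section PauliAlgebra.
Variable R : realType.
Local Notation C := R[i].

Lemma pauliE (k : 'I_4) (a b : 'I_2) : pauli R k a b = pauli_entry 'i k a b.
Proof. by case: k => [[|[|[|[|k]]]] lt_k]; rewrite // /pauli /= mxE. Qed.

Lemma mulii : 'i * 'i = -1 :> C. Proof. by rewrite -expr2 sqrCi. Qed.

Lemma pauli_fierz (k : 'I_4) (a b c d : 'I_2) :
  2 * (pauli R k a c * pauli R k d b) =
  \sum_(i < 4) (-1) ^+ anticomm k i * (pauli R i d c * pauli R i a b).
Proof.
rewrite !pauliE pauli_entry_fierz ?mulii //.
by apply: eq_bigr => i _; rewrite !pauliE.
Qed.

Lemma adj_pauli (k : 'I_4) : adjmx (pauli R k) = pauli R k.
Proof.
apply/matrixP => a b; rewrite !mxE !pauliE /pauli_entry.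
case: k => [[|[|[|[|k]]]] lt_k] //;
case: a => [[|[|a]] lt_a] //; case: b => [[|[|b]] lt_b] //=;
by rewrite -?(conjCi C) ?conjCK ?conjC0 ?conjC1 ?rmorphN1.
Qed.

Lemma trmx_pauli (k : 'I_4) : (pauli R k)^T = (-1) ^+ (k == 3%N :> nat) *: pauli R k.
Proof.
apply/matrixP => a b; rewrite !mxE !pauliE /pauli_entry.
case: k => [[|[|[|[|k]]]] lt_k] //;
case: a => [[|[|a]] lt_a] //; case: b => [[|[|b]] lt_b] //=;
by rewrite ?(expr0, expr1, mul1r, mulr0, mulN1r, opprK, oppr0).
Qed.

Lemma mxtrace_pauli2 (i j : 'I_4) : \tr (pauli R i *m pauli R j) = 2 * (i == j)%:R.
Proof.
have ii : ('i : C) * 'i = -1 by rewrite -expr2 sqrCi.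
rewrite /mxtrace !big_ord_recl !big_ord0 !mxE !big_ord_recl !big_ord0 !pauliE /pauli_entry.
case: i => [[|[|[|[|i]]]] lt_i] //; case: j => [[|[|[|[|j]]]] lt_j] //=;
by rewrite -?val_eqE /= ?(mul0r, mulr0, mul1r, mulr1, mulrN, mulNr, ii, oppr0, addr0,
  add0r, opprK); ring.
Qed.

(** Up to the factor 1/2, D is the character table of the Klein four-group of Paulis modulo
    phases. *)
Lemma DmxE (i k : 'I_4) : Dmx R i k = 2^-1 * (-1) ^+ anticomm i k.
Proof.
by case: i => [[|[|[|[|i]]]] lt_i] //; case: k => [[|[|[|[|k]]]] lt_k] //;
  rewrite !mxE.
Qed.

Definition pauli2 (i j : 'I_4) : 'M[C]_(2 * 2) := pauli R i *t pauli R j.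

Lemma pauli2E i j a b : pauli2 i j a b =
  pauli R i (mxtens_unindex a).1 (mxtens_unindex b).1 *
  pauli R j (mxtens_unindex a).2 (mxtens_unindex b).2.
Proof. by rewrite mxE. Qed.

Lemma DmxCE (i k : 'I_4) : (Dmx R i k)%:C%C = 2^-1 * (-1) ^+ anticomm i k.
Proof. by rewrite DmxE rmorphM /= fmorphV rmorph_sign rmorph_nat. Qed.

(** Two copies of [pauli_fierz] multiplied, with the signs and the factors 2 absorbed into D. *)
Lemma pauli2_fierz (k l : 'I_4) (a b c d : 'I_(2 * 2)) :
  pauli2 k l a c * pauli2 k l d b =
  \sum_(i < 4) \sum_(j < 4) (Dmx R k i)%:C%C * (Dmx R l j)%:C%C *
    (pauli2 i j d c * pauli2 i j a b).
Proof.
rewrite !pauli2E mulrACA.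
have half k' a' b' c' d' : pauli R k' a' c' * pauli R k' d' b' =
  \sum_(i < 4) (Dmx R k' i)%:C%C * (pauli R i d' c' * pauli R i a' b').
  have two_neq0 : (2 : C) != 0 by rewrite pnatr_eq0.
  apply: (mulfI two_neq0); rewrite (pauli_fierz k' a' b' c' d') mulr_sumr.
  by apply: eq_bigr => i _; rewrite DmxCE; field.
rewrite !half mulr_suml; apply: eq_bigr => i _.
rewrite mulr_sumr; apply: eq_bigr => j _.
by rewrite !pauli2E; ring.
Qed.

Lemma adj_pauli2 i j : adjmx (pauli2 i j) = pauli2 i j.
Proof. by rewrite /adjmx map_mxT trmx_tens -!/(adjmx _) !adj_pauli. Qed.

Lemma trmx_pauli2 i j :
  (pauli2 i j)^T = ((-1) ^+ (i == 3%N :> nat) * (-1) ^+ (j == 3%N :> nat)) *: pauli2 i j.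
Proof.
rewrite /pauli2 trmx_tens !trmx_pauli.
by apply/matrixP => a b; rewrite !mxE mulrACA.
Qed.

Lemma mxtrace_tens m n (A : 'M[C]_m) (B : 'M[C]_n) : \tr (A *t B) = \tr A * \tr B.
Proof.
rewrite /mxtrace mulr_sum; apply: eq_bigr => k _.
by case: (mxtens_indexP k) => i j; rewrite tensmxE mxtens_indexK.
Qed.

Lemma mxtrace_pauli2M i j k l :
  \tr (pauli2 i j *m pauli2 k l) = 4 * ((i == k) && (j == l))%:R.
Proof.
rewrite tensmx_mul mxtrace_tens !mxtrace_pauli2 -mulnb natrM; ring.
Qed.

Lemma DmxK : Dmx R *m Dmx R = 1%:M.
Proof.
apply/matrixP => i j; rewrite mxE !big_ord_recl big_ord0 !DmxE mxE.
case: i => [[|[|[|[|i]]]] lt_i] //; case: j => [[|[|[|[|j]]]] lt_j] //;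
by rewrite /anticomm -?val_eqE /= ?(expr0, expr1); field.
Qed.

Lemma trmx_Dmx : (Dmx R)^T = Dmx R.
Proof.
apply/matrixP => i j; rewrite mxE !DmxE /anticomm [j == i]eq_sym.
by rewrite andbCA.
Qed.

(** D is a symmetric involution, so the same transform leads back from the spectral matrix to the
    coefficients. *)
Lemma spectralK : involutive (@spectral R).
Proof.
by move=> mu; rewrite /spectral trmx_Dmx !mulmxA DmxK mul1mx -mulmxA DmxK mulmx1.
Qed.

End PauliAlgebra.

(** * Positivity and complete positivity *)

Section Psd.
Variable R : realType.
Local Notation C := R[i].

Lemma adjmxM m n p (A : 'M[C]_(m, n)) (B : 'M[C]_(n, p)) :
  adjmx (A *m B) = adjmx B *m adjmx A.
Proof. by rewrite /adjmx map_mxM trmx_mul. Qed.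

Lemma adjmxK m n (A : 'M[C]_(m, n)) : adjmx (adjmx A) = A.
Proof. by apply/matrixP => i j; rewrite !mxE conjCK. Qed.

Lemma adjmxD m n (A B : 'M[C]_(m, n)) : adjmx (A + B) = adjmx A + adjmx B.
Proof. by rewrite /adjmx map_mxD linearD. Qed.

Lemma adjmxZ m n c (A : 'M[C]_(m, n)) : adjmx (c *: A) = c^* *: adjmx A.
Proof. by rewrite /adjmx map_mxZ linearZ. Qed.

Lemma psd0 n : psd (0 : 'M[C]_n).
Proof.
split=> [|v]; first by rewrite /adjmx map_mx0 trmx0.
by rewrite mulmx0 mul0mx mxE.
Qed.

Lemma psdD n (A B : 'M[C]_n) : psd A -> psd B -> psd (A + B).
Proof.
move=> [hA pA] [hB pB]; split=> [|v]; first by rewrite adjmxD hA hB.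
by rewrite mulmxDr mulmxDl mxE addr_ge0.
Qed.

Lemma psdZ n c (A : 'M[C]_n) : 0 <= c -> psd A -> psd (c *: A).
Proof.
move=> c0 [hA pA]; split=> [|v]; first by rewrite adjmxZ hA geC0_conj.
by rewrite -scalemxAr -scalemxAl mxE mulr_ge0.
Qed.

Lemma psd_sum n (I : finType) (F : I -> 'M[C]_n) :
  (forall i, psd (F i)) -> psd (\sum_i F i).
Proof. by move=> pF; elim/big_ind: _ => //; [exact: psd0 | exact: psdD]. Qed.

Lemma psd_sandwich n m (K : 'M[C]_(m, n)) (A : 'M[C]_n) :
  psd A -> psd (K *m A *m adjmx K).
Proof.
move=> [hA pA]; split=> [|v]; first by rewrite !adjmxM adjmxK hA mulmxA.
by have := pA (adjmx K *m v); rewrite adjmxM adjmxK !mulmxA.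
Qed.

Lemma psd1 n : psd (1%:M : 'M[C]_n).
Proof.
split=> [|v]; first by rewrite /adjmx map_mx1 trmx1.
rewrite mulmx1 mxE sumr_ge0 // => i _; rewrite !mxE mulrC mul_conjC_ge0 //.
Qed.

Lemma psd_gram n m (K : 'M[C]_(n, m)) : psd (K *m adjmx K).
Proof. by have := psd_sandwich K (psd1 m); rewrite mulmx1. Qed.

Lemma psd_diag n (A : 'M[C]_n) i : psd A -> 0 <= A i i.
Proof.
move=> [_ /(_ (delta_mx i 0))].
rewrite -mulmxA -colE mxE (bigD1 i) //= big1 ?addr0 => [|j ji]; last first.
  by rewrite !mxE (negPf ji) conjC0 mul0r.
by rewrite !mxE !eqxx conjC1 mul1r.
Qed.

Lemma psd_trace n (A : 'M[C]_n) : psd A -> 0 <= \tr A.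
Proof. by move=> pA; apply: sumr_ge0 => i _; exact: psd_diag. Qed.

Lemma big_mxtens (V : nmodType) m n (F : 'I_(m * n) -> V) :
  \sum_k F k = \sum_i \sum_j F (mxtens_index (i, j)).
Proof.
rewrite pair_big /= (reindex (@mxtens_index m n)) /=; first by apply: eq_bigr => -[].
by exists (@mxtens_unindex m n) => k _; rewrite (mxtens_indexK, mxtens_unindexK).
Qed.

(** This is why a Kraus form gives complete positivity: amplifying a conjugation yields a
    conjugation again. *)
Lemma ampl_sandwich k n (K : 'M[C]_n) (X : 'M[C]_(k * n)) :
  ampl (fun Y => K *m Y *m adjmx K) X =
  ((1%:M : 'M[C]_k) *t K) *m X *m adjmx ((1%:M : 'M[C]_k) *t K).
Proof.
have tid (Y : 'M[C]_n) i a j b :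
    ((1%:M : 'M[C]_k) *t Y) (mxtens_index (i, a)) (mxtens_index (j, b)) =
    (i == j)%:R * Y a b by rewrite tensmxE mxE.
have -> : adjmx ((1%:M : 'M[C]_k) *t K) = (1%:M : 'M[C]_k) *t adjmx K.
  by rewrite /adjmx map_mxT map_mx1 trmx_tens trmx1.
apply/matrixP => p q; case: (mxtens_indexP p) => i a; case: (mxtens_indexP q) => j b.
rewrite [LHS]mxE !mxtens_indexK /= !mxE big_mxtens (bigD1 j) //=.
rewrite [X in _ + X]big1 => [|j' j'j]; last first.
  by rewrite big1 // => b' _; rewrite tid (negPf j'j) mul0r mulr0.
rewrite addr0; apply: eq_bigr => b' _; rewrite tid eqxx mul1r; congr (_ * _).
rewrite !mxE big_mxtens (bigD1 i) //= [X in _ + X]big1 => [|i' i'i]; last first.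
  by rewrite big1 // => a' _; rewrite tid eq_sym (negPf i'i) !mul0r.
by rewrite addr0; apply: eq_bigr => a' _; rewrite tid eqxx mul1r mxE.
Qed.

Lemma positive_sandwich_sum n (I : finType) (c : I -> C) (K : I -> 'M[C]_n) :
  (forall i, 0 <= c i) ->
  completely_positive (fun X => \sum_i c i *: (K i *m X *m adjmx (K i))).
Proof.
move=> c0 k X pX.
have -> : ampl (fun Y => \sum_i c i *: (K i *m Y *m adjmx (K i))) X =
    \sum_i c i *: ampl (fun Y => K i *m Y *m adjmx (K i)) X.
  by apply/matrixP => p q; rewrite mxE !summxE; apply: eq_bigr => i _; rewrite !mxE.
by apply: psd_sum => i; apply: psdZ => //; rewrite ampl_sandwich; apply: psd_sandwich.
Qed.

End Psd.

(** * Kraus forms, Choi forms and Pauli coefficients *)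

Section Maps.
Variable R : realType.
Local Notation C := R[i].
Local Notation pauli2 := (pauli2 R).

Lemma DmxC_sym (i k : 'I_4) : Dmx R i k = Dmx R k i.
Proof. by rewrite -{1}trmx_Dmx mxE. Qed.

Lemma spectralE (mu : 'M[R]_4) k l :
  spectral mu k l = \sum_i \sum_j Dmx R k i * Dmx R l j * mu i j.
Proof.
rewrite /spectral trmx_Dmx mxE exchange_big /=; apply: eq_bigr => j _.
rewrite mxE mulr_suml; apply: eq_bigr => i _.
by rewrite (DmxC_sym j l); ring.
Qed.

(** Both sides are linear in X, and comparing the coefficients of each entry [X c d] leaves
    [pauli2_fierz], weighted by the spectral matrix. *)
Lemma pauli_map_kraus (mu : 'M[R]_4) X :
  pauli_map mu X = \sum_(kl : 'I_4 * 'I_4)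
    ((spectral mu kl.1 kl.2)%:C%C / 4) *:
      (pauli2 kl.1 kl.2 *m X *m adjmx (pauli2 kl.1 kl.2)).
Proof.
apply/matrixP => a b; rewrite -(pair_big xpredT xpredT (fun k l =>
  ((spectral mu k l)%:C%C / 4) *: (pauli2 k l *m X *m adjmx (pauli2 k l)))) /=.
rewrite /pauli_map !summxE.
transitivity (\sum_i \sum_j (mu i j)%:C%C / 4 * \sum_c \sum_d
    X c d * (pauli2 i j d c * pauli2 i j a b)).
  apply: eq_bigr => i _; rewrite summxE; apply: eq_bigr => j _.
  rewrite [LHS]mxE -mulrA; congr (_ * _); rewrite /mxtrace mulr_suml exchange_big /=.
  apply: eq_bigr => d _; rewrite [(_ *m _) _ _]mxE mulr_suml; apply: eq_bigr => c _.
  by rewrite -!/(pauli2 _ _); ring.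
transitivity (\sum_k \sum_l (spectral mu k l)%:C%C / 4 * \sum_c \sum_d
    X c d * (pauli2 k l a c * pauli2 k l d b)); last first.
  apply: eq_bigr => k _; rewrite summxE; apply: eq_bigr => l _.
  rewrite [RHS]mxE adj_pauli2; congr (_ * _); rewrite mxE exchange_big /=.
  by apply: eq_bigr => d _; rewrite [(_ *m _) _ _]mxE mulr_suml; apply: eq_bigr => c _; ring.
transitivity (\sum_i \sum_j \sum_k \sum_l (spectral mu k l)%:C%C / 4 *
    ((Dmx R k i)%:C%C * (Dmx R l j)%:C%C *
      \sum_c \sum_d X c d * (pauli2 i j d c * pauli2 i j a b))).
  apply: eq_bigr => i _; apply: eq_bigr => j _.
  (* The coefficients are written as the transform of their own spectral matrix, so that it occurs
     on this side too. *)
  rewrite -{1}(spectralK mu) spectralE !rmorph_sum /= !mulr_suml.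
  apply: eq_bigr => k _; rewrite rmorph_sum /= !mulr_suml.
  apply: eq_bigr => l _; rewrite !rmorphM /= (DmxC_sym i k) (DmxC_sym j l).
  by ring.
under eq_bigr do (under eq_bigr do rewrite pair_big /=).
rewrite pair_big exchange_big /= -(pair_big xpredT xpredT (fun k l => \sum_ij
  (spectral mu k l)%:C%C / 4 * ((Dmx R k ij.1)%:C%C * (Dmx R l ij.2)%:C%C *
      \sum_c \sum_d X c d * (pauli2 ij.1 ij.2 d c * pauli2 ij.1 ij.2 a b)))) /=.
apply: eq_bigr => k _; apply: eq_bigr => l _; rewrite -mulr_sumr; congr (_ * _).
under [LHS]eq_bigr do rewrite mulr_sumr.
rewrite [LHS]exchange_big /=.
apply: eq_bigr => c _; under [LHS]eq_bigr do rewrite mulr_sumr.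
rewrite [LHS]exchange_big /=; apply: eq_bigr => d _.
rewrite pauli2_fierz pair_big mulr_sumr; apply: eq_bigr => ij _ /=; ring.
Qed.

Lemma completely_positive_pauli_map (mu : 'M[R]_4) :
  (forall k l, 0 <= spectral mu k l) -> completely_positive (pauli_map mu).
Proof.
move=> mu0 k X pX; have -> : ampl (pauli_map mu) X = ampl (fun X =>
    \sum_(kl : 'I_4 * 'I_4) ((spectral mu kl.1 kl.2)%:C%C / 4) *:
      (pauli2 kl.1 kl.2 *m X *m adjmx (pauli2 kl.1 kl.2))) X.
  by apply/matrixP => p q; rewrite !mxE pauli_map_kraus.
by apply: positive_sandwich_sum pX => -[i j]; rewrite divr_ge0 // ler0c.
Qed.

(** The amplified map, applied to the Gram matrix of the unnormalised maximally entangled vector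
    [w], is the Choi matrix. The sum is its quadratic form at the vector [u] formed by the entries
    of [v]. *)
Lemma choi_psd n (T : 'M[C]_n -> 'M[C]_n) (v : 'M[C]_n) :
  completely_positive T ->
  0 <= \sum_c \sum_d \sum_a \sum_b (v c a)^* * v d b * T (delta_mx c d) a b.
Proof.
move=> cpT; pose w : 'cV[C]_(n * n) :=
  \col_p ((mxtens_unindex p).1 == (mxtens_unindex p).2)%:R.
pose u : 'cV[C]_(n * n) := \col_p v (mxtens_unindex p).1 (mxtens_unindex p).2.
have uE c a : u (mxtens_index (c, a)) 0 = v c a by rewrite mxE mxtens_indexK.
have [_ /(_ u)] := cpT n _ (psd_gram w).
have amplE c a d b : ampl T (w *m adjmx w) (mxtens_index (c, a)) (mxtens_index (d, b)) =
    T (delta_mx c d) a b.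
  rewrite mxE !mxtens_indexK /=; congr (T _ a b); apply/matrixP => i j.
  rewrite !mxE big_ord1 !mxE !mxtens_indexK /= conjC_nat -natrM mulnb.
  by rewrite [c == i]eq_sym [d == j]eq_sym.
congr (0 <= _); rewrite mxE big_mxtens [RHS]exchange_big /=; apply: eq_bigr => d _.
under [RHS]eq_bigr do rewrite exchange_big /=.
rewrite [RHS]exchange_big /=; apply: eq_bigr => b _.
rewrite [(_ *m _) _ _]mxE big_mxtens mulr_suml; apply: eq_bigr => c _.
rewrite mulr_suml; apply: eq_bigr => a _.
by rewrite amplE [adjmx u _ _]mxE mxE !uE; ring.
Qed.

(** The diagonal of T in the Pauli basis, that is, what remains of T after averaging over
    conjugations by Paulis. These traces stand in for the average itself. *)
Definition pauli_coef (T : 'M[C]_(2 * 2) -> 'M[C]_(2 * 2)) : 'M[C]_4 :=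
  \matrix_(i, j) (\tr (pauli2 i j *m T (pauli2 i j)) / 4).

Lemma pauli_coef_pauli_map (mu : 'M[R]_4) i j :
  pauli_coef (pauli_map mu) i j = (mu i j)%:C%C.
Proof.
rewrite mxE /pauli_map mulmx_sumr raddf_sum /= (bigD1 i) //= [X in _ + X]big1; last first.
  move=> k ki; rewrite mulmx_sumr raddf_sum /= big1 // => l _.
  by rewrite -scalemxAr mxtraceZ -!/(pauli2 _ _) mxtrace_pauli2M (negPf ki) /= mulr0 mulr0 mul0r.
rewrite addr0 mulmx_sumr raddf_sum /= (bigD1 j) //= [X in _ + X]big1; last first.
  move=> l lj.
  by rewrite -scalemxAr mxtraceZ -!/(pauli2 _ _) mxtrace_pauli2M (negPf lj) andbF mulr0 mulr0 mul0r.
rewrite -scalemxAr mxtraceZ -!/(pauli2 _ _) !mxtrace_pauli2M !eqxx /= !addr0; by field.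
Qed.

Lemma pauli_coef_tr T i j :
  pauli_coef (fun X => (T X)^T) i j =
  (-1) ^+ (i == 3%N :> nat) * (-1) ^+ (j == 3%N :> nat) * pauli_coef T i j.
Proof.
rewrite !mxE -mxtrace_tr trmx_mul trmxK trmx_pauli2 -scalemxAr mxtraceZ mxtrace_mulC.
by rewrite mulrA.
Qed.

Lemma pauli_coef_cp (T : 'M[C]_(2 * 2) -> 'M[C]_(2 * 2)) k l :
  linear T -> completely_positive T ->
  0 <= \sum_i \sum_j (Dmx R k i)%:C%C * (Dmx R l j)%:C%C * pauli_coef T i j.
Proof.
move=> linT cpT; pose Tl : {linear _ -> _} := HB.pack T (GRing.isLinear.Build _ _ _ _ _ linT).
have TZ c X : T (c *: X) = c *: T X by exact: (linearZ_LR Tl).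
have := choi_psd (pauli2 k l)^T cpT.
have four_inv_gt0 : 0 < 4^-1 :> C by rewrite invr_gt0 ltr0n.
rewrite -(pmulr_rge0 _ four_inv_gt0); congr (0 <= _); rewrite mulr_sumr.
transitivity (\sum_i \sum_j \sum_c \sum_d \sum_a \sum_b
  (Dmx R k i)%:C%C * (Dmx R l j)%:C%C * (pauli2 i j b a * pauli2 i j c d) *
    T (delta_mx c d) a b / 4); last first.
  apply: eq_bigr => i _; apply: eq_bigr => j _; rewrite [pauli_coef _ _ _]mxE.
  rewrite [X in T X]matrix_sum_delta -[T _]/(Tl _) linear_sum.
  rewrite mulmx_sumr raddf_sum /= mulr_suml mulr_sumr; apply: eq_bigr => c _.
  rewrite -[T _]/(Tl _) linear_sum mulmx_sumr raddf_sum /= mulr_suml mulr_sumr.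
  apply: eq_bigr => d _; rewrite TZ -scalemxAr mxtraceZ /mxtrace /=.
  rewrite exchange_big /= mulr_sumr mulr_suml mulr_sumr; apply: eq_bigr => b _.
  rewrite [(_ *m _) _ _]mxE mulr_sumr mulr_suml mulr_sumr; apply: eq_bigr => a _.
  by ring.
under [RHS]eq_bigr do rewrite exchange_big /=.
rewrite [RHS]exchange_big /=; apply: eq_bigr => c _.
under [RHS]eq_bigr do rewrite exchange_big /=.
rewrite mulr_sumr [RHS]exchange_big /=; apply: eq_bigr => d _.
under [RHS]eq_bigr do rewrite exchange_big /=.
rewrite mulr_sumr [RHS]exchange_big /=; apply: eq_bigr => a _.
under [RHS]eq_bigr do rewrite exchange_big /=.
rewrite mulr_sumr [RHS]exchange_big /=; apply: eq_bigr => b _.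
have -> : ((pauli2 k l)^T c a)^* = pauli2 k l c a.
  by rewrite -[in RHS]adj_pauli2 !mxE.
rewrite [_^T d b]mxE pauli2_fierz !mulr_suml mulr_sumr; apply: eq_bigr => i _.
by rewrite !mulr_suml mulr_sumr; apply: eq_bigr => j _; ring.
Qed.

End Maps.

(** * Decomposable Pauli maps *)

Section Decomposable.
Variable R : realType.
Local Notation C := R[i].
Local Notation pauli2 := (pauli2 R).

Definition transpose_sign (i : 'I_4) : R := (-1) ^+ (i == 3%N :> nat).

Definition pauli_transpose (mu : 'M[R]_4) : 'M[R]_4 :=
  \matrix_(i, j) (transpose_sign i * transpose_sign j * mu i j).

Definition spectral_transpose (Q : 'M[R]_4) : 'M[R]_4 :=
  \matrix_(k, l) (Q (rev_ord k) (rev_ord l) + 4^-1 * (\sum_i \sum_j Q i j)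
    - 2^-1 * (\sum_j Q (rev_ord k) j + \sum_i Q i (rev_ord l))).

(** The sign matrix is 1 - 2 E, with E the projection to the last coordinate. Conjugation by D gives
    1 - chi chi^T / 2 with chi = (1, -1, -1, 1), which is J/2 minus the reversal. *)
Lemma Dmx_conj_sign (k m : 'I_4) :
  \sum_i Dmx R k i * transpose_sign i * Dmx R i m = 2^-1 - (m == rev_ord k)%:R.
Proof.
rewrite !big_ord_recl big_ord0 !DmxE /transpose_sign /anticomm -!val_eqE /=.
case: k => [[|[|[|[|k]]]] lt_k] //; case: m => [[|[|[|[|m]]]] lt_m] //=;
by rewrite ?(expr0, expr1); field.
Qed.

(** Transposition acts on each tensor factor through [Dmx_conj_sign]; expanding the product of the
    two factors 1/2 - delta produces the single entry, the total, the row sum and the column sum. *)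
Lemma spectral_pauli_transpose (Q : 'M[R]_4) :
  spectral (pauli_transpose (spectral Q)) = spectral_transpose Q.
Proof.
apply/matrixP => k l; rewrite spectralE mxE.
transitivity (\sum_m \sum_n (2^-1 - (m == rev_ord k)%:R) *
                            ((2^-1 - (n == rev_ord l)%:R) * Q m n)).
  transitivity (\sum_i \sum_j \sum_m \sum_n
      (Dmx R k i * transpose_sign i * Dmx R i m) *
      (Dmx R l j * transpose_sign j * Dmx R j n * Q m n)).
    apply: eq_bigr => i _; apply: eq_bigr => j _.
    rewrite [pauli_transpose _ _ _]mxE spectralE !mulr_sumr; apply: eq_bigr => m _.
    by rewrite !mulr_sumr; apply: eq_bigr => n _; ring.
  under eq_bigr do (under eq_bigr do rewrite pair_big /=).
  rewrite pair_big exchange_big /= [RHS]pair_big /=; apply: eq_bigr => mn _.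
  rewrite -!Dmx_conj_sign mulrA big_distrlr /= pair_big mulr_suml.
  by apply: eq_bigr => ij _; rewrite mulrA.
have half_sub_delta i (F : 'I_4 -> R) :
    \sum_m (2^-1 - (m == i)%:R) * F m = 2^-1 * (\sum_m F m) - F i.
  under eq_bigr do rewrite mulrBl.
  rewrite sumrB -mulr_sumr; congr (_ - _).
  by rewrite (bigD1 i) //= eqxx mul1r big1 ?addr0 // => m /negPf ->; rewrite mul0r.
under eq_bigr do rewrite -mulr_sumr half_sub_delta.
by rewrite half_sub_delta sumrB -mulr_sumr; field.
Qed.

Lemma spectralD (P Q : 'M[R]_4) : spectral (P + Q) = spectral P + spectral Q.
Proof. by rewrite /spectral mulmxDr mulmxDl. Qed.

Lemma pauli_mapD (mu nu : 'M[R]_4) X :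
  pauli_map (mu + nu) X = pauli_map mu X + pauli_map nu X.
Proof.
rewrite /pauli_map -big_split; apply: eq_bigr => i _; rewrite -big_split.
by apply: eq_bigr => j _; rewrite mxE rmorphD !mulrDl scalerDl.
Qed.

Lemma pauli_map_linear (mu : 'M[R]_4) : linear (pauli_map mu).
Proof.
move=> c X Y; rewrite /pauli_map scaler_sumr -big_split; apply: eq_bigr => i _.
rewrite scaler_sumr -big_split; apply: eq_bigr => j _ /=.
rewrite mulmxDr mxtraceD -scalemxAr mxtraceZ mulrDr scalerDl scalerA.
by congr (_ *: _ + _); ring.
Qed.

Lemma pauli_map_transpose (mu : 'M[R]_4) X :
  pauli_map (pauli_transpose mu) X = (pauli_map mu X)^T.
Proof.
rewrite /pauli_map linear_sum; apply: eq_bigr => i _.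
rewrite linear_sum; apply: eq_bigr => j _ /=.
rewrite linearZ /= -!/(pauli2 _ _) trmx_pauli2 scalerA; congr (_ *: _).
by rewrite mxE /transpose_sign !rmorphM !rmorph_sign; ring.
Qed.

(** Being nonnegative in the order of the complex numbers includes being real, so [pauli_coef_cp]
    already puts the transformed coefficients into R. *)
Lemma pauli_coef_real (T : 'M[C]_(2 * 2) -> 'M[C]_(2 * 2)) :
  linear T -> completely_positive T ->
  exists2 P : 'M[R]_4, (forall k l, 0 <= P k l) &
    pauli_coef T = map_mx (real_complex R) (spectral P).
Proof.
move=> linT cpT; set m := pauli_coef T.
pose Dc := map_mx (real_complex R) (Dmx R).
have DcK : Dc *m Dc = 1%:M by rewrite -map_mxM DmxK map_mx1.
have DmD k l : (Dc *m m *m Dc) k l =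
    \sum_i \sum_j (Dmx R k i)%:C%C * (Dmx R l j)%:C%C * m i j.
  rewrite mxE exchange_big /=; apply: eq_bigr => j _.
  rewrite [(_ *m _) _ _]mxE mulr_suml; apply: eq_bigr => i _.
  by rewrite [Dc k i]mxE [Dc j l]mxE (DmxC_sym R j l); ring.
have DmD_ge0 k l : 0 <= (Dc *m m *m Dc) k l by rewrite DmD pauli_coef_cp.
pose P : 'M[R]_4 := \matrix_(k, l) complex.Re ((Dc *m m *m Dc) k l).
exists P => [k l|]; first by have := DmD_ge0 k l; rewrite [P k l]mxE lecE => /andP[].
have PE : map_mx (real_complex R) P = Dc *m m *m Dc.
  apply/matrixP => k l; have := DmD_ge0 k l; rewrite lecE => /andP[/eqP im0 _].
  rewrite [LHS]mxE [P k l]mxE; apply/eqP; rewrite eq_complex /= eqxx /=.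
  by rewrite im0.
rewrite /spectral trmx_Dmx !map_mxM -/Dc PE !mulmxA DcK mul1mx.
by rewrite -mulmxA DcK mulmx1.
Qed.

(** The summands of a decomposition may be arbitrary completely positive maps, but passing to Pauli
    coefficients is additive and recovers [mu] from [pauli_map mu], so P and Q are read off from the
    coefficients of T and S'. Conversely P and Q give Pauli maps as summands. *)
Lemma decomposable_pauli_map (mu : 'M[R]_4) :
  decomposable (pauli_map mu) <->
  exists P Q : 'M[R]_4, [/\ forall k l, 0 <= P k l, forall k l, 0 <= Q k l &
    spectral mu = P + spectral_transpose Q].
Proof.
split=> [[T [S' [linT linS cpT cpS muE]]]|[P [Q [P0 Q0 muE]]]].
  have [P P0 TE] := pauli_coef_real linT cpT.
  have [Q Q0 SE] := pauli_coef_real linS cpS.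
  exists P, Q; split=> //; rewrite -spectral_pauli_transpose -[in RHS](spectralK P).
  rewrite -spectralD; congr spectral; apply/matrixP => i j.
  have inj := @fmorph_inj _ _ (real_complex R).
  apply: inj; rewrite -[LHS]/((mu i j)%:C%C) -[LHS]pauli_coef_pauli_map.
  have -> : pauli_coef (pauli_map mu) i j =
      pauli_coef T i j + pauli_coef (fun X => (S' X)^T) i j.
    by rewrite !mxE muE mulmxDr mxtraceD mulrDl.
  rewrite pauli_coef_tr TE SE [map_mx _ _ _ _]mxE [in X in _ + X]mxE [in RHS]mxE.
  by rewrite [pauli_transpose _ _ _]mxE /transpose_sign rmorphD !rmorphM !rmorph_sign.
exists (pauli_map (spectral P)), (pauli_map (spectral Q)).
split; [exact: pauli_map_linear|exact: pauli_map_linear| | |].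
- by apply: completely_positive_pauli_map => k l; rewrite spectralK.
- by apply: completely_positive_pauli_map => k l; rewrite spectralK.
move=> X; rewrite -pauli_map_transpose -pauli_mapD; congr (pauli_map _ X).
apply: (can_inj (@spectralK R)).
by rewrite spectralD spectralK spectral_pauli_transpose.
Qed.

End Decomposable.

(** * Stabilizer states *)

Section Stabilizer.
Variable R : realType.
Local Notation C := R[i].
Local Notation pauli2 := (pauli2 R).

Lemma pauli_sqr (k : 'I_4) : pauli R k *m pauli R k = 1%:M.
Proof.
have ii := mulii R.
apply/matrixP => a b; rewrite mxE !big_ord_recl big_ord0 !pauliE /pauli_entry mxE.
case: k => [[|[|[|[|k]]]] lt_k] //; case: a => [[|[|a]] lt_a] //; case: b => [[|[|b]] lt_b] //=;
by rewrite -?val_eqE /= ?(mul0r, mulr0, mul1r, mulr1, mulrN, mulNr, ii, oppr0, addr0, add0r, opprK).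
Qed.

Lemma pauli2_sqr i j : pauli2 i j *m pauli2 i j = 1%:M.
Proof.
rewrite /pauli2 tensmx_mul !pauli_sqr; apply/matrixP => a b; rewrite !mxE -natrM mulnb.
by rewrite -[a in RHS]mxtens_unindexK -[b in RHS]mxtens_unindexK (can_eq (@mxtens_indexK 2 2)).
Qed.

Lemma pauli2_00 : pauli2 0 0 = 1%:M.
Proof.
have p0 : pauli R 0 = 1%:M.
  apply/matrixP => -[[|[|a]] lt_a] // [[|[|b]] lt_b] //; rewrite pauliE mxE //.
by have := pauli2_sqr 0 0; rewrite /pauli2 tensmx_mul p0 mul1mx.
Qed.

Lemma trace_gram_ge0 n m (K : 'M[C]_(n, m)) (X : 'M[C]_n) :
  psd X -> 0 <= \tr (K *m adjmx K *m X).
Proof.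
move=> /(psd_sandwich (adjmx K)); rewrite adjmxK => /psd_trace.
by rewrite mxtrace_mulC mulmxA.
Qed.

Section Group.
Variables (a b c : 'I_4 * 'I_4) (s : bool).
Hypotheses (a0 : a != (0, 0)) (b0 : b != (0, 0)) (c0 : c != (0, 0)).
Hypotheses (ab : a != b) (ac : a != c) (bc : b != c).
Local Notation P x := (pauli2 x.1 x.2).
Hypothesis abE : P a *m P b = (-1) ^+ s *: P c.
Hypothesis baE : P b *m P a = (-1) ^+ s *: P c.

(** Four times the projection onto a joint eigenvector of the commuting Paulis [P a] and [P b]; the
    signs select the eigenvalues. *)
Definition stabilizer (e f : bool) : 'M[C]_(2 * 2) :=
  (1%:M + (-1) ^+ e *: P a) *m (1%:M + (-1) ^+ f *: P b).

Lemma stabilizerE e f : stabilizer e f =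
  pauli2 0 0 + (-1) ^+ e *: P a + (-1) ^+ f *: P b + ((-1) ^+ (e (+) f) * (-1) ^+ s) *: P c.
Proof.
rewrite /stabilizer !mulmxDl !mulmxDr !mul1mx !mulmx1 -!scalemxAl -!scalemxAr abE.
rewrite pauli2_00 signr_addb.
by apply/matrixP => i j; move: (P a) (P b) (P c) => A B D; rewrite !mxE; ring.
Qed.

(** The operator is self-adjoint and squares to four times itself. Written as a Gram matrix it can
    be used both as a positive input and as a positive functional. *)
Lemma stabilizer_gram e f :
  4 *: stabilizer e f = stabilizer e f *m adjmx (stabilizer e f).
Proof.
have adjE : adjmx (stabilizer e f) = stabilizer e f.
  rewrite stabilizerE !adjmxD !adjmxZ !adj_pauli2 rmorphM /=.
  by rewrite !(rmorphXn, rmorphN1).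
have signs (g : bool) : (-1) ^+ g * (-1) ^+ g = 1 :> C by rewrite -signr_addb addbb.
have proj x (g : bool) : (1%:M + (-1) ^+ g *: P x) *m (1%:M + (-1) ^+ g *: P x) =
    2 *: (1%:M + (-1) ^+ g *: P x).
  rewrite !mulmxDl !mulmxDr !mul1mx !mulmx1 -scalemxAl -scalemxAr scalerA signs scale1r.
  rewrite pauli2_sqr; apply/matrixP => i j.
  by move: (P x) => A; rewrite !mxE; ring.
have comm : (1%:M + (-1) ^+ f *: P b) *m (1%:M + (-1) ^+ e *: P a) =
    (1%:M + (-1) ^+ e *: P a) *m (1%:M + (-1) ^+ f *: P b).
  rewrite !mulmxDl !mulmxDr !mul1mx !mulmx1 -!scalemxAl -!scalemxAr abE baE.
  by apply/matrixP => i j; move: (P a) (P b) (P c) => A B D; rewrite !mxE; ring.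
rewrite adjE /stabilizer; move: comm (proj a e) (proj b f).
move: (1%:M + _) (1%:M + _) => A B AB AA BB.
by rewrite mulmxA -(mulmxA A B A) AB mulmxA AA -!scalemxAl -mulmxA BB -scalemxAr scalerA -natrM.
Qed.

(** The image of [stabilizer e f] is paired with [stabilizer false false]. By orthogonality of the
    Paulis only the four members of the group contribute, each with the product of its two signs;
    the sign [s] occurs in both factors and cancels. *)
Lemma positive_stabilizer (mu : 'M[R]_4) (e f : bool) :
  positive_map (pauli_map mu) ->
  0 <= mu 0 0 + (-1) ^+ e * mu a.1 a.2 + (-1) ^+ f * mu b.1 b.2
     + (-1) ^+ (e (+) f) * mu c.1 c.2.
Proof.
move=> pos; have four_gt0 : 0 < 4 :> C by rewrite ltr0n.
have pX : psd (stabilizer e f).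
  suff -> : stabilizer e f = 4^-1 *: (stabilizer e f *m adjmx (stabilizer e f)).
    by apply: psdZ (psd_gram _); rewrite invr_ge0 ltW.
  by rewrite -stabilizer_gram scalerA mulVf ?scale1r // gt_eqF.
have := trace_gram_ge0 (stabilizer false false) (pos _ pX).
rewrite -stabilizer_gram -scalemxAl mxtraceZ pmulr_rge0 //.
(* The coefficient of the Pauli [P x] in [stabilizer e' f']. *)
pose t (e' f' : bool) (x : 'I_4 * 'I_4) : C :=
  (x == (0, 0))%:R + (-1) ^+ e' * (x == a)%:R + (-1) ^+ f' * (x == b)%:R
  + (-1) ^+ (e' (+) f') * (-1) ^+ s * (x == c)%:R.
have tE e' f' x : \tr (P x *m stabilizer e' f') = 4 * t e' f' x.
  rewrite stabilizerE !mulmxDr -!scalemxAr !mxtraceD !mxtraceZ !mxtrace_pauli2M.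
  by rewrite -!xpair_eqE -!surjective_pairing /t; ring.
have -> : \tr (stabilizer false false *m pauli_map mu (stabilizer e f)) =
    4 * \sum_x (mu x.1 x.2)%:C%C * (t e f x * t false false x).
  rewrite /pauli_map pair_big mulmx_sumr raddf_sum mulr_sumr; apply: eq_bigr => x _ /=.
  by rewrite -scalemxAr mxtraceZ [X in _ * X]mxtrace_mulC -!/(pauli2 _ _) !tE; field.
rewrite pmulr_rge0 // -ler0c; congr (0 <= _).
rewrite (bigD1 (0, 0)) // (bigD1 a) //= (bigD1 b) ?b0 ?[b == a]eq_sym //=.
rewrite (bigD1 c) ?c0 ?[c == a]eq_sym ?[c == b]eq_sym ?ac ?bc //=.
rewrite big1 => [|x /andP[/andP[/andP[/negPf x0 /negPf xa] /negPf xb] /negPf xc]]; last first.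
  by rewrite /t x0 xa xb xc /=; ring.
rewrite /t !eqxx ![(0, 0) == _]eq_sym (negPf a0) (negPf b0) (negPf c0).
rewrite [b == a]eq_sym [c == a]eq_sym [c == b]eq_sym (negPf ab) (negPf ac) (negPf bc).
rewrite !rmorphD !rmorphM !rmorph_sign /=.
by case: (s) => /=; rewrite ?expr0 ?expr1; ring.
Qed.

End Group.
End Stabilizer.

(** * Positive maps: rectangle sums *)

Section PositiveInequalities.
Variable R : realType.

(** Two distinct characters of the Klein four-group agree exactly on a subgroup of order two, here
    generated by [i0], and cancel elsewhere. *)
Lemma Dmx_pair (k k' : 'I_4) : k != k' ->
  exists2 i0 : 'I_4, i0 != 0 & exists e : bool,
    forall i, Dmx R k i + Dmx R k' i = (i == 0)%:R + (-1) ^+ e * (i == i0)%:R.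
Proof.
suff key : k != k' -> exists2 i0 : 'I_4, i0 != 0 &
    forall i, (anticomm k i == anticomm k' i) = (i == 0) || (i == i0).
  move=> /key[i0 i00 i0E]; exists i0 => //; exists (anticomm k i0) => i.
  rewrite !DmxE; have := i0E i; case: (eqVneq i 0) => [-> _|i_neq0].
    by rewrite [0 == i0]eq_sym (negPf i00) /anticomm eqxx !andbF expr0 /=; field.
  case: (eqVneq i i0) => [-> /eqP ->|_ /=]; first by rewrite /=; field.
  by case: (anticomm k i); case: (anticomm k' i) => // _; rewrite ?expr0 ?expr1 /=; field.
have lt1 : (1 < 4)%N by []. have lt2 : (2 < 4)%N by []. have lt3 : (3 < 4)%N by [].
case: k => [[|[|[|[|k]]]] lt_k] //; case: k' => [[|[|[|[|k']]]] lt_k'] // _;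
first [exists (Ordinal lt1) => //; by case=> [[|[|[|[|i]]]] lt_i]
      |exists (Ordinal lt2) => //; by case=> [[|[|[|[|i]]]] lt_i]
      |exists (Ordinal lt3) => //; by case=> [[|[|[|[|i]]]] lt_i]].
Qed.

(** By [Dmx_pair] in both factors, a rectangle sum of the spectral matrix involves only four
    coefficients, those of the group generated by sigma_i0 in the first factor and sigma_j0 in the
    second. The stabilizer states of this group are product states. *)
Lemma positive_rectangle (mu : 'M[R]_4) (k k' l l' : 'I_4) :
  positive_map (pauli_map mu) -> k != k' -> l != l' ->
  0 <= spectral mu k l + spectral mu k l' + spectral mu k' l + spectral mu k' l'.
Proof.
move=> pos /Dmx_pair[i0 i00 [e De]] /Dmx_pair[j0 j00 [f Df]].
have i0P : (i0, 0) != (0, 0) :> 'I_4 * 'I_4 by rewrite xpair_eqE (negPf i00).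
have j0P : (0, j0) != (0, 0) :> 'I_4 * 'I_4 by rewrite xpair_eqE (negPf j00) andbF.
have ijP : (i0, j0) != (0, 0) :> 'I_4 * 'I_4 by rewrite xpair_eqE (negPf i00).
have ab : (i0, 0) != (0, j0) :> 'I_4 * 'I_4 by rewrite xpair_eqE (negPf i00).
have ac : (i0, 0) != (i0, j0) :> 'I_4 * 'I_4.
  by rewrite xpair_eqE [_ == j0]eq_sym (negPf j00) andbF.
have bc : (0, j0) != (i0, j0) :> 'I_4 * 'I_4 by rewrite xpair_eqE eq_sym (negPf i00).
have p0 : pauli R 0 = 1%:M.
  by apply/matrixP => -[[|[|a]] lt_a] // [[|[|b]] lt_b] //; rewrite pauliE mxE.
have := @positive_stabilizer R _ _ _ false i0P j0P ijP ab ac bc _ _ mu e f pos.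
rewrite /pauli2 /= !tensmx_mul p0 !mulmx1 !mul1mx scale1r => /(_ erefl erefl).
congr (0 <= _); rewrite !spectralE -!big_split /=.
transitivity (\sum_i ((i == 0)%:R + (-1) ^+ e * (i == i0)%:R) *
   \sum_j ((j == 0)%:R + (-1) ^+ f * (j == j0)%:R) * mu i j).
  have delta (x y : 'I_4) (s : R) (F : 'I_4 -> R) : y != x ->
      \sum_z ((z == x)%:R + s * (z == y)%:R) * F z = F x + s * F y.
    move=> yx; rewrite (bigD1 x) // (bigD1 y) //= big1 => [|z /andP[/negPf zx /negPf zy]].
      by rewrite !eqxx [x == y]eq_sym (negPf yx) /=; ring.
    by rewrite zx zy /=; ring.
  by rewrite !delta // signr_addb; ring.
apply: eq_bigr => i _; rewrite mulr_sumr -!big_split /=; apply: eq_bigr => j _.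
by rewrite -De -Df; ring.
Qed.

End PositiveInequalities.

(** * Positive maps: permutation sums *)

Section PositivePermutation.
Variable R : realType.
Local Notation C := R[i].

Lemma pauli_anticomm (x y z : 'I_4) :
  [/\ x != 0, y != 0 & z != 0] -> uniq [:: x; y; z] ->
  exists e : bool,
    pauli R x *m pauli R y = ((-1) ^+ e * 'i) *: pauli R z /\
    pauli R y *m pauli R x = - ((-1) ^+ e * 'i) *: pauli R z.
Proof.
have ii := mulii R.
(* The indices 1, 2, 3 stand for X, Z, Y, the reverse of the usual cyclic order, so pairs in
   increasing cyclic order have product -i times the third matrix. *)
suff key (e : bool) (a b : 'I_2) : [/\ x != 0, y != 0 & z != 0] -> uniq [:: x; y; z] ->
    e = ((val x, val y) \in [:: (1, 2); (2, 3); (3, 1)]%N) ->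
    (pauli R x *m pauli R y) a b = (-1) ^+ e * 'i * pauli R z a b /\
    (pauli R y *m pauli R x) a b = - ((-1) ^+ e * 'i * pauli R z a b).
  move=> nz xyz; eexists; split; apply/matrixP => a b; have [l r] := key _ a b nz xyz erefl;
  by rewrite ?l ?r [RHS]mxE ?mulNr.
rewrite !mxE !big_ord_recl !big_ord0 !pauliE /pauli_entry => -[].
case: x => [[|[|[|[|x]]]] lt_x] //; case: y => [[|[|[|[|y]]]] lt_y] //;
case: z => [[|[|[|[|z]]]] lt_z] // _ _ _ _ ->;
case: a => [[|[|a]] lt_a] //; case: b => [[|[|b]] lt_b] //=;
by rewrite ?inE /= ?(expr0, expr1) ?(mul0r, mulr0, mul1r, mulr1, mulN1r, mulrN,
  mulNr, ii, oppr0, addr0, add0r, opprK).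
Qed.

(** In each tensor factor the two Paulis anticommute, so their tensor products commute. The two
    factors i multiply to -1, which accounts for the negation of the combined sign. These groups
    belong to maximally entangled states. *)
Lemma pauli2_line (x y z : 'I_4) :
  [/\ x != 0, y != 0 & z != 0] -> uniq [:: x; y; z] ->
  exists s : bool,
    pauli2 R 1 x *m pauli2 R 2 y = (-1) ^+ s *: pauli2 R 3 z /\
    pauli2 R 2 y *m pauli2 R 1 x = (-1) ^+ s *: pauli2 R 3 z.
Proof.
have ii := mulii R.
have [//|e0 [e0l e0r]] := @pauli_anticomm 1 2 3 _ isT.
move=> nz xyz; have [e [el er]] := pauli_anticomm nz xyz.
exists (~~ (e0 (+) e)); rewrite /pauli2 !tensmx_mul e0l e0r el er.
have sgn : (-1) ^+ e0 * 'i * ((-1) ^+ e * 'i) = (-1) ^+ (~~ (e0 (+) e)) :> C.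
  by rewrite signrN signr_addb mulrACA ii mulrN1.
by split; apply/matrixP => a b; rewrite !mxE -sgn; ring.
Qed.

(** [anticomm] on natural numbers, for evaluation by [vm_compute]. *)
Definition anticommn (i k : nat) : bool := [&& i != 0, k != 0 & i != k]%N.

(** The sum over m of [D m i * D (p m) j] has four terms of absolute value 1/4, and this is the
    number of negative ones. Counts 0, 2 and 4 give the values 1, 0 and -1. *)
Definition sign_count (p : seq nat) (i j : nat) : nat :=
  count (fun m => anticommn m i (+) anticommn (nth 0%N p m) j) (iota 0 4).

(* Every permutation of the Klein four-group is affine, so its matrix
   becomes a signed permutation matrix in the basis of characters. *)
Definition affine_data (p : seq nat) (t : seq nat) (g : seq bool) : bool :=
  all (fun i => all (fun j => sign_count p i j ==
    if j == nth 0 t i then if nth false g i then 4 else 0 else 2)%N (iota 0 4)) (iota 0 4).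

(** The linear part of the affine map permutes the nontrivial characters, which is [t]. The
    translation part contributes the signs; these form a character themselves, so the last is the
    product of the two before it. *)
Lemma affine_dataP (p : seq nat) : p \in permutations (iota 0 4) ->
  exists (t : seq nat) (e f : bool), t \in permutations (iota 1 3) /\
    affine_data p (0%N :: t) [:: false; e; f; e (+) f].
Proof.
have : all (fun p => has (fun t => has (fun e => has (fun f =>
    affine_data p (0%N :: t) [:: false; e; f; e (+) f]) [:: true; false]) [:: true; false])
    (permutations (iota 1 3))) (permutations (iota 0 4)) by vm_compute.
move=> /allP tab /tab /hasP[t tP /hasP[e _ /hasP[f _ D]]].
by exists t, e, f.
Qed.

(** Transforming the permutation matrix of s by D leaves the four coefficients at (0, 0), (1, x),
    (2, y), (3, z), with signs as in [positive_stabilizer] for the group of [pauli2_line]. *)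
Lemma positive_permutation (mu : 'M[R]_4) (s : 'S_4) :
  positive_map (pauli_map mu) -> 0 <= \sum_m spectral mu m (s m).
Proof.
move=> pos; pose p := [seq val (s m) | m <- enum 'I_4].
have pE (m : 'I_4) : nth 0%N p m = s m.
  by rewrite (nth_map ord0) ?size_enum_ord // nth_ord_enum.
have p_perm : p \in permutations (iota 0 4).
  rewrite mem_permutations -val_enum_ord /p map_comp; apply: perm_map.
  apply: uniq_perm => [||m]; first by rewrite (map_inj_uniq perm_inj) enum_uniq.
    exact: enum_uniq.
  rewrite mem_enum; apply/mapP; exists ((s^-1)%g m); rewrite ?mem_enum //.
  by rewrite permKV.
have [t [e [f [tP D]]]] := affine_dataP p_perm.
(* Conjugating by D turns the matrix of s into a signed permutation matrix fixing 0. *)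
have Dsum (i j : 'I_4) : \sum_m Dmx R m i * Dmx R (s m) j =
    (if j == nth 0%N (0%N :: t) i :> nat
     then (-1) ^+ (nth false [:: false; e; f; e (+) f] i) else 0).
  have /allP/(_ (val i)) := D; rewrite mem_iota ltn_ord => /(_ isT)/allP/(_ (val j)).
  rewrite mem_iota ltn_ord => /(_ isT)/eqP cnt.
  transitivity (1 - 2^-1 * (sign_count p i j)%:R : R).
    rewrite /sign_count /= !natrD -[in nth _ p 0%N]/(val (ord0 : 'I_4)).
    rewrite !big_ord_recl big_ord0 /= addr0.
    have term (m : 'I_4) : Dmx R m i * Dmx R (s m) j =
        4^-1 - 2^-1 * (anticommn m i (+) anticommn (nth 0%N p m) j)%:R.
      rewrite !DmxE pE -!/(anticommn _ _) /anticomm -!val_eqE.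
      rewrite -/(anticommn m i) -/(anticommn (s m) j).
      by case: (anticommn m i); case: (anticommn _ j); rewrite /= ?expr0 ?expr1; field.
    by rewrite !term /=; field.
  rewrite cnt; case: ifP => // _; last by field.
  by case: (nth false _ _); rewrite ?expr0 ?expr1; field.
have t_uniq : uniq (0%N :: t).
  have := tP; rewrite mem_permutations => tperm.
  by rewrite -[0%N :: t]/([:: 0%N] ++ t) (perm_uniq (s2 := iota 0 4)) // perm_cons.
have [x [y [z tE]]] : exists x y z : 'I_4, t = [:: val x; val y; val z].
  have t_lt m : m \in t -> (m < 4)%N.
    by move: tP; rewrite mem_permutations => /perm_mem ->; rewrite mem_iota => /andP[].
  have : size t = 3%N by move: tP; rewrite mem_permutations => /perm_size ->.
  case: t t_lt {tP D Dsum t_uniq} => [|x [|y [|z [|]]]] // t_lt _.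
  have ltx : (x < 4)%N by rewrite t_lt ?inE ?eqxx.
  have lty : (y < 4)%N by rewrite t_lt ?inE ?eqxx ?orbT.
  have ltz : (z < 4)%N by rewrite t_lt ?inE ?eqxx ?orbT.
  by exists (Ordinal ltx), (Ordinal lty), (Ordinal ltz).
move: Dsum t_uniq; rewrite {}tE => Dsum; rewrite -[uniq _]/(uniq (map val [:: 0; x; y; z])).
rewrite (map_inj_uniq val_inj) => /andP[nz xyz].
have xyz0 : [/\ x != 0, y != 0 & z != 0].
  by move: nz; rewrite !inE !negb_or ![0 == _]eq_sym => /and3P.
have [sg [abE baE]] := pauli2_line xyz0 xyz.
have xP : (1, x) != (0, 0) :> 'I_4 * 'I_4 by [].
have yP : (2, y) != (0, 0) :> 'I_4 * 'I_4 by [].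
have zP : (3, z) != (0, 0) :> 'I_4 * 'I_4 by [].
have := @positive_stabilizer R (1, x) (2, y) (3, z) sg xP yP zP isT isT isT abE baE mu e f pos.
congr (0 <= _); rewrite /=.
transitivity (\sum_i \sum_j (\sum_m Dmx R m i * Dmx R (s m) j) * mu i j); last first.
  under [RHS]eq_bigr do rewrite spectralE.
  rewrite [RHS]exchange_big /=; apply: eq_bigr => i _.
  rewrite [RHS]exchange_big /=; apply: eq_bigr => j _.
  by rewrite mulr_suml.
have pick (k : 'I_4) (c : R) (F : 'I_4 -> R) :
    \sum_(j < 4) (if j == k :> nat then c else 0) * F j = c * F k.
  rewrite (bigD1 k) //= eqxx big1 ?addr0 // => j.
  by rewrite -val_eqE => /negPf ->; rewrite mul0r.
under [RHS]eq_bigr do under eq_bigr do rewrite Dsum.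
have sum4 (F : 'I_4 -> R) : \sum_i F i = F 0 + F 1 + F 2 + F 3.
  by rewrite !big_ord_recl big_ord0 addr0 !addrA; congr (F _ + F _ + F _ + F _); apply: val_inj.
rewrite sum4; congr (_ + _ + _ + _).
- by rewrite -[LHS]mul1r; exact: esym (pick 0 1 _).
- exact: esym (pick x _ _).
- exact: esym (pick y _ _).
- exact: esym (pick z _ _).
Qed.

End PositivePermutation.

(** * The cone of Kummer tetrads and hexads *)

(** In each shape the first list holds points and the second blocks: B carries the indicator matrix
    of the first list to that of the second. A shape is therefore one element of the cone, recorded
    together with its image. *)
Definition tetrad_block : seq (nat * nat) * seq (nat * nat) :=
  ([:: (0, 0); (0, 1); (1, 0); (1, 1)], [:: (2, 2); (2, 3); (3, 2); (3, 3)])%N.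
Definition tetrad_diag : seq (nat * nat) * seq (nat * nat) :=
  ([:: (0, 0); (1, 1); (2, 2); (3, 3)], [:: (0, 0); (1, 1); (2, 2); (3, 3)])%N.
Definition hexad_row : seq (nat * nat) * seq (nat * nat) :=
  ([:: (0, 0); (1, 1); (2, 2); (3, 0); (3, 1); (3, 2)],
   [:: (0, 0); (1, 1); (2, 2); (0, 3); (1, 3); (2, 3)])%N.
Definition hexad_col : seq (nat * nat) * seq (nat * nat) :=
  (hexad_row.2, hexad_row.1).

(* Coordinate [4 k + l] is the entry (k, l) of W and [16 + 4 k + l] that of B(W). *)
Definition place (sh : seq (nat * nat) * seq (nat * nat)) (p q : seq nat) : seq nat :=
  sort leq ([seq 4 * nth 0 p c.1 + nth 0 q c.2 | c <- sh.1] ++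
            [seq 16 + (4 * nth 0 p c.1 + nth 0 q c.2) | c <- sh.2])%N.

(** One permutation for each two-element set, as a rectangle depends only on its set of rows and its
    set of columns. *)
Definition pair_splits : seq (seq nat) :=
  [:: [:: 0; 1; 2; 3]; [:: 0; 2; 1; 3]; [:: 0; 3; 1; 2];
      [:: 1; 2; 0; 3]; [:: 1; 3; 0; 2]; [:: 2; 3; 0; 1]]%N.
(** One permutation for each choice of the last element: permuting the first three rows and the
    first three columns simultaneously fixes a hexad, so this choice and a permutation of the
    columns determine it. *)
Definition point_splits : seq (seq nat) :=
  [:: [:: 1; 2; 3; 0]; [:: 0; 2; 3; 1]; [:: 0; 1; 3; 2]; [:: 0; 1; 2; 3]]%N.
Definition perms4 : seq (seq nat) := permutations (iota 0 4).

Definition tetrads : seq (seq nat) := Eval vm_compute in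
  [seq place tetrad_block p q | p <- pair_splits, q <- pair_splits] ++
  [seq place tetrad_diag (iota 0 4) q | q <- perms4].
Definition hexads : seq (seq nat) := Eval vm_compute in
  [seq place hexad_row p q | p <- point_splits, q <- perms4] ++
  [seq place hexad_col p q | p <- point_splits, q <- perms4].
Definition rays : seq (seq nat) := tetrads ++ hexads.

(* A node records the coordinates that vanish on a face, certificates that
   further coordinates vanish there, the index of a ray to be subtracted, and
   for each coordinate [p] of that ray a reason why the facet [p = 0] is
   settled: certificates, an earlier node, and a word in [symmetries] carrying
   the face of that node onto this facet. *)
Definition node : Type :=
  (seq nat * seq (seq nat) * nat * seq (seq (seq nat) * nat * seq nat))%type.

(** Each list gives the images of the 32 coordinates. Some of these automorphisms, such as the
    second, exchange points and blocks; others, such as the first, preserve points but do not come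
    from permuting rows and columns. *)
Definition symmetries : seq (seq nat) :=
  [:: [:: 13; 7; 14; 4; 2; 8; 1; 11; 5; 15; 6; 12; 10; 0; 9; 3; 22; 28; 21; 31; 25; 19; 26; 16; 30; 20; 29; 23; 17; 27; 18; 24];
      [:: 20; 29; 17; 24; 27; 18; 30; 23; 26; 19; 31; 22; 21; 28; 16; 25; 9; 0; 12; 5; 6; 15; 3; 10; 7; 14; 2; 11; 8; 1; 13; 4];
      [:: 0; 13; 8; 5; 1; 12; 9; 4; 10; 7; 2; 15; 11; 6; 3; 14; 25; 20; 17; 28; 24; 21; 16; 29; 19; 30; 27; 22; 18; 31; 26; 23];
      [:: 8; 10; 3; 1; 14; 12; 5; 7; 0; 2; 11; 9; 6; 4; 13; 15; 18; 16; 25; 27; 20; 22; 31; 29; 26; 24; 17; 19; 28; 30; 23; 21];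
      [:: 14; 1; 5; 10; 11; 4; 0; 15; 8; 7; 3; 12; 13; 2; 6; 9; 25; 22; 18; 29; 28; 19; 23; 24; 31; 16; 20; 27; 26; 21; 17; 30];
      [:: 8; 9; 15; 14; 5; 4; 2; 3; 12; 13; 11; 10; 1; 0; 6; 7; 29; 28; 26; 27; 16; 17; 23; 22; 25; 24; 30; 31; 20; 21; 19; 18];
      [:: 28; 19; 24; 23; 26; 21; 30; 17; 31; 16; 27; 20; 25; 22; 29; 18; 11; 4; 15; 0; 13; 2; 9; 6; 8; 7; 12; 3; 14; 1; 10; 5];
      [:: 17; 24; 27; 18; 22; 31; 28; 21; 25; 16; 19; 26; 30; 23; 20; 29; 10; 3; 0; 9; 13; 4; 7; 14; 2; 11; 8; 1; 5; 12; 15; 6]]%N.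

(** Ordered so that nodes refer to earlier ones only, starting with a face that reduces to the
    origin and ending with the whole cone. *)
Definition certificate : seq node :=
[:: ([:: 10; 12; 15; 27; 29; 30], [:: [:: 47; 95]; [:: 46]; [:: 95]; [:: 100]; [:: 51; 84]; [:: 52]; [:: 19]; [:: 92];
[:: 20]; [:: 34]; [:: 93]; [:: 89]; [:: 83]], 0, [::]); ([:: 2; 7; 8; 12; 16; 20], [:: [:: 34; 92]; [:: 35]; [:: 94];
[:: 93]; [:: 109]; [:: 48]; [:: 89]; [:: 83]], 0, [:: ([::], 0, [:: 0; 2; 6; 3; 3]); ([::], 0, [:: 0; 3; 0; 3; 6]);
([::], 0, [:: 0; 5; 5; 5; 2]); ([::], 0, [:: 3; 2; 1; 4; 1]); ([::], 0, [:: 4; 0; 2; 4; 6]); ([::], 0, [:: 3; 5; 1; 6;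
3]); ([::], 0, [:: 0; 2; 3; 0; 6; 7]); ([::], 0, [:: 2; 4; 4; 0; 0])]); ([:: 1; 9; 13; 17; 21; 28], [:: [:: 32; 94];
[:: 35]; [:: 94]; [:: 93]; [:: 22; 102]], 2, [:: ([::], 0, [:: 0; 2; 6; 3; 3]); ([::], 1, [:: 6; 0; 7; 7; 7]); ([::],
0, [:: 1; 5; 3; 6; 6]); ([::], 1, [:: 3; 7; 4; 6]); ([::], 0, [:: 0; 3; 0; 3; 6]); ([::], 1, [:: 0; 6; 7; 6; 6]);
([::], 0, [:: 5; 5; 1; 7; 6]); ([::], 1, [:: 3; 0; 0; 0])]); ([:: 0; 11; 15; 19; 23], [:: [:: 31; 95]; [:: 33]; [::
95]; [:: 94]; [:: 26; 104; 113; 20]], 5, [:: ([::], 1, [:: 0; 3; 7; 4; 7; 6]); ([::], 1, [:: 5; 7; 1; 2; 5]); ([::],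
1, [:: 6; 6; 3]); ([::], 1, [:: 4; 1; 4; 0; 3]); ([::], 0, [:: 2; 2; 3; 7; 2; 7]); ([::], 2, [:: 7; 4; 1]); ([::], 0,
[:: 0; 2; 6; 3; 3]); ([::], 2, [:: 1; 2; 7; 7; 0])]); ([:: 2; 3; 9; 14; 15; 16; 18; 19; 26], [:: [:: 77]; [:: 28]; [::
56; 118]], 247, [:: ([::], 1, [:: 1; 0; 1; 7]); ([::], 0, [:: 2; 3; 1]); ([::], 1, [:: 6; 4; 7; 0; 6]); ([::], 0, [::
0; 6; 4; 4; 3; 1]); ([::], 1, [:: 2; 2; 7; 5; 3]); ([::], 0, [:: 3; 6; 6; 2; 1]); ([::], 0, [:: 0; 6; 1; 4]); ([::],
0, [:: 5; 0; 7; 4; 1]); ([::], 0, [:: 1; 2; 5; 6; 6]); ([::], 1, [:: 4; 4; 5; 5; 5]); ([::], 1, [:: 2; 1; 4; 0; 5]);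
([::], 1, [:: 1; 1; 3; 3; 0; 1])]); ([:: 3; 6; 7; 12; 16; 18; 20; 22; 24], [:: [:: 34]; [:: 119]; [:: 33; 117; 16]],
7, [:: ([::], 0, [:: 5; 2; 0; 4; 2]); ([::], 1, [:: 7; 6; 5; 1]); ([::], 1, [:: 0; 3; 3; 5]); ([::], 1, [:: 3; 7; 5;
4; 1]); ([::], 1, [:: 5; 1; 5]); ([::], 1, [:: 7; 5; 3; 2]); ([::], 1, [:: 0; 5; 4; 0; 2; 7]); ([::], 0, [:: 6; 3; 7;
7; 0])]); ([:: 4; 6; 9; 12; 20; 22; 23; 24], [:: [:: 15; 85]; [:: 36; 99]], 47, [:: ([::], 0, [:: 6; 5; 5; 2]); ([::],
0, [:: 6; 5; 1; 2; 5]); ([::], 1, [:: 1; 4; 1; 3; 6]); ([::], 4, [:: 5; 5; 0; 6; 7]); ([::], 0, [:: 0; 7; 4; 7; 7]);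
([::], 0, [:: 7; 6; 6; 1; 0]); ([::], 4, [:: 6; 1; 7; 3]); ([::], 1, [:: 0; 0; 7; 0; 4])]); ([:: 7; 16; 18; 19; 20;
22; 24; 25], [:: [:: 34]; [:: 48; 80; 45]], 7, [:: ([::], 0, [:: 2; 6; 2; 1; 0]); ([::], 1, [:: 7; 6; 5; 1]); ([::],
4, [:: 3; 4; 1; 2; 3]); ([::], 1, [:: 3; 7; 5; 4; 1]); ([::], 1, [:: 5; 1; 5]); ([::], 1, [:: 1; 0; 2; 0; 4; 0]);
([::], 4, [:: 0; 2; 2; 3; 1; 1]); ([::], 0, [:: 1; 1; 6; 5; 5])]); ([:: 6; 8; 10; 14; 18; 20; 21; 28], [:: [:: 58; 91;
89; 35]; [:: 37; 81]], 0, [:: ([::], 0, [:: 0; 2; 6; 3; 3]); ([::], 1, [:: 5; 1; 5; 3; 0]); ([::], 1, [:: 0; 6; 0; 0;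
1]); ([::], 5, [:: 0; 1; 7; 2; 5; 1]); ([::], 0, [:: 4; 0; 2; 4; 6]); ([::], 1, [:: 0; 6; 3; 3; 4]); ([::], 1, [:: 0;
1; 1; 0; 4; 6]); ([::], 5, [:: 0; 1; 4; 3; 7; 1])]); ([:: 2; 8; 11; 13; 15; 16; 17; 19; 24], [:: [:: 27; 111; 19;
97]], 67, [:: ([::], 0, [:: 4; 0; 0; 7; 7]); ([::], 1, [:: 5; 1; 5; 3; 0]); ([::], 1, [:: 4; 4; 4; 2]); ([::], 1, [::
0; 7; 7; 7; 5; 7]); ([::], 2, [:: 2; 4; 3; 7]); ([::], 2, [:: 3; 5; 5; 7; 1]); ([::], 2, [:: 4; 2; 4; 2; 5]); ([::],
2, [:: 0; 1; 1; 7; 7; 5]); ([:: [:: 25; 111]], 1, [:: 1; 1; 6; 1; 1; 1]); ([::], 0, [:: 4; 5; 4; 5; 2]); ([:: [:: 21;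
97]], 2, [:: 6; 2; 6; 7; 3]); ([::], 0, [:: 0; 7; 1; 6; 2])]); ([:: 3; 8; 11; 12; 13; 14; 15; 16; 24], [:: [:: 92];
[:: 29; 119; 22; 103]], 1, [:: ([::], 1, [:: 2; 4; 0; 0; 5]); ([::], 1, [:: 4; 0; 0; 6]); ([::], 1, [:: 3; 5; 7; 2;
2]); ([::], 5, [:: 2; 1; 0; 5; 4]); ([::], 5, [:: 1; 2; 7; 6; 1]); ([::], 1, [:: 2; 1; 7; 2; 2; 4]); ([::], 5, [:: 0;
4; 3; 6; 0; 6]); ([::], 0, [:: 2; 6; 3; 3; 1])]); ([:: 3; 6; 9; 13; 14; 15; 17], [:: [:: 20; 94; 108; 105]], 54, [::
([::], 1, [:: 7; 6; 5; 1]); ([::], 1, [:: 1; 6; 4; 0; 3]); ([::], 7, [:: 0; 2; 1; 0; 1; 3]); ([::], 7, [:: 3; 0; 3;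
7]); ([::], 7, [::]); ([::], 1, [:: 5; 1; 5]); ([::], 1, [:: 0; 4; 6; 6; 5]); ([::], 7, [:: 0; 6; 1; 5; 1; 4])]); ([::
1; 6; 8; 18; 19; 20; 25], [:: [:: 39; 96]; [:: 30; 75; 25]], 233, [:: ([::], 0, [:: 6; 5; 5; 2]); ([::], 8, [:: 0; 1;
1; 1; 3; 1]); ([::], 1, [:: 0; 1; 5; 5; 1]); ([::], 2, [:: 5; 1; 2]); ([::], 1, [:: 0; 7; 0; 7; 7; 6]); ([::], 2, [::
2; 3; 7; 1; 5]); ([::], 0, [:: 0; 7; 4; 7; 7]); ([::], 1, [:: 0; 0; 2; 6; 4; 6]); ([::], 1, [:: 0; 0; 4; 2; 4; 6]);
([::], 8, [:: 2; 5; 0; 2]); ([::], 2, [:: 1; 5; 4; 6; 3]); ([::], 2, [:: 0; 3; 1; 5; 3])]); ([:: 1; 5; 6; 7; 18; 19;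
20], [:: [:: 26; 89; 33; 117]; [:: 88; 40; 81]], 14, [:: ([::], 0, [:: 2; 4; 4; 5; 0]); ([::], 2, [:: 4; 1; 5; 0; 7]);
([::], 2, [:: 6; 0; 6; 5]); ([::], 8, [:: 3; 5; 2]); ([::], 0, [:: 1; 2; 0; 3; 1; 4]); ([::], 2, [:: 3; 3; 3; 3; 2]);
([::], 2, [:: 5; 0; 3; 3]); ([::], 8, [:: 1; 4; 6; 1; 4])]); ([:: 2; 5; 11; 15; 16; 17; 19; 24], [:: [:: 27; 111; 19;
97]], 67, [:: ([::], 0, [:: 4; 0; 0; 7; 7]); ([::], 1, [:: 5; 1; 5; 3; 0]); ([::], 2, [:: 2; 3; 7; 7; 4]); ([::], 2,
[:: 1; 2; 7; 6; 1]); ([::], 5, [:: 0; 1; 7; 2; 5; 1]); ([::], 5, [:: 1; 7; 1; 1; 7; 0]); ([::], 1, [:: 4; 2; 0; 1;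
3]); ([::], 1, [:: 6; 1; 1; 6; 5]); ([::], 2, [:: 3; 4; 1; 5; 7]); ([::], 1, [:: 2; 3; 0; 0; 0]); ([::], 10, [:: 0; 5;
6; 3; 2; 3]); ([::], 1, [:: 0; 4; 6; 1; 0])]); ([:: 6; 7; 14; 15; 18; 20; 22], [:: [:: 89]; [:: 34]], 56, [:: ([::],
7, [:: 0; 3; 2; 1; 3]); ([::], 1, [:: 1; 6; 4; 0; 3]); ([::], 1, [:: 3; 7; 5; 4; 1]); ([::], 7, [:: 6; 7; 6; 6; 7]);
([::], 7, [::]); ([::], 1, [:: 5; 1; 5]); ([::], 1, [:: 3; 7; 5; 5]); ([::], 7, [:: 2; 0; 6; 1])]); ([:: 6; 9; 12; 16;
17; 18; 20; 21], [:: [:: 35]; [:: 54; 85; 39; 81]], 69, [:: ([::], 1, [:: 4; 0; 3; 1; 5]); ([::], 1, [:: 5; 1; 5; 3;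
0]); ([::], 1, [:: 1; 2; 7; 6; 1]); ([::], 1, [:: 5; 6; 4; 0; 7]); ([::], 3, [:: 3; 2; 0; 3; 2]); ([::], 3, [:: 1; 7;
4]); ([::], 3, [:: 0; 6; 7; 3; 5]); ([::], 3, [:: 0; 2; 0; 7; 4; 1]); ([:: [:: 119; 17]], 2, [:: 4; 2; 4; 2; 5]);
([::], 0, [:: 5; 5; 7; 2; 0]); ([:: [:: 119; 11]], 2, [:: 4; 0; 2; 0; 2]); ([::], 0, [:: 6; 3; 1; 0])]); ([:: 2; 8;
11; 15; 16; 17; 19; 24], [:: [:: 27; 111; 19; 97]], 0, [:: ([::], 0, [:: 4; 0; 0; 7; 7]); ([::], 1, [:: 5; 1; 5; 3;
0]); ([::], 4, [:: 4; 6; 5; 2]); ([::], 7, [:: 2; 7; 6; 1; 3]); ([::], 0, [:: 4; 5; 4; 5; 2]); ([::], 4, [:: 2; 3; 3;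
6; 6]); ([::], 1, [:: 0; 4; 6; 1; 0]); ([::], 7, [:: 5; 0; 0; 0])]); ([:: 5; 7; 11; 15; 19; 21; 22; 24], [:: [:: 59;
89; 43; 82]], 62, [:: ([::], 1, [:: 2; 4; 0; 0; 5]); ([::], 1, [:: 1; 1; 3; 4; 7]); ([::], 0, [:: 0; 4; 6; 1; 6]);
([::], 1, [:: 3; 5; 7; 2; 2]); ([::], 4, [:: 1; 1; 5; 7; 0; 6]); ([::], 7, [:: 2; 0; 5; 2; 5; 7]); ([::], 1, [:: 6; 4;
2; 7; 0]); ([::], 1, [:: 3; 7; 4; 6]); ([::], 7, [:: 2; 0; 5; 4; 5]); ([::], 1, [:: 2; 1; 7; 2; 2; 4]); ([::], 4, [::
0; 3; 3; 5; 6]); ([::], 0, [:: 2; 6; 3; 3; 1])]); ([:: 2; 8; 9; 11; 15; 16; 17; 19], [:: [:: 27; 97; 111; 19]], 12,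
[:: ([::], 1, [:: 4; 0; 3; 1; 5]); ([::], 1, [:: 5; 1; 5; 3; 0]); ([::], 3, [:: 3; 2; 0; 3; 2]); ([::], 3, [:: 1; 7;
4]); ([::], 3, [:: 0; 6; 7; 3; 5]); ([::], 3, [:: 0; 2; 0; 7; 4; 1]); ([::], 0, [:: 4; 1; 0; 5; 1]); ([:: [:: 27;
97]], 2, [:: 6; 2; 1; 3])]); ([:: 4; 7; 8; 15; 18; 19; 20; 22; 24; 25], [:: [:: 59; 83; 52; 34; 86]], 60, [:: ([::],
0, [:: 4; 5; 2]); ([::], 4, [:: 0; 3; 6; 1; 2]); ([::], 1, [:: 2; 2; 0; 0]); ([::], 0, [:: 6; 5; 1; 2; 5]); ([:: [::
58; 117; 16]], 1, [:: 0; 7; 0; 7; 7; 6]); ([:: [:: 86]], 4, [:: 1; 0; 3; 5]); ([::], 0, [:: 1; 2; 6; 2; 7]); ([::], 4,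
[:: 6; 3]); ([:: [:: 26]], 4, [:: 1; 0; 3; 5]); ([::], 0, [:: 3; 1; 5; 1; 7]); ([:: [:: 10; 80]], 1, [:: 0; 0; 6; 0;
6]); ([::], 1, [:: 3; 1; 2; 2; 0])]); ([:: 5; 8; 13; 16; 17; 18; 19; 20; 21; 24], [:: [:: 35]], 67, [:: ([::], 0, [::
4; 0; 0; 7; 7]); ([:: [:: 117; 28; 56; 76]], 2, [:: 1; 2; 0; 7; 7]); ([::], 4, [:: 3; 1; 7; 1; 2]); ([::], 4, [:: 0;
1; 2; 2; 5; 2]); ([::], 2, [:: 0; 7; 6; 2; 0; 4]); ([::], 2, [:: 7; 0; 0; 3]); ([::], 2, [:: 0; 3; 3; 6; 7]); ([::],
2, [:: 1; 2; 0; 7; 7]); ([::], 0, [:: 6; 5; 1; 2; 5]); ([::], 4, [:: 4; 5; 2; 0; 5]); ([:: [:: 109; 11; 23; 108]], 2,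
[:: 1; 2; 0; 7; 7]); ([::], 4, [:: 0; 0; 0; 5; 5])]); ([:: 2; 4; 5; 11; 15; 16; 17; 19], [:: [:: 27; 97; 19; 111]],
67, [:: ([::], 0, [:: 2; 5; 4; 7; 7]); ([::], 0, [:: 1; 2; 0; 3; 1; 4]); ([::], 2, [:: 2; 3; 7; 7; 4]); ([::], 2, [::
2; 0; 6; 1]); ([::], 4, [:: 1; 7; 2; 6; 7; 3]); ([::], 4, [:: 3; 3; 1; 3; 7]); ([::], 0, [:: 5; 5; 4; 6; 5]); ([::],
0, [:: 3; 2; 4; 4; 1]); ([::], 6, [:: 5; 2; 7; 0; 5]); ([::], 1, [:: 2; 3; 0; 0; 0]); ([::], 6, [:: 0; 4; 2; 4; 6;
2]); ([::], 1, [:: 0; 4; 6; 1; 0])]); ([:: 4; 6; 10; 14; 18; 20; 21], [:: [:: 54; 85; 81; 39]], 12, [:: ([::], 1, [::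
4; 0; 3; 1; 5]); ([::], 0, [:: 1; 2; 0; 3; 1; 4]); ([::], 7, [:: 5; 1; 1; 6]); ([::], 7, [:: 1; 0; 4; 7; 7]); ([::],
1, [:: 6; 6; 3]); ([::], 1, [:: 1; 0; 0; 7; 6; 4]); ([::], 1, [:: 2; 3; 0; 0; 0]); ([::], 18, [:: 7; 5; 3; 1; 1])]);
([:: 6; 8; 10; 14; 18; 20; 21], [:: [:: 54; 85; 39; 81]], 0, [:: ([::], 1, [:: 4; 0; 3; 1; 5]); ([::], 1, [:: 5; 1; 5;
3; 0]); ([::], 7, [:: 0; 3; 5; 2; 7; 0]); ([::], 7, [:: 2; 7; 6; 1; 3]); ([::], 0, [:: 4; 5; 4; 5; 2]); ([::], 6, [::
4; 0; 0; 6]); ([::], 1, [:: 0; 4; 6; 1; 0]); ([::], 14, [:: 4; 3; 6; 2])]); ([:: 2; 5; 7; 8; 16; 17; 19; 21; 24], [::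
[:: 29; 118; 21; 31; 97]], 71, [:: ([::], 1, [:: 1; 0; 6; 7; 3]); ([::], 0, [:: 2; 3; 1]); ([::], 1, [:: 5; 7; 6; 4]);
([::], 5, [:: 6; 6; 0; 0; 1]); ([::], 4, [:: 5; 6; 4; 3; 7]); ([::], 7, [:: 3; 3; 6; 3]); ([:: [:: 89; 35]], 1, [:: 5;
4; 3; 1; 3]); ([::], 0, [:: 0; 4; 6; 1; 6]); ([:: [:: 29]], 7, [:: 3; 4; 6; 4]); ([::], 1, [:: 1; 0; 7; 2; 1; 1]);
([::], 1, [:: 2; 5; 2; 0; 7]); ([::], 7, [:: 4; 5; 2; 0; 5])]); ([:: 5; 6; 10; 12; 14; 15; 18; 21; 24], [:: [:: 58;
93; 51; 85; 83]], 6, [:: ([::], 1, [:: 1; 7; 1; 5; 1]); ([::], 1, [:: 3; 5; 7; 6; 7]); ([::], 7, [:: 6; 2; 0; 3; 3]);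
([:: [:: 118; 29]], 4, [:: 1; 7; 1; 1; 5]); ([::], 1, [:: 1; 0; 6; 5; 2]); ([:: [:: 97; 31]], 7, [:: 7; 7; 0; 6; 1]);
([::], 0, [:: 0; 1; 6; 0; 6; 2]); ([::], 7, [:: 6; 3; 1; 0; 4])]); ([:: 4; 5; 9; 13; 14; 15; 17; 20; 24], [:: [:: 57;
93; 84; 82; 46]], 72, [:: ([::], 0, [:: 1; 2; 0; 7; 6; 2]); ([::], 1, [:: 1; 0; 4; 7; 3]); ([::], 1, [:: 3; 6; 3; 7;
0]); ([::], 9, [:: 0; 2; 1; 0; 1; 3]); ([:: [:: 93]], 4, [:: 5; 2; 0; 7; 5]); ([::], 2, [:: 4; 2; 4; 4; 7]); ([::], 0,
[:: 6; 5; 0; 0]); ([::], 4, [:: 5; 2; 0; 7; 5]); ([::], 2, [:: 5; 4; 5; 3]); ([::], 9, [:: 3; 7; 1; 5]); ([:: [:: 57;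
93; 88]], 2, [:: 6; 0; 6; 5]); ([::], 0, [:: 6; 7; 6; 0])]); ([:: 4; 5; 7; 9; 13; 14; 17; 20; 24], [:: [:: 57; 93; 84;
82; 46]], 73, [:: ([::], 0, [:: 0; 5; 0; 2]); ([::], 2, [:: 0; 5; 5; 0; 5; 4]); ([::], 1, [:: 3; 6; 3; 7; 0]); ([::],
8, [:: 0; 0; 5; 0; 2; 2]); ([::], 5, [:: 7; 2; 1; 1; 4]); ([::], 2, [:: 4; 2; 4; 4; 7]); ([::], 0, [:: 6; 5; 0; 0]);
([:: [:: 30; 102]], 1, [:: 1; 3; 7; 3; 6]); ([::], 2, [:: 5; 4; 5; 3]); ([:: [:: 82; 46]], 8, [:: 0; 7; 1; 2; 2]);
([::], 8, [:: 3; 1; 7; 1; 4]); ([::], 1, [:: 2; 3; 2; 0])]); ([:: 2; 5; 7; 16; 17; 18; 20; 21; 24], [:: [:: 35]], 227,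
[:: ([::], 1, [:: 2; 1; 7; 3]); ([::], 2, [:: 1; 4; 7; 2; 5]); ([::], 10, [:: 5; 3; 5; 3; 0]); ([::], 2, [:: 0; 0; 5;
7; 6; 7]); ([::], 4, [:: 6; 1; 5; 3; 7]); ([::], 7, [:: 2; 0; 0; 1; 5]); ([:: [:: 27; 114; 31; 109]], 2, [:: 1; 2; 7;
6; 1]); ([::], 0, [:: 3; 4; 7; 3]); ([::], 2, [:: 5; 4; 7]); ([:: [:: 28]], 7, [:: 2; 0; 0; 1; 5]); ([::], 7, [:: 7;
5; 5; 4; 6]); ([::], 10, [:: 4; 2; 0; 1; 7])]); ([:: 6; 16; 17; 18; 20; 21], [:: [:: 35]; [:: 54; 85; 39; 81]], 0, [::
([::], 1, [:: 4; 0; 3; 1; 5]); ([::], 1, [:: 5; 1; 5; 3; 0]); ([::], 23, [::]); ([::], 23, [:: 0; 1; 1; 2; 2]); ([::],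
1, [:: 2; 3; 0; 0; 0]); ([::], 23, [:: 4; 3; 6; 2]); ([::], 1, [:: 0; 4; 6; 1; 0]); ([::], 23, [:: 0; 4; 7; 0; 2])]);
([:: 3; 6; 9; 13; 14; 15], [:: [:: 94; 20; 89; 108; 105]], 20, [:: ([::], 11, [:: 0; 1; 7; 6]); ([::], 11, [:: 3; 7;
0; 3]); ([::], 11, [:: 0; 3; 2; 3; 6; 0]); ([::], 11, [:: 3; 5; 1; 1; 6]); ([::], 11, [::]); ([::], 11, [:: 7; 1; 5;
6; 7]); ([::], 11, [:: 1; 1; 3; 2; 3; 4]); ([::], 11, [:: 0; 7; 7; 1; 6])]); ([:: 4; 5; 9; 13; 14; 17; 20; 24], [::
[:: 57; 93; 84; 82; 46]], 73, [:: ([::], 0, [:: 1; 2; 0; 7; 6; 2]); ([::], 2, [:: 0; 5; 5; 0; 5; 4]); ([::], 1, [:: 3;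
6; 3; 7; 0]); ([::], 17, [:: 0; 7; 1; 2; 2]); ([::], 7, [:: 5; 0; 4; 6; 2]); ([::], 2, [:: 4; 2; 4; 4; 7]); ([::], 0,
[:: 6; 5; 0; 0]); ([::], 4, [:: 5; 3; 7; 5; 2]); ([::], 2, [:: 5; 4; 5; 3]); ([::], 17, [:: 1; 7; 0; 4; 6]); ([::], 8,
[:: 3; 1; 7; 1; 4]); ([::], 1, [:: 2; 3; 2; 0])]); ([:: 5; 9; 13; 14; 15; 17; 20; 24], [:: [:: 57; 93; 84; 46; 82]],
72, [:: ([::], 0, [:: 1; 2; 0; 7; 6; 2]); ([::], 2, [:: 5; 4; 6; 3; 5]); ([::], 2, [:: 2; 1; 3; 7; 7]); ([::], 17, [::
0; 3; 6; 5; 1; 1]); ([::], 17, [:: 0; 6; 3; 3; 4]); ([::], 13, [:: 5; 1; 4; 3; 3]); ([::], 2, [:: 0; 7; 6; 2; 0; 4]);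
([::], 17, [:: 4; 0; 2; 1; 6]); ([::], 2, [:: 5; 4; 5; 3]); ([::], 17, [:: 3; 7; 1; 5]); ([::], 13, [:: 5; 3; 0; 6;
2]); ([::], 0, [:: 6; 7; 6; 0])]); ([:: 1; 4; 7; 10; 16; 18; 19; 20], [:: [:: 28; 102; 18; 33; 100]], 75, [:: ([::],
0, [:: 0; 5; 0; 2]); ([::], 2, [:: 0; 5; 5; 0; 5; 4]); ([::], 1, [:: 0; 6; 1; 6; 6]); ([::], 8, [:: 4; 5; 1; 6; 6]);
([::], 6, [:: 1; 2; 5; 7]); ([::], 7, [:: 1; 0; 5; 2; 5]); ([::], 0, [:: 0; 5; 5; 2; 2]); ([:: [:: 88; 34]], 1, [:: 4;
7; 1; 5; 1]); ([::], 12, [:: 0; 1; 7; 0; 7; 2]); ([::], 1, [:: 2; 4; 0; 0; 2]); ([::], 2, [:: 0; 1; 1; 2; 0; 2]);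
([::], 12, [:: 3; 4; 2; 2; 7])]); ([:: 5; 7; 9; 13; 14; 17; 20; 24], [:: [:: 57; 93; 84; 46; 82]], 14, [:: ([::], 0,
[:: 0; 5; 0; 2]); ([::], 2, [:: 2; 1; 3; 7; 7]); ([::], 8, [:: 0; 0; 5; 0; 2]); ([::], 17, [:: 0; 3; 6; 5; 1; 1]);
([::], 1, [:: 6; 2; 4; 0]); ([::], 2, [:: 3; 2; 6; 3; 2]); ([::], 2, [:: 5; 4; 5; 3]); ([::], 17, [:: 3; 7; 1; 5])]);
([:: 4; 8; 9; 10; 11; 14; 15; 18], [:: [:: 95]], 12, [:: ([::], 16, [:: 3; 1; 7; 3; 2; 3]); ([::], 1, [:: 0; 3; 4; 2;
5]); ([::], 3, [:: 0; 1; 1; 7; 7; 5]); ([::], 3, [:: 0; 2; 2; 5; 4; 0]); ([::], 3, [:: 0; 7; 6; 2; 0; 4]); ([::], 16,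
[:: 7; 1; 2; 3]); ([:: [:: 28; 103; 56; 82]], 2, [:: 1; 4; 7; 1; 1]); ([:: [:: 96; 46; 27; 78]], 2, [:: 4; 2; 0; 6;
2])]); ([:: 2; 7; 12; 16; 17; 19; 21; 24], [:: [:: 29; 118; 21; 97; 31]], 6, [:: ([::], 1, [:: 1; 7; 1; 5; 1]); ([::],
0, [:: 2; 3; 1]); ([::], 18, [:: 3; 0; 2; 1; 7]); ([::], 4, [:: 0; 1; 1; 7; 0; 6]); ([::], 1, [:: 0; 3; 3; 7; 6]);
([::], 18, [:: 7; 3; 3; 7]); ([::], 0, [:: 0; 1; 6; 0; 6; 2]); ([::], 4, [:: 4; 2; 2; 2; 7; 3])]); ([:: 2; 7; 8; 16;
17; 19; 21; 24], [:: [:: 29; 118; 21; 31; 97]], 71, [:: ([::], 1, [:: 1; 0; 6; 7; 3]); ([::], 0, [:: 2; 3; 1]); ([::],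
2, [:: 4; 1; 1; 2]); ([::], 5, [:: 6; 6; 0; 0; 1]); ([::], 6, [:: 5; 4; 2; 5; 5]); ([::], 14, [:: 0; 1; 4; 1; 3]);
([::], 2, [:: 3; 2; 3; 6; 7]); ([::], 1, [:: 0; 3; 3; 7; 6]); ([::], 14, [:: 0; 0; 0; 5; 5]); ([::], 1, [:: 1; 0; 7;
2; 1; 1]); ([::], 1, [:: 2; 5; 2; 0; 7]); ([::], 7, [:: 4; 5; 2; 0; 5])]); ([:: 2; 8; 9; 16; 17; 18; 20; 21], [:: [::
35]], 216, [:: ([::], 4, [:: 0; 1; 1; 0; 4; 6]); ([::], 2, [:: 0; 0; 2; 1; 1; 0]); ([::], 7, [:: 2; 6; 2; 0]); ([::],
19, [:: 0; 4; 6; 0; 6; 0]); ([::], 3, [:: 0; 4; 7; 1; 0]); ([::], 3, [:: 1; 1; 1; 3; 6]); ([::], 19, [::]); ([::], 3,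
[:: 0; 6; 7; 3; 5]); ([::], 17, [:: 0; 0; 3; 7]); ([::], 0, [:: 4; 1; 0; 5; 1]); ([:: [:: 27; 81; 97; 54]], 2, [:: 4;
0; 6; 6]); ([::], 17, [:: 2; 0; 6; 1])]); ([:: 2; 5; 16; 17; 18; 20; 21; 24], [:: [:: 35]], 59, [:: ([::], 2, [:: 1;
4; 7; 2; 5]); ([::], 14, [:: 0; 3; 4; 3; 3]); ([::], 7, [:: 0; 4; 7; 2; 2]); ([:: [:: 28; 117; 15; 114]], 7, [:: 0; 6;
4; 6; 1]); ([::], 14, [::]); ([::], 1, [:: 4; 2; 0; 1; 3]); ([::], 2, [:: 5; 4; 7]); ([::], 29, [:: 2; 4; 6; 2; 3])]);
([:: 5; 6; 8; 10; 14; 18; 21; 24], [:: [:: 58; 91; 89; 37; 81]], 12, [:: ([::], 1, [:: 1; 0; 6; 7; 3]); ([::], 1, [::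
3; 5; 7; 6; 7]); ([::], 18, [:: 0; 0; 0; 2; 1; 3]); ([::], 18, [:: 4; 6; 7; 2; 4]); ([::], 1, [:: 1; 0; 6; 5; 2]);
([::], 18, [:: 3; 6; 6; 5; 1]); ([::], 1, [:: 1; 0; 7; 2; 1; 1]); ([::], 18, [:: 4; 5; 5; 4; 3])]); ([:: 2; 8; 16; 17;
18; 20; 21; 24], [:: [:: 35]], 59, [:: ([::], 2, [:: 3; 7; 1; 1; 6]); ([::], 17, [:: 0; 1; 5; 2; 5]); ([::], 17, [::
0; 0; 3; 7]); ([::], 2, [:: 3; 5; 5; 7; 1]); ([::], 17, [::]); ([::], 2, [:: 2; 1; 7; 2]); ([::], 2, [:: 2; 0; 0; 5;
0]); ([::], 17, [:: 2; 0; 6; 1])]); ([:: 2; 5; 15; 16; 17; 19; 21; 24], [:: [:: 29; 118; 21; 31; 97]], 2, [:: ([::],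
1, [:: 1; 0; 6; 7; 3]); ([::], 2, [:: 2; 3; 7; 7; 4]); ([::], 12, [:: 0; 0; 7; 6; 1]); ([::], 17, [:: 0; 1; 4; 1; 3]);
([::], 17, [:: 6; 6; 5; 6; 2]); ([::], 2, [:: 6; 1; 6; 1; 1]); ([::], 12, [:: 1; 5; 2; 1; 6]); ([::], 1, [:: 2; 5; 2;
0; 7])]); ([:: 4; 5; 8; 10; 11; 14; 15; 18], [:: [:: 95]], 5, [:: ([::], 7, [:: 6; 3; 4; 2]); ([::], 4, [:: 1; 3; 3;
7; 4]); ([::], 4, [:: 0; 3; 4; 6; 7; 5]); ([::], 7, [:: 2; 6; 7; 3; 7]); ([::], 18, [:: 4; 2; 0; 1; 7]); ([::], 1, [::
5; 4; 3; 1; 3]); ([::], 1, [:: 5; 0; 6; 5; 4]); ([::], 18, [:: 5; 3; 5; 3; 0])]); ([:: 5; 8; 9; 11; 13; 14; 17; 20],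
[:: [:: 57; 93; 84; 46; 82]], 14, [:: ([::], 1, [:: 2; 3; 4]); ([::], 1, [:: 1; 0; 7; 3; 2]); ([::], 3, [:: 4; 0; 2;
0; 2]); ([:: [:: 94]], 16, [:: 2; 0; 7; 1]); ([::], 3, [:: 1; 6; 4; 2]); ([::], 16, [:: 2; 0; 7; 1]); ([::], 0, [:: 0;
3; 0; 3; 6]); ([:: [:: 95; 40; 78]], 2, [:: 1; 3; 7; 4; 2])]); ([:: 1; 10; 11; 16; 18; 19; 20], [:: [:: 28; 102; 18;
33; 100]], 5, [:: ([::], 2, [:: 2; 0; 7; 7; 1]); ([::], 2, [:: 0; 1; 2]); ([::], 17, [:: 7; 4; 3; 3; 3]); ([::], 17,
[:: 7; 2; 5; 1; 1]); ([::], 13, [:: 5; 4; 5; 3]); ([::], 0, [:: 2; 6; 7; 7; 6]); ([::], 33, [:: 5; 3; 1; 7; 3]);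
([::], 2, [:: 0; 1; 1; 2; 0; 2])]); ([:: 2; 8; 16; 17; 18; 20; 21], [:: [:: 35]], 0, [:: ([:: [:: 26; 73; 113; 51]],
7, [:: 7; 4; 4]); ([::], 7, [:: 1; 2; 2; 5; 5]); ([::], 11, [:: 0; 4; 4; 0; 0]); ([::], 15, [:: 3; 4; 0; 3; 0]);
([::], 1, [:: 7; 7; 6; 5]); ([::], 14, [:: 0; 6; 3; 2; 4; 7]); ([::], 18, [:: 0; 5; 6; 5; 1; 2]); ([::], 40, [:: 0; 6;
3; 2; 4; 7])]); ([:: 4; 5; 9; 10; 13; 17; 20], [:: [:: 57; 93; 46; 84; 82]], 5, [:: ([::], 2, [:: 0; 5; 5; 0; 5; 4]);
([::], 1, [:: 0; 6; 1; 6; 6]); ([::], 17, [:: 4; 7; 7; 7; 6]); ([::], 34, [::]); ([::], 12, [:: 0; 1; 7; 0; 7; 2]);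
([::], 1, [:: 2; 4; 0; 0; 2]); ([::], 32, [:: 5; 3; 1; 7; 3]); ([::], 2, [:: 0; 1; 1; 2; 0; 2])]); ([:: 5; 9; 11; 13;
14; 17; 20], [:: [:: 57; 93; 84; 46; 82]], 2, [:: ([::], 1, [:: 2; 3; 4]); ([::], 2, [:: 2; 1; 3; 7; 7]); ([::], 11,
[:: 5; 5; 6; 4; 1]); ([::], 14, [:: 0; 2; 0; 1; 1]); ([::], 1, [:: 2; 5; 1; 5; 6]); ([::], 12, [:: 4; 7; 7; 4; 2]);
([::], 1, [:: 2; 3; 2; 0]); ([::], 43, [:: 1; 7; 1; 2; 0])]); ([:: 2; 4; 10; 11; 14; 15; 18], [:: [:: 95]], 59, [::
([::], 2, [:: 4; 2; 2; 6]); ([::], 23, [::]); ([::], 15, [:: 6; 7; 2; 1; 2]); ([::], 11, [:: 0; 3; 5; 6; 6]); ([::],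
23, [:: 0; 4; 6; 0; 6; 0]); ([::], 1, [:: 5; 1; 2; 2; 3]); ([::], 40, [:: 0; 3; 3; 4; 3; 6]); ([::], 14, [:: 2; 4; 6;
2; 3])]); ([:: 1; 7; 10; 16; 18; 19; 20], [:: [:: 28; 102; 18; 33; 100]], 14, [:: ([::], 0, [:: 0; 5; 0; 2]); ([::],
2, [:: 0; 1; 2]); ([::], 7, [:: 3; 2; 2; 6; 4]); ([::], 14, [:: 0; 2; 1; 0; 1; 3]); ([::], 1, [:: 6; 2; 4; 0]); ([::],
2, [:: 4; 4; 0; 6; 4]); ([::], 1, [:: 2; 4; 0; 0; 2]); ([::], 38, [:: 0; 3; 6; 1; 2])]); ([:: 1; 8; 10; 16; 18; 19;
20], [:: [:: 28; 102; 33; 100; 18]], 14, [:: ([::], 1, [:: 3; 6; 7; 4; 5]); ([::], 2, [:: 2; 6; 7; 2; 5]); ([::], 3,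
[:: 4; 0; 2; 0; 2]); ([::], 45, [:: 0; 6; 5; 6; 2]); ([::], 3, [:: 1; 6; 4; 2]); ([::], 19, [:: 6; 4; 2; 7; 0]);
([::], 0, [:: 0; 0; 6; 1; 0]); ([::], 12, [:: 3; 2; 0; 7])]); ([:: 5; 9; 10; 12; 13; 17; 20], [:: [:: 57; 93; 46; 84;
82]], 75, [:: ([::], 1, [:: 1; 2; 5; 6]); ([::], 2, [:: 3; 1; 6]); ([::], 1, [:: 6; 0; 7; 7; 7]); ([::], 6, [:: 1; 0;
2; 0]); ([::], 3, [:: 4; 0; 2; 0; 2]); ([::], 45, [:: 5; 3; 1; 7; 3]); ([::], 3, [:: 1; 6; 4; 2]); ([::], 16, [:: 3;
1; 0; 7; 2]); ([::], 8, [:: 3; 2; 4; 6; 1]); ([::], 1, [:: 2; 4; 0; 0; 2]); ([::], 0, [:: 0; 1; 1; 6; 6; 5]); ([::],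
12, [:: 2; 7; 5; 6; 0])]); ([:: 1; 4; 6; 16; 18; 19; 20], [:: [:: 28; 96; 30; 117; 21]], 13, [:: ([::], 0, [:: 2; 4;
4; 5; 0]); ([::], 2, [:: 0; 5; 5; 0; 5; 4]); ([::], 6, [:: 4; 5; 3; 5]); ([::], 17, [:: 0; 7; 1; 2; 2]); ([::], 0, [::
1; 2; 0; 3; 1; 4]); ([::], 2, [:: 0; 2; 6; 4; 5; 3]); ([::], 2, [:: 5; 4; 5; 3]); ([::], 32, [:: 0; 2; 3; 3; 6])]);
([:: 0; 1; 2; 16; 17; 20; 21], [:: [:: 35]], 24, [:: ([::], 3, [:: 2; 2; 3; 3; 5]); ([::], 3, [:: 0; 5; 5; 6; 7; 2]);
([::], 7, [:: 3; 1; 0; 7; 7]); ([::], 7, [:: 6; 0; 3; 5; 3]); ([:: [:: 26; 73; 117; 54]], 2, [:: 1; 5; 2; 4; 5]);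
([::], 0, [:: 0; 7; 2; 4; 7]); ([::], 19, [:: 6; 4; 0; 3; 6]); ([::], 39, [:: 6; 4; 0; 3; 6])]); ([:: 4; 6; 7; 8; 9;
12; 16], [:: [:: 53; 90; 86; 38; 79]], 16, [:: ([::], 2, [:: 1; 1; 1; 4; 0]); ([::], 1, [:: 0; 0; 5; 7; 6; 2]); ([::],
22, [:: 2; 4; 5; 0]); ([::], 7, [:: 4; 4; 3; 6]); ([::], 0, [:: 1; 7; 7; 0]); ([::], 34, [:: 0; 3; 6; 1; 2]); ([::],
1, [:: 0; 2; 6; 7; 7; 6]); ([::], 12, [:: 0; 3; 0; 3; 5])]); ([:: 0; 2; 4; 10; 11; 14; 15], [:: [:: 95]], 30, [::
([::], 7, [:: 7; 4; 4]); ([::], 7, [:: 6; 7; 2; 1; 2]); ([::], 7, [:: 1; 4; 2; 1; 6]); ([::], 7, [:: 4; 3; 1; 2; 2]);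
([::], 23, [:: 1; 1; 4; 2; 0]); ([::], 1, [:: 0; 0; 2; 0; 5; 1]); ([::], 1, [:: 5; 1; 2; 2; 3]); ([::], 23, [:: 7; 1;
2; 3])]); ([:: 4; 5; 8; 10; 11; 13; 15; 16; 17; 18; 20], [::], 67, [:: ([::], 2, [:: 2; 2; 3; 2; 4]); ([::], 10, [::
0; 4; 3; 7; 2; 1]); ([:: [:: 103; 35]], 4, [:: 0; 4; 3; 1; 6]); ([:: [:: 80]], 7, [:: 2; 4; 0; 1]); ([:: [:: 88; 42;
93; 78]], 5, [:: 7; 5; 3; 5]); ([::], 1, [:: 0; 4; 7; 3; 6]); ([::], 5, [:: 0; 5; 5; 1; 6; 3]); ([:: [:: 53; 88; 80;
42]], 2, [:: 2; 2; 3; 2; 4]); ([::], 0, [:: 6; 5; 1; 2; 5]); ([:: [:: 80; 28; 103; 52; 35]], 26, [:: 4; 7; 2; 0; 6]);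
([:: [:: 57; 91; 35; 88]], 1, [:: 3; 6; 1; 2; 3]); ([::], 26, [:: 4; 7; 2; 0; 6])]); ([:: 4; 6; 7; 9; 10; 13; 16; 17;
18; 19; 20], [::], 64, [:: ([::], 0, [:: 1; 7; 7; 0]); ([::], 8, [:: 4; 5; 1; 6; 6]); ([::], 22, [:: 1; 2; 1; 0; 4;
3]); ([:: [:: 46; 87; 82]], 8, [:: 4; 5; 1; 6; 6]); ([:: [:: 79]], 9, [:: 1; 2; 7; 7; 2; 0]); ([:: [:: 58; 93; 85; 83;
51]], 22, [:: 1; 2; 1; 0; 4; 3]); ([:: [:: 94; 35]], 0, [:: 2; 0; 2; 0; 4]); ([:: [:: 58; 85; 33; 83; 51]], 22, [:: 1;
2; 1; 0; 4; 3]); ([:: [:: 81; 28; 112; 5; 99]], 28, [:: 0; 2; 4; 2; 7]); ([::], 6, [:: 3; 4; 0; 0; 0]); ([::], 2, [::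
4; 2; 7; 1; 2]); ([::], 28, [:: 0; 2; 4; 2; 7])]); ([:: 1; 4; 6; 8; 9; 13; 17; 18; 19; 20; 24], [::], 47, [:: ([::],
0, [:: 2; 4; 4; 5; 0]); ([:: [:: 87; 46; 78]], 6, [:: 0; 6; 0; 7; 0]); ([::], 28, [:: 3; 2; 0; 6; 7]); ([::], 27, [::
0; 1; 4; 6; 5]); ([::], 6, [:: 0; 6; 0; 7; 0]); ([::], 0, [:: 2; 7; 5; 6; 6]); ([:: [:: 35; 94; 91; 25; 99; 15; 36]],
27, [:: 0; 1; 4; 6; 5]); ([:: [:: 34; 89; 20; 45; 108]], 28, [:: 3; 2; 0; 6; 7])]); ([:: 1; 10; 16; 18; 19; 20], [::
[:: 28; 102; 18; 33; 100]], 75, [:: ([::], 1, [:: 0; 6; 3; 0; 2]); ([::], 3, [:: 4; 3; 5; 2; 7]); ([::], 2, [:: 0; 1;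
2]); ([::], 24, [:: 4; 5; 1; 6; 6]); ([::], 52, [::]); ([::], 49, [:: 5; 3; 1; 7; 3]); ([::], 3, [:: 1; 6; 4; 2]);
([::], 24, [:: 0; 3; 6; 1; 2]); ([::], 52, [:: 2; 0; 7; 7; 1]); ([::], 1, [:: 2; 4; 0; 0; 2]); ([::], 2, [:: 0; 1; 1;
2; 0; 2]); ([::], 49, [:: 2; 0; 4; 4; 7])]); ([:: 5; 6; 9; 13; 17; 20], [:: [:: 57; 93; 46; 84; 82]], 72, [:: ([::],
0, [:: 2; 4; 4; 5; 0]); ([::], 3, [:: 4; 3; 5; 2; 7]); ([::], 2, [:: 2; 0; 1; 0; 3]); ([::], 13, [::]); ([::], 24, [::
4; 5; 1; 6; 6]); ([::], 12, [:: 1; 2; 2; 3; 6; 2]); ([::], 1, [:: 5; 1; 5; 3; 0]); ([::], 3, [:: 2; 3; 3; 1; 0]);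
([::], 2, [:: 5; 4; 5; 3]); ([::], 12, [:: 3; 6; 3; 2]); ([::], 52, [:: 0; 0; 1; 2; 3; 4]); ([::], 2, [:: 0; 1; 1; 2;
0; 2])]); ([:: 2; 16; 17; 18; 20; 21], [:: [:: 35]], 0, [:: ([::], 23, [:: 1; 1; 4; 2; 0]); ([::], 23, [:: 2; 0; 3;
5]); ([::], 50, [::]); ([::], 50, [:: 5; 4; 5; 6; 1]); ([::], 23, [:: 1; 3; 2; 5; 5; 2]); ([::], 50, [:: 1; 3; 2; 5;
5; 2]); ([::], 23, [:: 0; 7; 3; 6; 7; 5]); ([::], 50, [:: 0; 4; 3; 5; 4; 7])]); ([:: 1; 4; 16; 18; 19; 20], [:: [::
28; 102; 18; 33; 100]], 5, [:: ([::], 2, [:: 0; 5; 5; 0; 5; 4]); ([::], 2, [:: 4; 1; 5; 0; 7]); ([::], 54, [::]);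
([::], 54, [:: 0; 6; 3; 3; 1]); ([::], 54, [:: 0; 2; 3; 3; 6]); ([::], 2, [:: 5; 4; 5; 3]); ([::], 54, [:: 2; 3; 3; 6;
0]); ([::], 2, [:: 0; 1; 1; 2; 0; 2])]); ([:: 4; 6; 8; 9; 12; 16], [:: [:: 53; 90; 86; 38; 79]], 11, [:: ([::], 2, [::
4; 6; 2; 0; 0]); ([::], 1, [:: 0; 0; 5; 7; 6; 2]); ([::], 24, [:: 2; 5; 4; 2; 3]); ([::], 56, [:: 0; 2; 1; 0; 1; 3]);
([::], 1, [:: 6; 3; 6; 6; 1]); ([::], 12, [:: 0; 6; 1; 4; 1]); ([::], 3, [:: 0; 2; 1; 5; 5; 1]); ([::], 53, [:: 6; 6;
4])]); ([:: 0; 2; 10; 11; 14; 15], [:: [:: 95]], 24, [:: ([::], 57, [::]); ([::], 3, [:: 0; 5; 5; 6; 7; 2]); ([::],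
15, [:: 0; 6; 0; 5; 3; 0]); ([::], 11, [:: 0; 1; 2; 3; 7]); ([::], 23, [:: 1; 1; 4; 2; 0]); ([::], 1, [:: 0; 0; 2; 0;
5; 1]); ([::], 24, [:: 5; 0; 1; 3; 1]); ([::], 47, [:: 3; 0; 0])]); ([:: 4; 5; 10; 11; 13; 15; 16; 17; 18; 20], [::],
76, [:: ([::], 2, [:: 2; 2; 3; 2; 4]); ([:: [:: 111]], 18, [:: 2; 7; 7; 6]); ([:: [:: 23; 116; 32; 108]], 7, [:: 3; 2;
0; 1]); ([:: [:: 88]], 11, [:: 1; 4; 7; 3]); ([::], 58, [::]); ([::], 44, [:: 0; 7; 6; 4; 6; 7]); ([:: [:: 35]], 44,
[:: 0; 7; 6; 4; 6; 7]); ([:: [:: 53; 88; 111; 15]], 2, [:: 2; 2; 3; 2; 4]); ([::], 41, [:: 4; 3; 0; 5; 3]); ([:: [::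
59; 81; 94; 39]], 1, [:: 4; 5; 5; 4; 3]); ([::], 41, [:: 3; 5; 1; 3]); ([::], 26, [:: 4; 7; 2; 0; 6])]); ([:: 4; 6;
10; 11; 12; 13; 16; 17; 18; 20], [::], 76, [:: ([::], 2, [:: 3; 3; 7; 6; 1]); ([:: [:: 111]], 14, [:: 0; 2; 3; 1; 1;
7]); ([:: [:: 119; 34]], 4, [:: 3; 0; 4; 2; 3]); ([:: [:: 83]], 18, [:: 0; 3; 6; 3; 4]); ([::], 1, [:: 6; 3; 6; 6;
1]); ([::], 7, [:: 0; 3; 6; 5; 5]); ([::], 5, [:: 0; 1; 4; 3; 2; 1]); ([::], 6, [:: 6; 1; 5; 5; 7]); ([:: [:: 58; 117;
16; 119]], 1, [:: 1; 4; 6; 1; 1]); ([::], 38, [:: 1; 7; 0; 6]); ([:: [:: 86; 23; 34; 119; 52]], 38, [:: 1; 7; 0; 6]);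
([::], 0, [:: 1; 4; 6; 2; 5])]); ([:: 2; 6; 7; 9; 15; 16; 17; 18; 20; 24], [::], 224, [:: ([:: [:: 51; 110]], 1, [::
2; 5; 1; 7]); ([::], 2, [:: 0; 0; 2; 1; 1; 0]); ([::], 15, [:: 6; 4; 6]); ([:: [:: 46; 63; 82]], 7, [:: 7; 2; 6; 7;
5]); ([:: [:: 118]], 7, [:: 0; 2; 2; 3; 6; 1]); ([::], 40, [:: 1; 3; 0; 0; 2]); ([::], 14, [:: 1; 4; 6; 1; 1]); ([::],
2, [:: 0; 4; 2; 5; 7; 5]); ([::], 40, [:: 1; 4; 6; 1; 1]); ([::], 1, [:: 1; 1; 1; 3; 4; 3]); ([::], 18, [:: 2; 3; 6;
0; 5; 1]); ([:: [:: 89; 46; 63; 22]], 7, [:: 1; 0; 4; 6; 3])]); ([:: 6; 7; 11; 13; 15; 16; 17; 18; 20; 24], [::], 200,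
[:: ([:: [:: 113; 35; 107; 28]], 1, [:: 0; 6; 0; 5; 2]); ([:: [:: 93; 34; 33; 119; 26; 112; 23]], 35, [:: 7; 3; 3;
7]); ([::], 11, [:: 2; 2; 2; 3; 5]); ([::], 40, [:: 1; 5; 5; 3; 5]); ([::], 17, [:: 7; 5; 6; 7]); ([::], 42, [:: 0; 6;
5; 5; 3]); ([::], 35, [:: 7; 3; 3; 7]); ([::], 2, [:: 3; 3; 0; 2; 6]); ([::], 40, [:: 0; 0; 5; 0]); ([::], 18, [:: 3;
4; 2; 7; 4]); ([::], 42, [:: 4; 5; 6; 6]); ([::], 14, [:: 0; 7; 7; 7])]); ([:: 4; 8; 10; 11; 13; 15; 16; 17; 18; 20],
[::], 4, [:: ([:: [:: 100]], 14, [:: 1; 2; 6; 1; 4]); ([:: [:: 29; 108; 105; 34]], 7, [:: 2; 4; 3; 5; 7]); ([::], 58,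
[::]); ([:: [:: 80]], 11, [:: 3; 5; 3; 7; 1]); ([:: [:: 28; 112; 43; 95; 80]], 25, [:: 0; 4; 7; 5; 1; 4]); ([::], 43,
[:: 4; 7; 2; 0; 6]); ([:: [:: 57; 90; 59; 86]], 1, [:: 3; 6; 1; 2; 3]); ([::], 43, [:: 3; 5; 6; 4; 5])]); ([:: 1; 7;
8; 9; 11; 15; 16; 17; 18; 20], [::], 227, [:: ([::], 4, [:: 2; 1; 2; 6; 5]); ([::], 2, [:: 3; 5; 2]); ([::], 7, [:: 5;
0; 1; 4; 3]); ([:: [:: 34; 96]], 7, [:: 0; 1; 3; 1; 2; 7]); ([::], 1, [:: 1; 4; 0; 7]); ([::], 44, [:: 1; 7; 3; 6;
1]); ([:: [:: 59; 115; 89; 27]], 2, [:: 2; 6; 7; 2; 5]); ([:: [:: 34]], 44, [:: 1; 7; 3; 6; 1]); ([::], 1, [:: 7; 1;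
1; 1; 7]); ([::], 9, [:: 4; 7; 2; 0; 6]); ([:: [:: 80; 46]], 1, [:: 3; 5; 3; 5; 5]); ([::], 18, [:: 5; 4; 3; 1; 1])]);
([:: 1; 2; 4; 8; 9; 12; 17; 18; 19; 20], [::], 53, [:: ([::], 0, [:: 7; 4; 0]); ([:: [:: 118]; [:: 45; 102]], 8, [::
2; 3; 1; 6]); ([::], 21, [:: 1; 7; 7; 0; 2]); ([:: [:: 90]], 22, [:: 0; 7; 3; 7; 4]); ([:: [:: 92; 35]], 0, [:: 0; 7;
4; 7; 7]); ([::], 59, [:: 0; 3; 7; 4; 4; 7]); ([::], 2, [:: 0; 4; 7; 6; 4; 2]); ([::], 6, [:: 1; 2; 0; 6; 3; 2])]);
([:: 4; 6; 7; 9; 13; 16; 17; 18; 19; 20], [::], 66, [:: ([::], 0, [:: 1; 7; 7; 0]); ([::], 13, [:: 6; 6; 7; 7; 6]);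
([::], 22, [:: 1; 1; 5; 2; 2]); ([:: [:: 46; 87; 82]], 13, [::]); ([::], 59, [:: 0; 6; 5; 6; 2]); ([:: [:: 89; 33; 16;
119; 117]], 27, [:: 3; 1; 0; 5; 5]); ([:: [:: 94; 35]], 0, [:: 2; 0; 2; 0; 4]); ([:: [:: 59; 86; 34; 83; 52]], 22, [::
1; 1; 5; 2; 2]); ([::], 28, [:: 0; 1; 5; 6; 7; 2]); ([::], 28, [:: 3; 7; 0; 3]); ([::], 60, [:: 4; 5; 3; 7]); ([::],
28, [:: 0; 5; 6; 3])]); ([:: 1; 8; 10; 11; 13; 15; 16; 17; 18; 20], [::], 2, [:: ([::], 6, [:: 6; 5; 0]); ([::], 2,
[:: 0; 1; 2]); ([:: [:: 100]], 14, [:: 1; 2; 6; 1; 4]); ([::], 58, [:: 1; 7; 3; 6; 1]); ([::], 0, [:: 2; 1; 2; 7]);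
([::], 35, [:: 0; 4; 1; 4; 5]); ([::], 25, [:: 4; 5; 7; 7; 5]); ([:: [:: 88; 18; 42; 93; 100]], 35, [:: 0; 4; 1; 4;
5])]); ([:: 0; 4; 6; 7; 9; 11; 12; 16; 17; 18], [::], 79, [:: ([:: [:: 115]], 6, [:: 0; 0; 0; 6; 0; 5]); ([:: [::
118]], 5, [:: 6; 0; 0; 2; 4]); ([::], 1, [:: 0; 0; 5; 7; 6; 2]); ([:: [:: 82]], 16, [:: 1; 2; 2; 3; 7]); ([:: [::
83]], 19, [:: 0; 3; 1; 7; 0; 4]); ([:: [:: 98]], 7, [:: 4; 5; 2; 2; 4; 6]); ([:: [:: 86; 34; 110]], 1, [:: 7; 4; 5; 2;
5]); ([:: [:: 98; 32]; [:: 81; 41; 86]], 2, [:: 2; 5; 6; 6; 4; 5]); ([:: [:: 98; 29]], 0, [:: 0; 0; 1; 1; 0; 3]);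
([::], 12, [:: 0; 2; 5; 0; 7; 0]); ([:: [:: 81; 22; 21; 60; 55; 98; 26]], 45, [:: 2; 1; 0; 1; 2]); ([::], 45, [:: 2;
1; 0; 1; 2])]); ([:: 4; 5; 6; 9; 11; 15; 16; 17; 18; 20], [::], 203, [:: ([::], 0, [:: 2; 5; 4; 7; 7]); ([::], 8, [::
1; 3; 2; 1; 1; 4]); ([:: [:: 78]], 9, [:: 6; 1; 4; 7]); ([::], 21, [:: 3; 4; 6; 5]); ([::], 20, [:: 5; 2; 2; 1; 5]);
([:: [:: 94]], 22, [:: 6; 4; 2; 7; 0]); ([::], 59, [:: 7; 3; 3; 7]); ([:: [:: 35]], 4, [:: 1; 7; 2; 6; 7; 3]); ([::
[:: 34]], 22, [:: 6; 4; 2; 7; 0]); ([:: [:: 59; 81; 33; 85; 94]], 0, [:: 0; 5; 5; 5; 2]); ([::], 6, [:: 0; 0; 1; 7; 3;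
0]); ([::], 2, [:: 1; 3; 1; 3])]); ([:: 4; 5; 8; 12; 16], [:: [:: 53; 91; 47; 84; 80]], 17, [:: ([::], 2, [:: 0; 3; 5;
6; 7; 6]); ([::], 2, [:: 1; 3; 1; 1; 2; 1]); ([::], 65, [:: 0; 6; 0; 0; 1]); ([::], 65, [:: 0; 2; 1; 5; 3; 7]); ([::],
1, [:: 0; 4; 7; 3; 6]); ([::], 64, [:: 2; 0; 2; 4]); ([::], 3, [:: 0; 0; 1; 1; 0]); ([::], 62, [:: 1; 0; 4; 5; 5])]);
([:: 6; 7; 8; 11; 12; 13; 16; 17; 18], [::], 74, [:: ([:: [:: 110]], 29, [:: 4; 0; 5; 5]); ([:: [:: 109]; [:: 92; 29;
73; 50]], 18, [:: 1; 1; 6; 1; 7]); ([:: [:: 29; 103; 22; 119]], 7, [:: 7; 3; 5; 4]); ([::], 7, [:: 0; 2; 1; 0; 4; 0]);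
([::], 44, [:: 0; 7; 0; 7; 3]); ([:: [:: 92]], 11, [:: 6; 0; 1; 4; 2]); ([:: [:: 51; 85; 45; 80]], 1, [::]); ([::],
41, [:: 0; 0; 2; 7; 3; 7]); ([:: [:: 94; 45; 29; 108; 80]], 25, [:: 1; 2; 0; 6; 3]); ([::], 26, [:: 7; 5; 7; 3; 2]);
([::], 67, [:: 6; 6; 4]); ([:: [:: 38; 94; 86; 40]; [:: 83]], 2, [:: 1; 6; 5; 6; 2; 0])]); ([:: 4; 6; 10; 11; 13; 16;
17; 18; 20], [::], 14, [:: ([::], 2, [:: 6; 5; 1; 6; 7]); ([:: [:: 112]; [:: 119; 34; 26]], 7, [:: 1; 2; 2; 6; 2]);
([::], 68, [::]); ([::], 67, [:: 2; 0; 7; 1]); ([:: [:: 35]; [:: 37; 87; 79]], 7, [:: 1; 0; 4; 7; 7]); ([:: [:: 34]],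
44, [:: 0; 3; 6; 1; 2]); ([::], 38, [:: 1; 7; 0; 6]); ([::], 41, [:: 2; 3; 2; 3; 6])]); ([:: 1; 8; 9; 11; 15; 16; 17;
18; 20], [::], 227, [:: ([:: [:: 26; 104; 46; 72; 34]], 7, [:: 3; 5; 7]); ([::], 2, [:: 3; 5; 2]); ([::], 11, [:: 0;
0; 1; 5; 7; 0]); ([::], 15, [:: 4; 2; 4; 3]); ([::], 3, [:: 4; 0; 2; 0; 2]); ([:: [:: 94]], 47, [:: 1; 2; 2; 5; 7]);
([::], 24, [:: 6; 4; 2; 7; 0]); ([::], 47, [:: 1; 2; 2; 5; 7]); ([::], 1, [:: 7; 1; 1; 1; 7]); ([::], 17, [:: 0; 3; 3;
4; 1; 3]); ([::], 14, [:: 3; 3; 0; 4]); ([::], 18, [:: 5; 4; 3; 1; 1])]); ([:: 1; 6; 9; 11; 15; 16; 17; 18; 20], [::],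
203, [:: ([::], 2, [:: 0; 0; 3; 1; 1]); ([::], 2, [:: 2; 0; 1; 0; 3]); ([::], 15, [:: 4; 2; 4; 3]); ([::], 11, [:: 0;
3; 6; 4; 1]); ([::], 15, [:: 1; 7; 6; 0; 6]); ([::], 50, [:: 0; 3; 6; 1; 2]); ([::], 23, [:: 0; 1; 4; 2; 1]); ([::],
1, [:: 5; 1; 5; 3; 0]); ([:: [:: 34]], 50, [:: 0; 3; 6; 1; 2]); ([::], 23, [:: 2; 6; 2; 1; 5]); ([::], 14, [:: 1; 0;
7; 0; 1]); ([::], 14, [:: 0; 3; 5; 5; 6])]); ([:: 4; 9; 11; 12; 13; 16; 17; 18; 20], [::], 70, [:: ([::], 24, [:: 3;
6; 7; 0]); ([::], 41, [:: 1; 4; 7; 6; 6]); ([:: [:: 35; 116; 22; 105]], 7, [:: 0; 1; 6; 6; 0]); ([:: [:: 84]; [:: 57;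
93; 46; 82]], 18, [:: 7; 1; 3; 5; 7]); ([::], 3, [:: 0; 1; 1; 7; 7; 5]); ([:: [:: 94]], 47, [:: 3; 6; 7; 0]); ([::],
3, [:: 0; 2; 2; 5; 4; 0]); ([::], 47, [:: 3; 6; 7; 0]); ([:: [:: 48; 90; 111; 15]], 1, [:: 4; 7; 7; 0; 0]); ([::], 69,
[:: 2; 6; 6; 1; 4]); ([::], 38, [:: 0; 4; 3; 7; 2; 1]); ([::], 17, [:: 0; 2; 1; 5; 5; 5])]); ([:: 1; 4; 9; 11; 15; 16;
17; 18; 20], [::], 7, [:: ([::], 51, [:: 0; 0; 6; 6; 6; 1]); ([:: [:: 99]], 17, [:: 1; 0; 3; 0; 6; 2]); ([::], 11, [::
0; 0; 1; 5; 7; 0]); ([::], 42, [:: 2; 1; 4; 5; 4]); ([::], 2, [:: 1; 3; 1; 3; 7; 6]); ([:: [:: 53; 100; 80; 6; 94]],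
51, [:: 0; 0; 6; 6; 6; 1]); ([::], 14, [:: 1; 2; 0; 3]); ([::], 70, [:: 7; 0; 3; 3; 6])]); ([:: 2; 6; 8; 10; 13; 16;
17; 18; 20], [::], 224, [:: ([::], 1, [:: 3; 3; 0; 4]); ([::], 1, [:: 4; 4; 4; 2]); ([:: [:: 79]], 18, [:: 2; 0; 7; 4;
0; 7]); ([:: [:: 87; 35; 97]], 6, [:: 2; 0; 0; 1; 7]); ([::], 3, [:: 3; 2; 0; 3; 2]); ([::], 53, [:: 2; 0; 7; 1]);
([:: [:: 35; 97; 27; 111; 19]], 53, [:: 2; 0; 7; 1]); ([::], 16, [:: 5; 3; 1; 7; 3]); ([::], 6, [:: 3; 4; 6; 2; 4]);
([::], 0, [:: 4; 5; 4; 5; 2]); ([::], 12, [:: 0; 6; 0; 6; 1; 1]); ([:: [:: 83; 20]], 1, [:: 0; 0; 7; 3; 0; 0])]); ([::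
1; 4; 5; 9; 11; 16; 17; 18; 20], [::], 13, [:: ([::], 2, [:: 1; 6; 7; 7; 3]); ([:: [:: 29; 63; 99]], 7, [:: 0; 0; 4;
7; 6; 7]); ([::], 38, [:: 1; 2; 1; 7; 1; 6]); ([::], 40, [:: 0; 3; 4; 7; 0; 2]); ([::], 2, [:: 1; 3; 1; 3; 7; 6]);
([::], 14, [:: 0; 0; 2; 1; 2; 7]); ([:: [:: 63; 39; 29]; [:: 82]], 7, [:: 4; 0; 0; 4; 5]); ([::], 69, [:: 0; 7; 6; 5;
4])]); ([:: 1; 4; 9; 10; 13; 16; 17; 18; 20], [::], 14, [:: ([:: [:: 34; 66; 20; 113]], 7, [:: 2; 3; 5; 6]); ([::], 1,
[:: 0; 6; 1; 6; 6]); ([:: [:: 86; 22; 38; 115; 60]], 38, [:: 1; 4; 7; 6; 6]); ([::], 40, [:: 0; 1; 6; 6; 3]); ([:: [::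
47; 106]], 1, [:: 4; 4; 3; 0; 5]); ([::], 15, [:: 0; 1; 5; 3; 0; 2]); ([::], 2, [:: 7; 2; 0; 3]); ([::], 69, [:: 6; 0;
1; 1; 0])]); ([:: 7; 8; 9; 11; 15; 16; 17; 18; 20], [::], 224, [:: ([::], 18, [:: 0; 4; 6; 3; 1; 5]); ([::], 52, [::
7; 3; 3; 7]); ([::], 40, [:: 2; 4; 7; 1; 1]); ([:: [:: 82]], 17, [:: 1; 1; 6; 1; 6]); ([::], 3, [:: 3; 7; 0; 3; 7]);
([::], 71, [:: 7; 0; 3; 3; 6]); ([:: [:: 59; 92; 89; 43; 82]], 52, [:: 7; 3; 3; 7]); ([::], 39, [:: 0; 2; 4; 6; 4;
6]); ([::], 43, [:: 7; 3; 6]); ([::], 17, [:: 4; 7; 2; 0; 6]); ([:: [:: 94; 51; 80]], 1, [:: 0; 1; 1; 1; 5]); ([::],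
70, [:: 4; 2; 5; 2; 6])]); ([:: 4; 6; 9; 11; 12; 16; 17; 18; 20], [::], 70, [:: ([::], 2, [:: 3; 3; 7; 6; 1]); ([::
[:: 34; 115]], 7, [:: 2; 6; 0; 1; 6]); ([::], 4, [:: 0; 2; 4; 6; 1]); ([::], 20, [:: 5; 2; 2; 1; 5]); ([::], 1, [:: 6;
3; 6; 6; 1]); ([::], 72, [:: 0; 7; 6; 5; 4]); ([::], 4, [:: 4; 1; 2; 5; 4]); ([:: [:: 34]], 44, [:: 2; 4; 7; 0; 6]);
([:: [:: 48; 90; 80; 42]], 1, [:: 4; 7; 7; 0; 0]); ([::], 18, [:: 2; 6; 1; 2; 6]); ([::], 1, [:: 7; 6; 0; 3; 1]); ([::
[:: 35; 114; 39; 21; 85]], 27, [:: 0; 0; 0; 4])]); ([:: 1; 4; 8; 9; 10; 17; 18; 19; 20], [::], 215, [:: ([:: [:: 107;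
24; 46; 72]], 1, [:: 2; 1; 6; 6; 2]); ([::], 29, [:: 7; 2; 7; 6; 5]); ([::], 40, [:: 1; 1; 1; 6; 1; 3]); ([:: [::
79]], 17, [:: 1; 2; 2; 6; 2]); ([::], 11, [:: 3; 0; 7; 0; 1]); ([::], 42, [:: 7; 4; 7; 3; 1]); ([::], 14, [:: 7; 3; 1;
7]); ([::], 18, [:: 1; 6; 2; 3; 4]); ([::], 35, [:: 5; 7; 3; 1]); ([::], 2, [:: 1; 0; 4; 3; 1]); ([::], 25, [:: 0; 6;
4; 3; 2]); ([::], 70, [:: 0; 0; 5; 0; 0; 0])]); ([:: 0; 1; 4; 7; 11; 15; 16; 17; 18], [::], 211, [:: ([::], 13, [:: 2;
1; 7; 5; 2]); ([::], 0, [:: 0; 1; 5; 2; 3]); ([::], 21, [:: 0; 6; 3; 1; 1]); ([::], 27, [:: 6; 6; 7; 1; 4]); ([:: [::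
86]], 22, [:: 0; 0; 5; 4; 4; 4]); ([:: [:: 106]], 17, [:: 0; 4; 2; 0; 4; 2]); ([:: [:: 59; 115; 86; 24]], 0, [:: 1; 2;
0]); ([::], 2, [:: 5; 6; 7; 4; 3]); ([::], 6, [:: 6; 2; 2; 7; 3]); ([::], 34, [:: 0; 1; 5; 6; 6; 6]); ([::], 73, [::
7; 1; 0; 6; 7]); ([::], 6, [:: 1; 4; 5; 6])]); ([:: 0; 5; 7; 8; 11; 15; 16; 17; 18], [::], 45, [:: ([::], 2, [:: 1; 3;
1; 1; 2; 1]); ([::], 44, [:: 1; 7; 4; 3; 1; 1]); ([::], 7, [:: 2; 7; 4; 1; 1]); ([:: [:: 107]], 11, [:: 5; 7; 3; 2;
6]); ([:: [:: 59; 98; 82; 18]], 2, [:: 1; 3; 1; 1; 2; 1]); ([:: [:: 34; 68; 11; 82]], 1, [:: 0; 0; 0; 1; 6; 3]);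
([::], 26, [:: 1; 2; 5; 0; 6; 5]); ([::], 67, [:: 0; 7; 4; 6; 5])]); ([:: 1; 4; 8; 9; 12; 17; 18; 19; 20], [::], 5,
[:: ([::], 73, [::]); ([::], 73, [:: 0; 6; 5; 6; 2]); ([:: [:: 51; 115; 79; 9; 90]], 34, [:: 0; 0; 5; 0]); ([:: [::
52; 117; 80; 10; 90]], 34, [:: 0; 3; 7; 4; 4; 7]); ([::], 54, [:: 4; 3; 2; 5; 7]); ([:: [:: 89; 27; 26; 76; 59; 39;
63]], 54, [:: 4; 3; 2; 5; 7]); ([::], 74, [:: 4; 5; 2; 5; 6]); ([::], 22, [:: 0; 0; 3; 6; 4])]); ([:: 2; 8; 9; 11; 15;
16; 17; 18; 20], [::], 224, [:: ([::], 6, [:: 4; 2; 3; 1; 5]); ([::], 2, [:: 0; 0; 2; 1; 1; 0]); ([:: [:: 99]], 14,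
[:: 0; 0; 2; 6; 6; 1]); ([:: [:: 35; 97]], 7, [:: 2; 6; 2; 0]); ([::], 3, [:: 0; 4; 7; 1; 0]); ([::], 75, [:: 1; 2; 2;
5; 7]); ([::], 19, [::]); ([::], 39, [::]); ([::], 35, [:: 3; 4; 4; 6; 0]); ([::], 0, [:: 4; 1; 0; 5; 1]); ([::], 8,
[:: 3; 0; 6; 4; 5]); ([::], 25, [:: 1; 2; 2; 1; 5])]); ([:: 0; 4; 5; 7; 11; 12; 16; 17; 18], [::], 9, [:: ([::], 7,
[:: 0; 1; 2; 1; 3; 6]); ([:: [:: 114]], 6, [:: 4; 0; 2; 4; 6]); ([:: [:: 82]], 24, [:: 5; 0; 4]); ([::], 76, [:: 1; 2;
2; 5; 7]); ([:: [:: 101; 35]], 1, [:: 0; 0; 6; 7; 4]); ([::], 28, [:: 6; 1; 6; 7; 2]); ([:: [:: 81; 23; 21; 61; 54;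
101; 26]], 53, [:: 0; 4; 1; 6; 4; 0]); ([::], 53, [:: 0; 4; 1; 6; 4; 0])]); ([:: 1; 10; 11; 13; 15; 16; 17; 18; 20],
[::], 2, [:: ([::], 14, [:: 6; 7; 4; 7; 1]); ([::], 2, [:: 0; 1; 2]); ([::], 40, [:: 1; 2; 6; 1; 4]); ([::], 67, [::
1; 7; 3; 6; 1]); ([:: [:: 94; 39; 100]], 1, [:: 4; 2; 1; 2; 5]); ([::], 70, [:: 0; 1]); ([::], 41, [:: 4; 6; 7; 6]);
([:: [:: 20; 112; 43; 95; 88]], 35, [:: 0; 4; 1; 4; 5])]); ([:: 1; 2; 9; 11; 15; 16; 17; 18; 20], [::], 2, [:: ([::],
8, [:: 5; 4; 6; 4; 7]); ([::], 0, [:: 4; 4; 0; 3]); ([:: [:: 99]], 17, [:: 1; 0; 3; 0; 6; 2]); ([::], 77, [:: 0; 7; 6;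
5; 4]); ([::], 32, [:: 2; 2; 1; 2; 2]); ([::], 2, [:: 1; 2; 1; 6; 7]); ([::], 6, [:: 2; 0; 6; 2; 6]); ([::], 25, [::
1; 4; 0; 2; 7; 3])]); ([:: 4; 6; 7; 9; 11; 12; 16; 17; 18], [::], 79, [:: ([:: [:: 115]], 14, [:: 0; 1; 1; 2; 2; 1]);
([::], 7, [:: 1; 2; 1; 7; 3]); ([:: [:: 119]; [:: 34; 112; 23]], 7, [:: 5; 5; 6; 7; 7]); ([::], 36, [:: 3; 5]); ([::
[:: 83]], 39, [:: 6; 7; 2; 3; 4]); ([:: [:: 86]], 11, [:: 5; 3; 5; 3; 2]); ([:: [:: 34; 119; 52; 86; 83]], 25, [:: 4;
5; 6; 6]); ([:: [:: 81; 41; 86]; [:: 98; 32]], 2, [:: 2; 5; 6; 6; 4; 5]); ([:: [:: 48; 90; 80; 42]], 1, [:: 4; 7; 7;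
0; 0]); ([::], 43, [:: 0; 7; 4; 2; 3]); ([::], 71, [:: 0; 6; 0; 0; 1]); ([::], 45, [:: 2; 1; 0; 1; 2])]); ([:: 4; 8;
9; 11; 15; 16; 17; 18; 20], [::], 13, [:: ([:: [:: 93; 35; 33; 67; 39; 104; 20]], 53, [:: 0; 0; 6; 6; 6; 1]); ([:: [::
99]], 14, [:: 0; 0; 2; 6; 6; 1]); ([::], 3, [:: 0; 1; 1; 7; 7; 5]); ([::], 71, [:: 1; 2; 2; 5; 7]); ([:: [:: 35]], 36,
[::]); ([::], 53, [:: 0; 0; 6; 6; 6; 1]); ([::], 43, [:: 0; 7; 7; 7; 5; 7]); ([::], 17, [:: 1; 7; 3; 7; 4])]); ([:: 0;
3; 6; 7; 8; 10; 14; 16; 17], [::], 193, [:: ([:: [:: 102]], 19, [:: 1; 3; 0; 6; 5]); ([::], 1, [:: 0; 5; 0; 7; 1]);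
([:: [:: 104]], 16, [:: 2; 6; 5; 1; 5]); ([:: [:: 83]], 7, [:: 2; 1; 3; 6; 3; 6]); ([:: [:: 91]], 22, [:: 1; 2; 5; 3;
7]); ([:: [:: 113]], 7, [:: 3; 6; 2; 1; 1]); ([:: [:: 81; 22; 68]], 0, [:: 0; 5; 3; 2; 4; 2]); ([:: [:: 89; 35; 68];
[:: 45; 79]], 2, [:: 0; 0; 6; 3; 3; 4]); ([::], 56, [:: 1; 3; 1; 5; 1; 6]); ([:: [:: 119; 33; 57; 76; 29]], 56, [:: 1;
3; 1; 5; 1; 6]); ([:: [:: 55; 68; 83; 47]], 1, [:: 3; 6; 2; 3; 6]); ([::], 12, [:: 1; 5; 4; 0; 5])]); ([:: 4; 8; 12;
16], [:: [:: 53; 91; 47; 84; 80]], 17, [:: ([::], 3, [:: 6; 7; 4; 6; 5]); ([::], 3, [:: 3; 6; 7; 1; 4]); ([::], 78,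
[:: 1; 5; 6; 0; 5]); ([::], 78, [:: 4; 7; 7; 7; 6]); ([::], 3, [:: 0; 2; 1; 6; 6; 6]); ([::], 78, [:: 1; 4; 2; 2]);
([::], 3, [:: 0; 0; 1; 1; 0]); ([::], 78, [:: 4; 0; 7; 4; 2])]); ([:: 5; 7; 9; 10; 12; 16; 17; 18], [::], 16, [::
([::], 40, [:: 6; 4; 3; 1; 6]); ([:: [:: 35; 105; 26; 116]], 7, [:: 2; 3; 2; 5; 6]); ([::], 11, [:: 3; 1; 5; 1]);
([::], 79, [:: 0; 5; 4; 3; 5]); ([::], 38, [:: 4; 0; 4; 1]); ([:: [:: 32; 116; 48; 88; 83]], 38, [:: 5; 6; 2; 1; 3]);
([::], 25, [:: 0; 3; 7; 6; 1]); ([::], 80, [:: 0; 0; 2; 6; 6])]); ([:: 4; 7; 8; 9; 16; 17; 18; 20], [::], 66, [::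
([::], 18, [:: 0; 4; 6; 3; 1; 5]); ([:: [:: 34; 96; 27; 78; 106]], 32, [:: 5; 1; 6; 6; 4]); ([::], 14, [:: 2; 4; 7; 1;
1]); ([::], 16, [:: 2; 7; 6; 5; 1]); ([::], 47, [:: 6; 6; 6; 4; 5]); ([::], 1, [:: 0; 0; 6; 6; 2; 0]); ([:: [:: 80;
35]; [:: 99; 7; 104]], 7, [:: 5; 7; 6; 4]); ([::], 15, [:: 4; 5; 4; 3; 1]); ([::], 25, [:: 0; 2; 4; 3; 3; 3]); ([::],
2, [:: 0; 4; 1; 0; 4; 5]); ([::], 3, [:: 7; 6; 3; 5; 7]); ([::], 81, [:: 0; 2; 0; 0; 3; 6])]); ([:: 4; 9; 11; 13; 16;
17; 18; 20], [::], 14, [:: ([:: [:: 72; 46; 26; 104]], 30, [:: 3; 7; 2; 1]); ([::], 23, [:: 1; 0; 6; 2]); ([::], 83,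
[::]); ([::], 63, [:: 6; 1; 4; 0; 7]); ([::], 3, [:: 0; 2; 2; 5; 4; 0]); ([::], 63, [:: 3; 7; 2; 1]); ([::], 81, [::
6; 3; 0; 4]); ([::], 82, [:: 6; 0; 3; 3; 5])]); ([:: 6; 7; 9; 11; 16; 17; 18; 20], [::], 14, [:: ([::], 2, [:: 3; 7;
6; 6; 5]); ([::], 51, [:: 7; 3; 3; 7]); ([::], 41, [:: 4; 5; 6; 6]); ([::], 84, [:: 0; 7; 6; 5; 4]); ([::], 2, [:: 0;
4; 2; 5; 7; 5]); ([:: [:: 34]], 50, [:: 1; 4; 0; 7]); ([::], 80, [:: 1; 0; 6; 1; 4]); ([::], 14, [:: 5; 0; 4; 5;
7])]); ([:: 1; 5; 7; 11; 12; 16; 17; 18], [::], 237, [:: ([:: [:: 114]], 17, [:: 4; 2; 0; 0; 5]); ([::], 2, [:: 0; 0;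
4; 5; 4]); ([::], 11, [:: 4; 4; 3]); ([::], 42, [:: 0; 7; 4; 5; 2]); ([::], 50, [:: 5; 0; 4]); ([::], 40, [:: 0; 5; 7;
4; 4]); ([::], 23, [:: 2; 2; 5; 0; 2]); ([::], 38, [:: 0; 0; 2; 5; 6; 4]); ([::], 14, [:: 3; 2; 6; 3; 2]); ([::], 84,
[:: 0; 6; 0; 0; 1]); ([::], 2, [:: 0; 3; 2; 1; 0]); ([:: [:: 38; 115; 86; 0; 82]], 51, [:: 0; 4; 1; 6; 4; 0])]); ([::
4; 6; 8; 9; 16; 17; 18; 20], [::], 4, [:: ([::], 12, [:: 1; 6; 0; 6; 0]); ([::], 6, [:: 1; 2; 4; 1]); ([::], 16, [::
0; 1; 1; 6; 3]); ([:: [:: 89; 33; 39; 79; 109]], 53, [:: 4; 3; 6; 7; 7]); ([::], 85, [:: 1; 2; 7; 7; 2; 0]); ([::], 1,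
[:: 4; 6; 3; 4]); ([::], 3, [:: 7; 6; 3; 5; 7]); ([::], 53, [:: 0; 5; 4; 0; 1; 4])]); ([:: 1; 4; 5; 6; 10; 16; 17;
20], [::], 58, [:: ([:: [:: 63]], 14, [:: 0; 4; 0; 3; 1]); ([::], 48, [:: 2; 0; 6; 1]); ([::], 42, [:: 2; 5; 6; 4]);
([:: [:: 34; 84; 115]], 7, [:: 2; 1; 6; 7; 3]); ([::], 37, [:: 2; 5; 1]); ([::], 2, [:: 2; 7; 7; 6; 0]); ([::], 14,
[:: 0; 6; 3; 6; 3; 4]); ([::], 86, [:: 5; 7; 1; 2])]); ([:: 1; 4; 9; 10; 16; 17; 18; 20], [::], 48, [:: ([::], 1, [::
0; 6; 1; 6; 6]); ([:: [:: 34; 115; 24; 81; 100]], 35, [:: 0; 0; 0; 2; 1]); ([::], 38, [:: 3; 4; 6; 4; 0]); ([::], 87,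
[::]); ([:: [:: 28; 102; 18; 33; 100]], 48, [::]); ([::], 15, [:: 0; 1; 5; 3; 0; 2]); ([::], 12, [:: 0; 1; 7; 0; 7;
2]); ([:: [:: 23; 69; 49; 96; 34]], 26, [:: 4; 5; 7; 7; 5])]); ([:: 0; 1; 2; 6; 10; 16; 17; 20], [::], 91, [:: ([::],
3, [:: 3; 4; 1; 5; 7]); ([:: [:: 61]], 18, [:: 6; 1; 3; 6; 3]); ([::], 1, [:: 0; 3; 1; 5; 3; 6]); ([::], 53, [:: 0; 4;
1; 5; 7]); ([:: [:: 69]], 18, [:: 4; 2; 1; 3; 4]); ([:: [:: 115; 35; 73]], 6, [:: 6; 3; 7; 5]); ([:: [:: 117; 58; 98;
34]], 1, [:: 7; 4; 5; 2; 5]); ([::], 0, [:: 0; 7; 2; 4; 7]); ([::], 85, [:: 0; 5; 1; 7; 2]); ([::], 12, [:: 0; 0; 4;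
4; 4; 3]); ([:: [:: 35; 73; 55; 98; 9]], 53, [:: 0; 7; 1; 0; 2]); ([::], 6, [:: 5; 5; 1; 5])]); ([:: 1; 3; 6; 10; 11;
16; 17; 20], [::], 58, [:: ([::], 3, [:: 0; 2; 5; 0; 4]); ([:: [:: 83]], 47, [:: 0; 3; 6; 1; 0; 4]); ([::], 40, [:: 1;
7; 6; 0; 6; 1]); ([:: [:: 115]], 17, [:: 3; 3; 3; 1; 3]); ([:: [:: 32; 116; 28; 76]], 1, [:: 0; 6; 5; 1; 2]); ([::],
17, [:: 7; 0; 2; 2; 6]); ([:: [:: 44; 117; 14; 95; 70]], 52, [:: 0; 7; 1; 0; 2]); ([::], 88, [:: 7; 4; 4; 1; 2])]);
([:: 4; 9; 11; 12; 16; 17; 18; 20], [::], 75, [:: ([::], 52, [:: 0; 0; 6; 6; 6; 1]); ([:: [:: 35; 114; 21; 85; 99]],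
32, [:: 1; 7; 7; 2]); ([::], 18, [:: 4; 2; 1; 3; 2]); ([::], 89, [::]); ([::], 3, [:: 0; 1; 1; 7; 7; 5]); ([::], 88,
[:: 0; 7; 6; 5; 4]); ([::], 39, [:: 1; 4; 7; 3; 3]); ([::], 47, [:: 3; 6; 7; 0]); ([:: [:: 48; 90; 80; 42]], 1, [:: 4;
7; 7; 0; 0]); ([::], 90, [:: 1; 4; 0; 5; 5]); ([::], 32, [:: 0; 5; 2; 1; 5]); ([::], 33, [:: 5; 4; 5; 1])]); ([:: 6;
7; 9; 11; 12; 16; 17; 18], [::], 15, [:: ([::], 40, [:: 0; 1; 1; 2; 2; 1]); ([::], 40, [:: 6; 3; 6; 3; 1]); ([::], 79,
[:: 2; 0; 2; 4]); ([::], 79, [:: 0; 0; 2; 6; 6]); ([::], 41, [:: 4; 5; 6; 6]); ([::], 90, [:: 1; 1; 4; 3; 7; 1]);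
([::], 41, [:: 3; 7; 1; 5; 2]); ([::], 90, [:: 1; 0; 2; 4; 7])]); ([:: 4; 9; 11; 15; 16; 17; 18; 20], [::], 12, [::
([::], 61, [:: 0; 0; 6; 6; 6; 1]); ([::], 84, [::]); ([::], 88, [:: 0; 7; 6; 5; 4]); ([::], 63, [:: 6; 1; 4; 0; 7]);
([::], 63, [:: 3; 7; 2; 1]); ([::], 61, [:: 0; 5; 2; 0; 4; 7]); ([::], 84, [:: 3; 2; 4; 3; 7]); ([::], 88, [:: 2; 2;
0; 5; 7])]); ([:: 0; 1; 7; 11; 12; 16; 17; 18], [::], 17, [:: ([::], 13, [:: 1; 7; 1; 1; 2; 3]); ([::], 0, [:: 0; 1;
5; 2; 3]); ([::], 27, [:: 1; 7; 3; 0]); ([::], 91, [:: 0; 7; 0; 7; 3]); ([::], 6, [:: 5; 0; 4; 5; 3]); ([::], 34, [::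
1; 4; 0; 4; 1]); ([::], 6, [:: 7; 7; 1; 2; 1]); ([::], 34, [:: 1; 6; 0; 3; 5])]); ([:: 5; 7; 8; 11; 15; 16; 17; 18],
[::], 12, [:: ([::], 92, [::]); ([::], 92, [:: 0; 1; 4; 1; 3]); ([::], 50, [:: 4; 2; 4; 3]); ([::], 50, [:: 0; 2; 2;
5; 3]); ([::], 84, [:: 3; 7; 5; 0; 1]); ([::], 48, [:: 0; 6; 7; 2; 4]); ([::], 84, [:: 5; 1; 1; 7; 7]); ([::], 48, [::
2; 6; 6])]); ([:: 0; 4; 7; 11; 15; 16; 17; 18], [::], 15, [:: ([::], 91, [::]); ([::], 91, [:: 2; 0; 7; 1]); ([::],
92, [:: 0; 6; 0; 0; 1]); ([::], 92, [:: 0; 2; 0; 1; 1]); ([::], 64, [:: 2; 1; 7; 5; 2]); ([::], 64, [:: 3; 3; 3; 1; 3;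
0]); ([::], 23, [:: 5; 0; 1; 2; 4]); ([::], 93, [:: 0; 7; 6; 2; 7; 1])]); ([:: 1; 4; 11; 15; 16; 17; 18; 20], [::],
13, [:: ([:: [:: 93; 34; 33; 72; 26; 104; 46]], 62, [:: 0; 3; 6; 2; 6]); ([::], 33, [:: 0; 6; 3; 2; 4; 7]); ([::], 43,
[:: 6; 6; 4; 1]); ([::], 47, [:: 0; 4; 6; 0; 2; 3]); ([::], 3, [:: 2; 1; 6; 5; 6]); ([::], 62, [:: 0; 3; 6; 2; 6]);
([::], 43, [:: 0; 1; 7; 2; 5]); ([::], 88, [:: 0; 2; 3; 1; 2; 5])]); ([:: 2; 4; 9; 11; 16; 17; 18; 20], [::], 14, [::
([::], 24, [:: 3; 7; 2; 2; 3]); ([::], 1, [:: 0; 4; 7; 1; 2; 5]); ([:: [:: 35; 114; 21; 85; 99]], 32, [:: 1; 7; 7;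
2]); ([::], 47, [:: 5; 0; 5; 5; 7]); ([::], 15, [:: 6; 7; 2; 1; 2]); ([::], 3, [:: 0; 1; 7; 1; 3; 5]); ([::], 81, [::
0; 2; 6; 4]); ([::], 2, [:: 1; 2; 1; 6; 7])]); ([:: 0; 3; 6; 10; 11; 16; 17; 20], [::], 49, [:: ([::], 3, [:: 3; 4; 1;
5; 7]); ([:: [:: 83]], 24, [:: 0; 3; 6; 1; 0; 4]); ([:: [:: 35; 68]], 7, [:: 0; 3; 6; 4]); ([:: [:: 110]], 14, [:: 1;
1; 1; 0; 4]); ([::], 0, [:: 0; 1; 2; 1]); ([::], 8, [:: 7; 4; 2; 3]); ([::], 19, [:: 0; 2; 3; 0; 5]); ([::], 94, [::
0; 2; 3; 0; 5])]); ([:: 0; 5; 6; 8; 10; 14; 16; 17], [::], 39, [:: ([:: [:: 67]], 9, [:: 1; 2; 2; 1; 3; 2]); ([::],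
44, [:: 1; 3; 2; 1; 3; 3]); ([::], 7, [:: 6; 4; 3; 0]); ([:: [:: 101]], 11, [:: 5; 2; 6; 2; 1]); ([:: [:: 87; 28;
101]; [:: 54; 83]], 2, [:: 0; 3; 5; 6; 7; 6]); ([:: [:: 101; 35]], 1, [:: 5; 0; 1; 2; 7]); ([::], 26, [:: 4; 2; 0; 4;
3]); ([::], 79, [:: 0; 7; 2; 5; 1])]); ([:: 0; 1; 5; 7; 8; 10; 16; 17], [::], 141, [:: ([:: [:: 64]], 6, [:: 6; 0; 7;
7; 7]); ([::], 7, [:: 6; 3; 3; 1; 1]); ([::], 7, [:: 0; 3; 0; 2; 7; 5]); ([:: [:: 117]], 24, [:: 0; 0; 0; 1; 5; 1]);
([:: [:: 113]; [:: 87; 19; 42; 60]], 24, [:: 0; 2; 4; 3; 0]); ([::], 44, [:: 3; 6; 6; 2]); ([::], 28, [:: 2; 0; 0; 3;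
0]); ([::], 28, [:: 1; 6; 1; 6; 3]); ([:: [:: 34; 82; 66; 9]], 1, [:: 0; 0; 0; 1; 6; 3]); ([::], 53, [:: 1; 4; 6; 0;
0]); ([:: [:: 96; 29]], 1, [:: 3; 0; 3; 5]); ([::], 95, [:: 0; 3; 1; 0; 7; 3])]); ([:: 0; 4; 5; 7; 11; 16; 17; 18],
[::], 15, [:: ([::], 29, [:: 1; 0; 3; 3; 0]); ([::], 32, [:: 0; 0; 1; 1; 6; 6]); ([::], 11, [:: 1; 3; 0; 5; 7]);
([::], 42, [:: 0; 5; 1]); ([::], 2, [:: 0; 7; 1; 3; 5; 5]); ([::], 35, [:: 6; 1; 6; 7; 2]); ([::], 18, [:: 0; 7; 3; 7;
2; 4]); ([::], 90, [:: 7; 1; 0; 6; 7])]); ([:: 2; 9; 11; 15; 16; 17; 18; 20], [::], 43, [:: ([::], 2, [:: 0; 0; 2; 1;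
1; 0]); ([::], 41, [:: 6; 6; 2; 3; 2]); ([::], 94, [::]); ([::], 96, [:: 1; 2; 2; 5; 7]); ([::], 24, [:: 0; 4; 6; 0;
6; 0]); ([::], 47, [:: 2; 0; 2; 4]); ([::], 97, [:: 3; 6; 2; 1; 6]); ([::], 41, [:: 0; 7; 2; 0; 4])]); ([:: 4; 5; 7;
11; 12; 16; 17; 18], [::], 9, [:: ([::], 11, [:: 4; 4; 3]); ([:: [:: 114]], 14, [:: 4; 7; 2]); ([:: [:: 82]], 47, [::
5; 0; 4]); ([::], 98, [:: 1; 2; 2; 5; 7]); ([:: [:: 35; 116; 45; 86; 82]], 38, [:: 0; 2; 3; 7; 7]); ([::], 32, [:: 6;
1; 6; 7; 2]); ([::], 99, [:: 0; 6; 0; 0; 1]); ([::], 53, [:: 0; 4; 1; 6; 4; 0])]); ([:: 0; 4; 7; 11; 12; 16; 17; 18],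
[::], 3, [:: ([:: [:: 34; 106; 44; 72; 86]], 34, [:: 1; 0; 2; 4; 7]); ([:: [:: 35; 111; 53; 73; 86]], 34, [:: 2; 6; 7;
1; 1]); ([::], 95, [::]); ([::], 95, [:: 1; 2; 2; 5; 7]); ([:: [:: 48; 85; 29; 110]], 1, [:: 1; 1; 5; 5; 0]); ([::],
93, [:: 5; 6; 4; 3; 7]); ([::], 62, [:: 1; 5; 6; 7; 5]); ([:: [:: 83; 38; 7; 92; 118]], 62, [:: 1; 5; 6; 7; 5])]);
([:: 0; 6; 7; 8; 10; 14; 16; 17], [::], 10, [:: ([:: [:: 102]], 39, [:: 5; 7; 6; 5; 2]); ([::], 100, [::]); ([::], 36,
[:: 0; 7; 5; 6; 6; 7]); ([:: [:: 83]], 11, [:: 4; 0; 7; 1; 5]); ([:: [:: 34; 80; 46; 110]; [:: 89]], 2, [:: 0; 0; 6;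
3; 3; 4]); ([::], 56, [:: 1; 3; 1; 5; 1; 6]); ([::], 43, [:: 0; 3; 5; 6; 5]); ([::], 98, [:: 3; 1; 1; 5])]); ([:: 1;
4; 5; 11; 16; 17; 18; 20], [::], 13, [:: ([::], 3, [:: 1; 3; 2; 3; 4]); ([::], 32, [:: 3; 3; 0; 4]); ([::], 38, [:: 1;
2; 1; 7; 1; 6]); ([::], 47, [:: 1; 3; 1; 7; 0]); ([::], 3, [:: 2; 1; 6; 5; 6]); ([::], 24, [:: 1; 3; 1; 7; 0]); ([::
[:: 63; 39; 29]; [:: 82]], 7, [:: 4; 0; 0; 4; 5]); ([::], 83, [:: 3; 1; 3; 5; 5])]); ([:: 2; 5; 6; 8; 10; 14; 16; 17],
[::], 141, [:: ([::], 1, [:: 5; 7; 6; 4]); ([:: [:: 79]], 24, [:: 2; 1; 7; 1; 6]); ([:: [:: 81]], 24, [:: 0; 4; 1; 6;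
4; 0]); ([:: [:: 91]], 23, [:: 0; 2; 3; 4; 5; 0]); ([:: [:: 87]], 23, [:: 4; 6; 4; 4; 7]); ([:: [:: 97]], 11, [:: 2;
7; 1; 5; 5]); ([::], 65, [:: 0; 3; 6; 1; 2]); ([:: [:: 94; 33; 34; 111; 25; 23; 118]], 65, [:: 0; 3; 6; 1; 2]); ([::],
12, [:: 1; 3; 3; 5; 2]); ([:: [:: 95; 32; 114; 55]], 1, [:: 4; 2; 0; 1; 3]); ([::], 12, [:: 4; 4; 4; 6; 5]); ([:: [::
26; 97; 89; 41]], 1, [:: 6; 3; 0; 4; 1])]); ([:: 1; 4; 9; 11; 16; 17; 18; 20], [::], 43, [:: ([::], 2, [:: 3; 2; 1; 4;
6]); ([::], 86, [::]); ([::], 43, [:: 7; 3; 4; 5; 4]); ([:: [:: 106]], 50, [:: 1; 4; 2; 3; 2]); ([:: [:: 28; 102; 18;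
33; 100]], 48, [:: 0; 6; 5; 6; 2]); ([::], 2, [:: 1; 3; 1; 3; 7; 6]); ([::], 51, [:: 3; 1; 1; 7; 0]); ([::], 84, [::
2; 3; 4; 4; 6])]); ([:: 0; 1; 4; 7; 11; 16; 17; 18], [::], 43, [:: ([::], 0, [:: 0; 1; 5; 2; 3]); ([::], 29, [:: 1; 0;
3; 3; 0]); ([:: [:: 80]], 23, [:: 1; 3; 5; 4; 1; 5]); ([:: [:: 106]], 17, [:: 0; 4; 2; 0; 4; 2]); ([:: [:: 33; 106;
104; 25]], 1, [:: 3; 6; 3; 6; 5]); ([::], 2, [:: 5; 6; 7; 4; 3]); ([::], 6, [:: 6; 2; 2; 7; 3]); ([::], 97, [:: 0; 4;
5; 6; 7])]); ([:: 4; 7; 9; 12; 16; 17; 18], [::], 17, [:: ([:: [:: 118]], 24, [:: 3; 2; 6; 7; 6]); ([::], 23, [:: 0;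
3; 5; 5]); ([::], 102, [:: 0; 1; 1; 2; 2]); ([::], 63, [:: 2; 1; 1; 2; 1; 2]); ([::], 103, [:: 0; 7; 6; 5; 4]); ([::],
51, [:: 3; 7; 1; 6]); ([::], 3, [:: 2; 2; 0; 2]); ([::], 104, [:: 0; 1; 4; 1; 3])]); ([:: 0; 7; 9; 12; 16; 17; 18],
[::], 17, [:: ([:: [:: 118]], 24, [:: 0; 3; 6; 1; 0; 7]); ([::], 2, [:: 0; 6; 1; 7; 2; 0]); ([::], 47, [:: 0; 5; 2; 1;
0; 2]); ([::], 106, [:: 6; 6; 4]); ([::], 14, [:: 6; 4; 6; 1]); ([::], 107, [:: 1; 4; 7; 3; 3]); ([::], 2, [:: 5; 7;
6; 4; 7]); ([::], 105, [:: 1; 6; 3; 4; 2])]); ([:: 1; 4; 6; 10; 16; 17; 20], [::], 37, [:: ([::], 48, [:: 1; 6; 4; 5;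
5]); ([::], 108, [::]); ([:: [:: 79]], 24, [:: 3; 2; 4; 2; 7]); ([::], 63, [:: 4; 2; 4; 5; 6]); ([::], 51, [:: 0; 0;
0; 5; 0; 1]); ([::], 3, [:: 2; 4; 3; 0; 5]); ([::], 109, [:: 2; 0; 6; 1]); ([::], 104, [:: 0; 6; 3; 2; 4; 7])]); ([::
0; 1; 6; 10; 16; 17; 20], [::], 37, [:: ([::], 110, [::]); ([::], 3, [:: 2; 3; 6; 1; 0]); ([:: [:: 35; 68; 45; 79;
98]], 32, [:: 0; 6; 3; 3; 0; 3]); ([::], 111, [:: 0; 7; 6; 5; 4]); ([:: [:: 117; 58; 98; 34]], 1, [:: 7; 4; 5; 2; 5]);
([::], 55, [:: 5; 4; 6; 3; 7]); ([::], 46, [:: 3; 0; 1; 6]); ([::], 112, [:: 0; 6; 3; 2; 4; 7])]); ([:: 5; 7; 11; 12;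
16; 17; 18], [::], 9, [:: ([::], 106, [::]); ([::], 47, [:: 4; 1; 7; 4; 6]); ([::], 63, [:: 7; 0; 7; 2; 1]); ([::],
113, [:: 1; 4; 6; 1; 1]); ([:: [:: 35; 116; 45; 86; 82]], 48, [:: 5; 7; 7; 2; 1]); ([::], 112, [:: 2; 3; 7; 3; 4]);
([::], 114, [:: 2; 3; 7; 3; 4]); ([::], 61, [:: 0; 6; 6; 4; 6])]); ([:: 1; 7; 11; 12; 16; 17; 18], [::], 7, [:: ([::],
115, [::]); ([::], 33, [:: 7; 3; 4; 6]); ([::], 48, [:: 4; 4; 2; 4]); ([::], 47, [:: 5; 4; 5; 5; 6]); ([:: [:: 28;
102; 32; 47; 72]], 48, [:: 1; 4; 0; 4; 1]); ([::], 112, [:: 2; 0; 1; 1; 6]); ([::], 3, [:: 2; 6; 2; 5; 0]); ([::], 62,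
[:: 1; 7; 1; 1; 2; 3])]); ([:: 4; 7; 11; 15; 16; 17; 18], [::], 203, [:: ([::], 117, [::]); ([:: [:: 93; 34; 33; 112;
23; 119; 26]], 78, [:: 1; 6; 0]); ([::], 63, [:: 1; 7; 7; 3; 0]); ([::], 116, [:: 0; 2; 1; 0; 1; 3]); ([::], 63, [::
2; 6; 4; 5; 2]); ([::], 116, [:: 0; 1; 1; 2; 2]); ([::], 78, [:: 1; 6; 0]); ([::], 118, [:: 3; 3; 0; 4; 2]); ([::],
118, [:: 4; 2; 4; 3]); ([::], 64, [:: 3; 3; 3; 1; 3; 0]); ([::], 114, [:: 0; 2; 2; 5; 3]); ([::], 114, [:: 0; 4; 0; 1;
3])]); ([:: 0; 1; 7; 8; 16; 17; 18], [::], 17, [:: ([::], 13, [:: 0; 2; 6; 1; 4]); ([::], 0, [:: 0; 1; 5; 2; 3]); ([::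
[:: 102]], 24, [:: 2; 2; 1; 5; 0]); ([::], 115, [:: 5; 3; 1; 7; 3]); ([::], 6, [:: 0; 7; 7; 3]); ([::], 34, [:: 0; 6;
7; 2; 4]); ([:: [:: 32; 107; 28; 42; 72]], 62, [:: 0; 2; 6; 1; 4]); ([::], 3, [:: 0; 0; 2; 5; 6])]); ([:: 2; 5; 7; 8;
16; 17; 18], [::], 16, [:: ([::], 35, [:: 3; 1; 4; 6; 2]); ([::], 1, [:: 5; 7; 6; 4]); ([:: [:: 109]], 24, [:: 5; 6;
7; 7]); ([::], 47, [:: 2; 0; 4; 7; 4]); ([::], 12, [:: 4; 7; 3; 3]); ([::], 2, [:: 2; 7; 1; 0; 6]); ([::], 119, [:: 1;
4; 6; 1; 1]); ([::], 3, [:: 0; 1; 6; 1; 2])]); ([:: 0; 1; 3; 10; 16; 17; 20], [::], 37, [:: ([::], 3, [:: 3; 4; 1; 5;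
7]); ([::], 3, [:: 0; 6; 1; 0; 3; 2]); ([::], 12, [:: 5; 4; 2; 3; 1]); ([::], 120, [:: 0; 7; 6; 5; 4]); ([::], 0, [::
0; 1; 5; 2; 3]); ([::], 55, [:: 5; 5; 5]); ([::], 52, [:: 3; 3; 2; 0; 2]); ([::], 52, [:: 5; 3; 1; 7])]); ([:: 5; 6;
8; 10; 14; 16; 17], [::], 12, [:: ([::], 121, [::]); ([::], 121, [:: 0; 1; 4; 1; 3]); ([::], 50, [:: 1; 3; 7; 0]);
([::], 50, [:: 2; 2; 1; 0; 7]); ([::], 48, [:: 0; 3; 7; 1]); ([::], 106, [:: 0; 6; 7]); ([::], 48, [:: 0; 6; 7; 3; 3;
2]); ([::], 106, [:: 4; 0; 7; 2; 6])]); ([:: 1; 2; 6; 10; 16; 17; 20], [::], 2, [:: ([::], 110, [::]); ([::], 3, [::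
0; 2; 5; 0; 4]); ([::], 48, [:: 1; 6; 4; 5; 5]); ([::], 108, [:: 0; 7; 6; 5; 4]); ([::], 107, [:: 4; 0; 2; 7; 3]);
([::], 51, [:: 0; 1; 5; 4; 6; 3]); ([::], 103, [:: 4; 0; 2; 7; 3]); ([::], 14, [:: 6; 1; 5; 2])]); ([:: 0; 4; 5; 6;
10; 16; 17], [::], 30, [:: ([:: [:: 79]], 47, [:: 5; 7; 3; 7; 0]); ([:: [:: 81]], 24, [:: 0; 0; 6; 5; 6]); ([::], 122,
[:: 0; 1; 5; 0; 3; 6]); ([::], 11, [:: 7; 4; 4; 6; 0]); ([::], 53, [:: 3; 0; 6; 7]); ([::], 123, [:: 0; 6; 5; 6; 2]);
([::], 35, [:: 1; 2; 7; 5; 3]); ([::], 32, [:: 4; 5; 7; 0; 1])]); ([:: 1; 6; 8; 10; 16; 17; 20], [::], 14, [:: ([::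
[:: 35; 68; 45; 79; 98]], 32, [:: 0; 6; 3; 3; 0; 3]); ([:: [:: 108; 33; 102; 23; 70]], 53, [:: 0; 3; 0; 4; 1; 0]);
([::], 1, [:: 0; 0; 6; 6; 6; 1]); ([::], 47, [:: 2; 6; 1; 0; 6]); ([::], 15, [:: 3; 5; 6; 4; 5]); ([::], 103, [:: 1;
4; 0; 7]); ([::], 2, [:: 3; 2; 6; 0]); ([::], 3, [:: 1; 3; 5; 7; 6])]); ([:: 4; 7; 11; 12; 16; 17; 18], [::], 75, [::
([::], 126, [::]); ([::], 48, [:: 2; 6; 7; 1; 1]); ([:: [:: 35; 105; 22; 116]], 30, [:: 0; 6; 2; 6; 7]); ([::], 125,
[:: 1; 2; 2; 5; 7]); ([::], 30, [:: 6; 2; 2; 1; 6]); ([::], 63, [:: 2; 6; 4; 5; 2]); ([::], 119, [:: 1; 4; 7; 3; 3]);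
([::], 119, [:: 3; 7; 2; 1]); ([::], 3, [:: 7; 6; 2; 0; 3]); ([::], 104, [:: 1; 6; 3; 4; 2]); ([::], 124, [:: 4; 2; 5;
2]); ([:: [:: 38; 92; 7; 118; 83]], 62, [:: 1; 5; 6; 7; 5])]); ([:: 6; 7; 8; 10; 14; 16; 17], [::], 0, [:: ([::], 127,
[::]); ([:: [:: 102]], 47, [:: 2; 6; 0; 7; 4]); ([:: [:: 79]], 47, [:: 5; 5; 5; 3; 5]); ([::], 127, [:: 0; 3; 3; 5]);
([::], 48, [:: 4; 6; 3; 3; 1]); ([::], 48, [:: 5; 6; 0; 1; 2]); ([::], 125, [:: 2; 3; 7; 0; 2; 6]); ([::], 125, [:: 0;
3; 3; 3; 6; 7])]); ([:: 0; 2; 5; 7; 9; 10; 16], [::], 55, [:: ([:: [:: 69]], 11, [:: 5; 2; 2; 2; 2]); ([:: [:: 81]],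
11, [:: 0; 3; 7; 7; 5]); ([::], 57, [:: 0; 0; 4; 5; 4]); ([::], 36, [:: 6; 3; 4; 6; 2]); ([:: [:: 107; 46; 69]; [::
61; 23]], 2, [:: 1; 0; 5; 7; 3]); ([:: [:: 88; 16; 69]; [:: 65; 38]], 2, [:: 0; 1; 6; 1; 2]); ([::], 56, [:: 6; 1; 2;
2; 5]); ([::], 127, [:: 5; 7; 1; 2; 3])]); ([:: 0; 1; 6; 9; 16; 17; 20], [::], 37, [:: ([::], 37, [:: 3; 5; 7; 3]);
([::], 1, [:: 0; 6; 0; 6]); ([::], 16, [:: 2; 0; 7]); ([::], 47, [:: 1; 0; 7; 0; 5; 6]); ([::], 2, [:: 0; 0; 3; 1;
1]); ([:: [:: 98; 35]; [:: 115; 13; 69]], 7, [:: 4; 6; 1; 3]); ([::], 3, [:: 5; 4; 4; 1; 3]); ([::], 103, [:: 6; 0; 7;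
6; 7])]); ([:: 0; 4; 7; 8; 10; 16; 17], [::], 16, [:: ([::], 11, [:: 0; 1; 6; 3; 3; 3]); ([:: [:: 62]], 17, [:: 1; 3;
5; 7; 3; 2]); ([::], 50, [:: 6; 6; 1; 6]); ([::], 121, [:: 0; 0; 3; 2; 2; 2]); ([::], 38, [:: 6; 0; 5; 5]); ([:: [::
34; 80; 100; 6; 113]], 51, [:: 6; 7; 1; 2; 1]); ([::], 38, [:: 1; 0; 6; 7; 3]); ([::], 106, [:: 2; 3; 7; 6; 4])]);
([:: 0; 7; 8; 9; 16; 17; 18], [::], 15, [:: ([::], 39, [:: 0; 1; 0; 3; 3; 3]); ([::], 32, [:: 3; 5; 1; 5; 6]); ([::],
48, [:: 1; 7; 6; 0; 6]); ([::], 47, [:: 2; 1; 6; 7; 0]); ([::], 18, [:: 0; 4; 6; 3; 1; 5]); ([::], 112, [:: 0; 0; 7;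
5; 2; 5]); ([::], 3, [:: 0; 2; 5; 2; 1]); ([::], 52, [:: 0; 7; 1; 4; 1])]); ([:: 1; 5; 6; 8; 16; 17; 18], [::], 17,
[:: ([:: [:: 63]], 19, [:: 0; 7; 7; 7; 0]); ([::], 1, [:: 0; 6; 5; 1; 2]); ([:: [:: 34; 106; 18; 87; 96]], 51, [:: 3;
4; 0; 5; 0]); ([::], 47, [:: 5; 0; 7; 2]); ([::], 12, [:: 5; 1; 2; 4]); ([::], 3, [:: 0; 6; 3; 4; 7; 1]); ([::], 109,
[:: 1; 4; 6; 1; 1]); ([::], 2, [:: 2; 7; 2; 2])]); ([:: 0; 1; 4; 6; 16; 17; 20], [::], 54, [:: ([:: [:: 61]], 23, [::
0; 2; 6; 7; 2; 6]); ([::], 3, [:: 2; 3; 6; 1; 0]); ([::], 108, [:: 3; 3; 5; 4; 3]); ([:: [:: 33; 85; 72]], 12, [:: 0;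
5; 7; 1; 4; 6]); ([::], 2, [:: 0; 0; 3; 1; 1]); ([::], 3, [:: 2; 4; 3; 0; 5]); ([::], 128, [:: 0; 1; 0; 7; 1; 5]);
([::], 51, [:: 0; 7; 1; 0; 2])]); ([:: 0; 3; 4; 6; 10; 16; 17], [::], 37, [:: ([::], 1, [:: 5; 6; 6; 4; 2]); ([::],
53, [:: 0; 3; 6; 1]); ([:: [:: 79]], 23, [:: 5; 2; 4; 7; 1]); ([::], 129, [:: 0; 4; 3; 5; 5]); ([:: [:: 34; 112; 110;
24]], 1, [:: 0; 0; 5; 7; 6; 2]); ([::], 110, [:: 3; 1; 7; 3; 2; 3]); ([::], 12, [:: 1; 6; 6; 3]); ([:: [:: 35; 105;
38; 68; 19]], 65, [:: 2; 4])]); ([:: 1; 5; 7; 8; 16; 17; 18], [::], 17, [:: ([::], 35, [:: 3; 1; 4; 6; 2]); ([::], 2,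
[:: 3; 5; 2]); ([:: [:: 102]], 50, [:: 4; 1; 5]); ([::], 106, [:: 5; 3; 1; 7; 3]); ([::], 51, [:: 2; 1; 4; 2]); ([::
[:: 35; 75; 54; 28; 117]], 48, [:: 0; 6; 7; 2; 4]); ([::], 130, [:: 1; 0; 7; 7; 4]); ([::], 2, [:: 2; 7; 2; 2])]);
([:: 0; 1; 4; 7; 16; 17; 18], [::], 17, [:: ([::], 13, [:: 2; 1; 7; 5; 2]); ([::], 0, [:: 0; 1; 5; 2; 3]); ([::], 35,
[:: 4; 2; 5]); ([::], 131, [:: 5; 3; 1; 7; 3]); ([::], 54, [:: 0; 3; 6; 2; 6]); ([::], 2, [:: 5; 6; 7; 4; 3]); ([::],
12, [:: 2; 1; 0; 1; 2]); ([::], 51, [:: 0; 1; 5; 6; 6; 6])]); ([:: 0; 4; 7; 11; 16; 17; 18], [::], 48, [:: ([::], 3,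
[:: 0; 1; 6; 6; 5; 5]); ([::], 123, [:: 1; 2; 2; 5; 7]); ([::], 63, [:: 2; 5; 1; 5; 5]); ([::], 106, [:: 2; 0; 2; 4]);
([:: [:: 31; 107; 24; 113]], 30, [:: 2; 5; 1; 5; 5]); ([::], 128, [:: 4; 2; 4; 3]); ([::], 23, [:: 5; 0; 1; 2; 4]);
([::], 104, [:: 4; 2; 5; 6; 4])]); ([:: 7; 9; 12; 16; 17; 18], [::], 0, [:: ([::], 133, [::]); ([::], 133, [:: 0; 1;
1; 2; 2]); ([::], 132, [::]); ([::], 132, [:: 0; 1; 1; 2; 2]); ([::], 134, [:: 2; 2; 5; 6; 0]); ([::], 135, [:: 0; 0;
1; 3; 2]); ([::], 134, [:: 0; 0; 1; 3; 2]); ([::], 135, [:: 2; 2; 5; 6; 0])]); ([:: 7; 11; 12; 16; 17; 18], [::], 78,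
[:: ([::], 137, [::]); ([::], 137, [:: 0; 2; 1; 0; 1; 3]); ([:: [:: 35; 112; 20; 28; 103]], 78, [:: 0; 5; 7; 2; 7;
4]); ([::], 136, [:: 1; 2; 2; 5; 7]); ([::], 136, [:: 1; 4; 6; 1; 1]); ([::], 138, [:: 0; 2; 0; 1; 1]); ([::], 137,
[:: 5; 6; 2; 0; 2]); ([::], 136, [:: 1; 5; 0; 1; 1]); ([::], 137, [:: 1; 5; 0; 1; 1]); ([::], 136, [:: 5; 6; 2; 0;
2]); ([::], 138, [:: 6; 0; 3; 5; 5]); ([:: [:: 38; 92; 7; 118; 83]], 78, [:: 2; 5; 4; 7; 5])]); ([:: 1; 7; 8; 16; 17;
18], [::], 1, [:: ([::], 139, [::]); ([::], 46, [:: 2; 4; 7; 0; 2]); ([::], 61, [:: 0; 1; 7; 5; 7; 2]); ([::], 140,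
[:: 1; 2; 2; 5; 7]); ([::], 3, [:: 0; 0; 2; 5; 6]); ([::], 141, [:: 0; 0; 4; 1; 0]); ([::], 61, [:: 2; 1; 7; 1; 6]);
([::], 135, [:: 5; 4; 4; 3; 6])]); ([:: 0; 2; 6; 10; 16; 17], [::], 18, [:: ([::], 47, [:: 1; 6; 1; 3; 0]); ([::], 48,
[:: 0; 0; 2; 2; 6; 1]); ([::], 47, [:: 4; 5; 7; 7; 7]); ([::], 48, [:: 1; 3; 3; 6; 3]); ([::], 62, [:: 3; 0; 6; 7]);
([::], 3, [:: 0; 0; 2; 4; 6]); ([::], 23, [:: 0; 5; 7; 2; 6; 0]); ([::], 137, [:: 4; 6; 1; 6; 6])]); ([:: 4; 6; 10;
14; 16; 17], [::], 30, [:: ([::], 63, [:: 0; 5; 1; 4; 5; 4]); ([::], 142, [:: 2; 0; 2; 4]); ([::], 63, [:: 0; 3; 1; 4;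
0]); ([::], 142, [:: 0; 1; 1; 2; 2]); ([::], 78, [:: 1; 1; 5; 2; 2]); ([::], 138, [:: 0; 6; 5; 6; 2]); ([::], 64, [::
0; 0; 5; 7; 3; 2]); ([::], 137, [:: 2; 3; 0; 4; 4])]); ([:: 0; 4; 6; 10; 16; 17], [::], 37, [:: ([::], 47, [:: 1; 6;
1; 3; 0]); ([::], 144, [::]); ([::], 63, [:: 0; 7; 6; 2; 1]); ([::], 142, [:: 0; 4; 3; 5; 5]); ([::], 61, [:: 5; 0; 5;
0; 7]); ([::], 143, [:: 3; 1; 7; 3; 2; 3]); ([:: [:: 29; 62; 43; 79; 101]], 48, [:: 0; 0; 2; 7; 4]); ([::], 136, [::
3; 2; 4; 2; 5])]); ([:: 1; 4; 6; 10; 16; 17], [::], 37, [:: ([::], 48, [:: 1; 6; 4; 5; 5]); ([::], 144, [:: 2; 0; 2;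
4]); ([::], 30, [:: 0; 2; 6; 1; 7]); ([::], 63, [:: 4; 2; 4; 5; 6]); ([:: [:: 34; 100; 115; 24; 81]], 62, [:: 1; 4; 6;
5; 1]); ([::], 3, [:: 2; 4; 3; 0; 5]); ([::], 145, [:: 1; 4; 6; 1; 1]); ([::], 146, [:: 3; 4; 3; 5])]); ([:: 0; 5; 7;
9; 10; 16], [::], 55, [:: ([::], 31, [:: 0; 6; 6; 2; 7; 6]); ([::], 66, [:: 3; 1; 6]); ([::], 66, [:: 0; 0; 1; 7]);
([::], 148, [:: 0; 4; 1; 5; 7]); ([::], 65, [:: 0; 5; 2; 3]); ([::], 65, [:: 0; 5; 4; 7; 6]); ([::], 65, [:: 0; 2; 6;
4; 5; 6]); ([::], 147, [:: 1; 7; 4; 7; 6])]); ([:: 0; 1; 5; 6; 9; 16], [::], 123, [:: ([:: [:: 63]], 47, [:: 3; 0; 6;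
7; 4]); ([::], 50, [:: 5; 7; 4; 7]); ([:: [:: 66]], 47, [:: 1; 2; 5; 1; 5]); ([::], 66, [:: 1; 1; 0; 5; 4]); ([::],
31, [:: 2; 0; 3; 3; 0]); ([::], 66, [:: 1; 0; 6; 0; 3]); ([::], 65, [:: 1; 1; 2; 2; 4]); ([::], 48, [:: 0; 7; 5; 1;
5]); ([::], 65, [:: 5; 3; 6; 7; 3]); ([::], 49, [:: 0; 7; 7]); ([::], 48, [:: 6; 4; 4; 1; 2]); ([::], 147, [:: 0; 0;
5; 5; 2; 4])]); ([:: 0; 4; 6; 8; 16; 17], [::], 11, [:: ([:: [:: 61]], 24, [:: 3; 2; 2; 7]); ([:: [:: 35; 112; 28; 80;
103]], 51, [:: 2; 7; 4; 7; 5]); ([::], 63, [:: 0; 7; 6; 2; 1]); ([::], 150, [:: 0; 6; 5; 6; 2]); ([::], 51, [:: 1; 6;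
3; 5; 6]); ([::], 149, [:: 1; 6; 3; 4; 5; 4]); ([::], 3, [:: 0; 2; 1; 5; 5; 1]); ([::], 134, [:: 4; 5; 2; 0; 2])]);
([:: 2; 5; 8; 16; 17; 18], [::], 12, [:: ([::], 52, [:: 6; 3; 2; 5]); ([::], 52, [:: 0; 1; 4; 5; 4]); ([::], 62, [::
0; 6; 2; 5; 7]); ([::], 62, [:: 1; 6; 6; 5; 6]); ([::], 3, [:: 0; 0; 1; 6; 0; 6]); ([::], 141, [:: 4; 7; 3; 2]);
([::], 3, [:: 0; 1; 6; 1; 2]); ([::], 141, [:: 0; 1; 7; 7; 4; 2])]); ([:: 0; 1; 2; 6; 9; 16], [::], 56, [:: ([::], 65,
[:: 0; 1; 4; 6; 1; 6]); ([:: [:: 63]], 47, [:: 3; 0; 6; 7; 4]); ([:: [:: 69]], 47, [:: 6; 7; 4; 2; 0]); ([::], 11, [::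
1; 1; 3; 2; 5]); ([::], 3, [:: 1; 1; 2; 2; 5]); ([:: [:: 35; 115; 13; 69; 98]], 51, [:: 6; 0; 6; 1; 7]); ([:: [:: 28;
118; 12; 98; 63]], 51, [:: 0; 5; 5; 7; 6]); ([::], 150, [:: 5; 3; 6; 6])]); ([:: 0; 2; 6; 8; 16; 17], [::], 52, [::
([::], 1, [:: 0; 5; 0; 7; 1]); ([:: [:: 61]], 24, [:: 3; 2; 2; 7]); ([::], 47, [:: 4; 5; 7; 7; 7]); ([:: [:: 35; 111;
26; 73; 113]], 51, [:: 4; 6; 4; 6; 5]); ([::], 3, [:: 0; 0; 2; 4; 6]); ([::], 12, [:: 0; 3; 3; 7; 7; 6]); ([::], 2,
[:: 7; 0; 5; 5; 4]); ([::], 145, [:: 4; 5; 2; 0; 2])]); ([:: 0; 4; 5; 16; 17; 18], [::], 17, [:: ([::], 54, [:: 4; 0;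
7; 4; 4]); ([::], 2, [:: 1; 3; 1; 1; 2; 1]); ([::], 152, [:: 7; 2; 1; 2]); ([::], 151, [:: 0; 6; 0; 0; 1]); ([::], 3,
[:: 1; 3; 2; 3; 4]); ([::], 153, [:: 5; 2; 0; 2; 6]); ([:: [:: 29; 61; 37; 107; 20]], 53, [:: 2; 6; 6]); ([::], 149,
[:: 5; 2; 0; 2; 6])]); ([:: 2; 4; 6; 10; 16; 17], [::], 12, [:: ([::], 47, [:: 1; 6; 1; 3; 0]); ([::], 48, [:: 1; 6;
4; 5; 5]); ([::], 61, [:: 0; 7; 5; 7; 6; 4]); ([::], 154, [:: 2; 0; 1; 1; 2]); ([::], 2, [:: 4; 6; 4; 6; 3]); ([::],
139, [:: 0; 4; 3; 1; 1]); ([:: [:: 29; 75; 40; 53; 61]], 65, [:: 0; 6; 2; 2; 6]); ([::], 133, [:: 4; 0; 5; 6; 1])]);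
([:: 0; 1; 4; 16; 17; 18], [::], 17, [:: ([::], 13, [:: 2; 1; 7; 5; 2]); ([::], 0, [:: 0; 1; 5; 2; 3]); ([::], 52, [::
2; 3; 2; 1; 5]); ([::], 139, [:: 0; 6; 0; 0; 1]); ([:: [:: 35; 73; 51; 26; 113]], 62, [:: 0; 3; 6; 2; 6]); ([::], 3,
[:: 2; 1; 6; 5; 6]); ([::], 12, [:: 2; 1; 0; 1; 2]); ([::], 51, [:: 0; 1; 5; 6; 6; 6])]); ([:: 0; 4; 7; 16; 17; 18],
[::], 17, [:: ([::], 156, [:: 2; 0; 7; 1]); ([::], 3, [:: 0; 1; 6; 6; 5; 5]); ([::], 155, [:: 7; 2; 1; 2]); ([::],
157, [:: 2; 0; 7; 1]); ([::], 64, [:: 2; 1; 7; 5; 2]); ([::], 153, [:: 0; 3; 4; 7; 3]); ([::], 62, [:: 0; 0; 1; 6; 7;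
4]); ([::], 134, [:: 0; 3; 4; 7; 3])]); ([:: 0; 6; 10; 16; 17], [::], 37, [:: ([::], 161, [::]); ([::], 164, [:: 2; 0;
2; 4]); ([::], 163, [:: 1; 4; 6; 1; 1]); ([::], 162, [:: 3; 6; 2; 6; 4]); ([:: [:: 32; 101; 24; 79; 110]], 78, [:: 0;
2; 4; 3; 7]); ([::], 158, [:: 5; 4; 0; 7; 2]); ([::], 160, [:: 0; 2; 4; 1; 5]); ([::], 159, [:: 4; 6; 1; 6; 2])]);
([:: 4; 6; 10; 16; 17], [::], 12, [:: ([::], 163, [::]); ([::], 164, [::]); ([::], 164, [:: 2; 0; 1; 1; 2]); ([::],
163, [:: 2; 0; 1; 1; 2]); ([::], 160, [:: 4; 2; 4; 3]); ([::], 160, [:: 0; 4; 3; 1; 1]); ([::], 158, [:: 0; 2; 2; 5;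
3]); ([::], 158, [:: 4; 0; 5; 6; 1])]); ([:: 0; 5; 6; 9; 16], [::], 46, [:: ([::], 166, [::]); ([::], 166, [:: 5; 4;
3; 5; 4]); ([::], 165, [:: 1; 4; 7; 3]); ([::], 165, [:: 5; 7; 1; 2]); ([::], 78, [:: 3; 3; 5; 4]); ([::], 78, [:: 0;
0; 0; 4]); ([::], 162, [:: 5; 5; 3; 5]); ([::], 162, [:: 5; 7; 6; 6; 1])]); ([:: 1; 6; 8; 16; 17], [::], 24, [::
([::], 78, [:: 0; 4; 1; 7; 4]); ([::], 167, [:: 5; 4; 3; 5; 4]); ([::], 78, [:: 4; 4; 7; 1]); ([::], 167, [:: 0; 1; 5;
3; 6; 3]); ([::], 168, [:: 0; 0; 2; 6; 6]); ([::], 160, [:: 0; 6; 5; 6; 2]); ([::], 168, [:: 1; 0; 7; 2; 1; 1]);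
([::], 160, [:: 6; 4; 0; 3; 6])]); ([:: 0; 1; 6; 9; 16], [::], 54, [:: ([::], 169, [::]); ([::], 166, [::]); ([::],
166, [:: 0; 0; 2; 7; 3; 7]); ([::], 169, [:: 2; 2; 6; 5; 6]); ([::], 61, [:: 3; 6; 7; 1; 5]); ([::], 61, [:: 0; 4; 1;
2; 4; 3]); ([::], 163, [:: 2; 1; 7; 2; 2; 4]); ([::], 163, [:: 0; 0; 5; 7; 7; 3])]); ([:: 0; 3; 6; 16; 17], [::], 54,
[:: ([::], 3, [:: 3; 4; 1; 5; 7]); ([:: [:: 116; 23; 25; 62; 107]], 78, [:: 1; 4; 0; 1; 7; 2]); ([::], 172, [:: 0; 3;
1; 0; 7; 3]); ([::], 170, [:: 1; 1; 2; 2; 4]); ([::], 2, [:: 3; 7; 6; 6]); ([::], 171, [:: 1; 4; 0; 1; 7; 2]); ([::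
[:: 35; 112; 25; 50; 74]], 78, [:: 6; 6; 4; 2; 4]); ([::], 168, [:: 3; 4; 6; 3; 2])]); ([:: 0; 4; 8; 16; 17], [::],
11, [:: ([::], 62, [:: 0; 6; 2; 4; 1]); ([::], 62, [:: 0; 1; 6; 3; 3; 3]); ([::], 167, [:: 1; 4; 6; 1; 1]); ([::],
167, [:: 5; 0; 3; 3]); ([::], 173, [:: 4; 0; 0; 7; 5]); ([::], 171, [:: 4; 0; 0; 7; 5]); ([::], 3, [:: 0; 2; 1; 5; 5;
1]); ([::], 174, [:: 4; 0; 0; 7; 5])]); ([:: 0; 4; 6; 16; 17], [::], 30, [:: ([::], 167, [::]); ([::], 167, [:: 3; 6;
1; 1; 7]); ([::], 167, [:: 5; 3; 1; 7; 3]); ([::], 167, [:: 4; 0; 3; 2]); ([::], 171, [:: 2; 0; 7; 1]); ([::], 174,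
[:: 0; 6; 5; 6; 2]); ([::], 174, [:: 3; 7; 7; 4]); ([::], 171, [:: 5; 0; 4; 4; 3])]); ([:: 0; 1; 5; 6; 16], [::], 51,
[:: ([::], 63, [:: 1; 3; 5; 4]); ([::], 63, [:: 4; 4; 0; 0; 7]); ([::], 166, [:: 1; 3; 1; 1; 7]); ([::], 166, [:: 0;
6; 0; 6; 3]); ([::], 64, [:: 3; 7; 6; 6; 2]); ([::], 78, [:: 3; 3; 0; 4]); ([::], 162, [:: 3; 6; 7; 1; 6]); ([::],
161, [:: 4; 5; 2; 0; 2])]); ([:: 0; 2; 6; 16; 17], [::], 30, [:: ([::], 170, [::]); ([::], 61, [:: 0; 3; 3; 2; 6; 4]);
([::], 170, [:: 5; 3; 1; 7; 3]); ([::], 61, [:: 1; 6; 7; 0]); ([::], 173, [:: 0; 3; 6; 1; 2]); ([::], 3, [:: 0; 0; 2;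
4; 6]); ([:: [:: 35; 75; 36; 50; 67]], 78, [:: 6; 0; 2; 6]); ([::], 171, [:: 6; 0; 2; 6])]); ([:: 0; 1; 2; 5; 16],
[::], 25, [:: ([::], 30, [:: 4; 3; 1; 3]); ([::], 63, [:: 1; 3; 5; 4]); ([::], 65, [:: 6; 7; 7; 7]); ([::], 169, [::
0; 6; 0; 0; 1]); ([:: [:: 29; 63; 73; 57; 101]], 62, [:: 7; 6; 6; 1; 1]); ([::], 3, [:: 1; 1; 2; 2; 5]); ([::], 170,
[:: 0; 5; 1; 7; 2]); ([::], 164, [:: 4; 3; 6; 2; 6])]); ([:: 0; 2; 4; 16; 17], [::], 30, [:: ([::], 62, [:: 0; 6; 2;
4; 1]); ([::], 62, [:: 1; 3; 3; 6; 3]); ([::], 62, [:: 1; 6; 3; 4; 2]); ([::], 62, [:: 4; 6; 4; 6; 5]); ([::], 173,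
[:: 2; 0; 7; 1]); ([::], 3, [:: 0; 0; 2; 4; 6]); ([::], 3, [:: 0; 1; 7; 1; 3; 5]); ([::], 173, [:: 5; 0; 4; 4; 3])]);
([:: 0; 1; 2; 5; 8], [::], 167, [:: ([::], 66, [:: 3; 5; 0; 5; 0]); ([::], 66, [:: 1; 0; 4; 1; 5; 0]); ([::], 66, [::
1; 2; 5; 1; 5]); ([::], 66, [:: 0; 2; 1; 6; 5; 4]); ([::], 31, [:: 5; 2; 2; 0]); ([::], 66, [:: 2; 5; 2; 7; 7]);
([::], 65, [:: 6; 0; 2; 6; 3]); ([::], 65, [:: 0; 5; 6; 3; 2; 1]); ([::], 65, [:: 0; 0; 3; 3; 2; 3]); ([::], 65, [::
3; 3; 6; 7; 2]); ([::], 65, [:: 2; 3; 2; 0; 3; 5]); ([::], 165, [:: 6; 2; 7; 3; 4])]); ([:: 6; 10; 16; 17], [::], 12,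
[:: ([::], 175, [::]); ([::], 175, [:: 2; 0; 2; 4]); ([::], 175, [:: 4; 2; 5; 3; 2]); ([::], 175, [:: 1; 2; 3; 2; 6]);
([::], 175, [:: 0; 2; 6; 3; 4]); ([::], 175, [:: 2; 4; 2; 2; 7]); ([::], 175, [:: 7; 4; 6; 0; 6]); ([::], 175, [:: 0;
0; 4; 6])]); ([:: 0; 6; 9; 16], [::], 31, [:: ([::], 179, [:: 1; 5; 5; 4; 1]); ([::], 177, [:: 0; 1; 4; 6; 1; 6]);
([::], 179, [:: 0; 1; 1; 2; 0; 4]); ([::], 177, [:: 0; 6; 5; 6; 4]); ([::], 178, [:: 2; 0; 2; 4]); ([::], 176, [:: 5;
1; 7; 2; 5]); ([::], 178, [:: 1; 4; 7; 3; 3]); ([::], 176, [:: 3; 2; 2; 6; 1])]); ([:: 1; 4; 16; 17], [::], 30, [::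
([::], 101, [:: 7; 1]); ([::], 181, [:: 1; 0; 7; 6; 2; 7]); ([::], 101, [:: 3; 7; 7; 3]); ([::], 181, [:: 1; 1; 4; 4;
2]); ([::], 180, [:: 2; 3; 6; 2]); ([::], 180, [:: 0; 0; 7; 2; 4]); ([::], 180, [:: 2; 2; 1; 5; 2]); ([::], 180, [::
1; 6; 0; 2; 7])]); ([:: 0; 1; 5; 16], [::], 30, [:: ([::], 185, [:: 0; 1; 6; 3; 3]); ([::], 183, [:: 4; 1; 4; 6; 4]);
([::], 185, [:: 0; 6; 0; 6; 3]); ([::], 183, [:: 0; 1; 3; 1; 5; 2]); ([::], 184, [:: 2; 0; 7; 1]); ([::], 184, [:: 1;
7; 2; 1; 7]); ([::], 182, [:: 1; 6; 4; 2]); ([::], 182, [:: 3; 3; 1; 1; 5])]); ([:: 0; 6; 16; 17], [::], 51, [::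
([::], 184, [::]); ([::], 182, [::]); ([::], 176, [:: 4; 0; 3; 2]); ([::], 178, [:: 0; 1; 1; 2; 2]); ([::], 180, [::
0; 1; 7; 4; 4; 6]); ([::], 184, [:: 0; 1; 7; 4; 4; 6]); ([::], 175, [:: 0; 1; 7; 4; 4; 6]); ([::], 176, [:: 3; 7; 3;
5; 4])]); ([:: 0; 1; 4; 16], [::], 30, [:: ([::], 78, [:: 0; 4; 3; 5; 5]); ([::], 185, [:: 4; 1; 4; 6; 4]); ([::], 78,
[:: 6; 1; 3; 2; 3]); ([::], 185, [:: 0; 1; 3; 1; 5; 2]); ([::], 186, [:: 6; 5; 1; 5; 3]); ([::], 186, [:: 2; 6; 7; 3;
2]); ([::], 184, [:: 1; 6; 4; 2]); ([::], 184, [:: 3; 3; 1; 1; 5])]); ([:: 0; 2; 16; 17], [::], 59, [:: ([::], 3, [::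
3; 4; 1; 5; 7]); ([::], 184, [::]); ([:: [:: 35; 99; 20; 67; 104]], 78, [:: 6; 4; 2; 4; 4]); ([::], 186, [:: 1; 3; 3;
7; 2]); ([::], 3, [:: 0; 0; 2; 4; 6]); ([:: [:: 29; 109; 32; 50; 73]], 78, [:: 6; 0; 2; 6]); ([::], 184, [:: 6; 0; 1;
7; 5]); ([::], 186, [:: 0; 7; 4; 5; 3])]); ([:: 0; 1; 2; 16], [::], 59, [:: ([::], 101, [:: 5; 2; 6; 6; 4]); ([::],
185, [:: 2; 0; 7; 1]); ([::], 185, [:: 5; 4; 5; 3]); ([::], 78, [:: 0; 4; 5; 4; 0]); ([::], 3, [:: 1; 1; 2; 2; 5]);
([::], 180, [:: 1; 6; 4; 2]); ([::], 180, [:: 0; 6; 0; 6; 3; 3]); ([::], 181, [:: 3; 6; 2; 1])]); ([:: 0; 1; 2; 4],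
[::], 33, [:: ([::], 187, [:: 4; 0; 3; 5; 2]); ([::], 187, [:: 0; 2; 1; 0; 1; 3]); ([::], 187, [:: 0; 1; 2; 2; 1; 0]);
([::], 187, [:: 2; 6; 7; 3]); ([::], 78, [:: 0; 0; 6; 6; 2; 4]); ([::], 78, [:: 0; 4; 1; 5; 7; 5]); ([::], 183, [:: 0;
1; 4; 2; 1]); ([::], 183, [:: 0; 0; 3; 4; 0])]); ([:: 0; 5; 16], [::], 46, [:: ([::], 191, [::]); ([::], 191, [:: 2;
0; 6; 1]); ([::], 189, [:: 2; 2; 0; 5]); ([::], 189, [:: 1; 0; 6; 3; 2; 5]); ([::], 190, [:: 0; 1; 1; 2; 2]); ([::],
190, [:: 3; 3; 6; 6]); ([::], 188, [:: 2; 3; 5; 7; 2; 5]); ([::], 188, [:: 6; 7; 7; 6; 1])]); ([:: 0; 1; 16], [::],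
30, [:: ([::], 193, [:: 3; 3; 3; 5; 2]); ([::], 191, [:: 1; 4; 7; 3]); ([::], 193, [:: 0; 1; 1; 2; 0; 2]); ([::], 191,
[:: 3; 1; 7; 3; 2]); ([::], 194, [:: 4; 0; 1; 5; 0]); ([::], 194, [:: 6; 2; 5; 4]); ([::], 192, [:: 4; 0; 0; 2; 3]);
([::], 192, [:: 3; 6; 2; 0; 4])]); ([:: 1; 2; 16], [::], 32, [:: ([::], 101, [:: 6; 1; 4; 2]); ([::], 195, [:: 1; 2;
4; 6; 2]); ([::], 101, [:: 1; 2; 3; 6; 3]); ([::], 195, [:: 2; 3; 6; 1; 1; 1]); ([::], 194, [:: 0; 0; 7]); ([::], 194,
[:: 0; 5; 6; 3; 0]); ([::], 194, [:: 6; 6; 5; 6; 7]); ([::], 194, [:: 0; 4; 0; 3; 1])]); ([:: 0; 1; 4], [::], 35, [::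
([::], 196, [:: 3; 3; 4; 2; 2]); ([::], 196, [:: 2; 1; 1; 2; 3]); ([::], 196, [:: 1; 6; 4; 7; 1; 5]); ([::], 196, [::
7; 7; 7; 6; 0]); ([::], 193, [::]); ([::], 191, [:: 5; 5; 5]); ([::], 191, [:: 1; 1; 4; 2; 4]); ([::], 193, [:: 3; 1;
6; 2; 2])]); ([:: 0; 16], [::], 32, [:: ([::], 198, [:: 0; 1; 1; 5; 4]); ([::], 197, [:: 0; 1; 6; 4; 4; 2]); ([::],
198, [:: 3; 6; 2; 1]); ([::], 197, [:: 7; 7; 6; 1; 5]); ([::], 198, [:: 0; 0; 1; 5; 0; 3]); ([::], 198, [:: 0; 6; 6;
2; 1; 3]); ([::], 197, [:: 3; 7; 7; 5; 7]); ([::], 197, [:: 0; 4; 7; 5])]); ([:: 1; 16], [::], 32, [:: ([::], 199, [::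
3; 4; 2; 2]); ([::], 198, [:: 1; 0; 2; 7; 7; 1]); ([::], 199, [:: 4; 6; 7; 5]); ([::], 198, [:: 6; 1; 7; 3; 6]);
([::], 198, [:: 2; 3; 7; 0; 4]); ([::], 199, [:: 0; 2; 7; 6; 7; 4]); ([::], 199, [:: 3; 2; 1; 4]); ([::], 198, [:: 6;
5; 1; 1; 4])]); ([:: 0; 1], [::], 30, [:: ([::], 200, [:: 0; 4; 5; 4; 3]); ([::], 200, [:: 7; 7; 2; 3]); ([::], 200,
[:: 1; 0; 7; 5; 3]); ([::], 200, [:: 2; 2; 0; 6; 1]); ([::], 199, [:: 3; 6; 4; 6; 3]); ([::], 199, [:: 0; 4; 4; 0; 5;
5]); ([::], 197, [:: 2; 4; 3; 1; 1]); ([::], 197, [:: 0; 5; 5; 2; 4])]); ([:: 0], [::], 35, [:: ([::], 203, [:: 4; 5;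
6; 5; 7]); ([::], 203, [:: 0; 0; 3; 4; 3]); ([::], 203, [:: 2; 0; 2; 1; 1]); ([::], 203, [:: 0; 7; 2; 7]); ([::], 201,
[::]); ([::], 202, [:: 1; 5; 7; 3; 0]); ([::], 202, [:: 5; 7; 1; 6; 6]); ([::], 201, [:: 0; 3; 6; 7; 1; 1])]); ([::],
[::], 35, [:: ([::], 204, [:: 0; 6; 4; 6]); ([::], 204, [:: 6; 6; 6; 4; 7]); ([::], 204, [:: 6; 4; 1]); ([::], 204,
[:: 6; 5; 6; 4; 3]); ([::], 204, [:: 2; 4; 2; 2; 6]); ([::], 204, [:: 7; 0; 4; 5; 5]); ([::], 204, [:: 0; 0; 5; 3;
6]); ([::], 204, [:: 1; 5; 2; 4; 3; 4])])]%N.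

(** * Verification of the certificate by computation *)

Definition points (g : seq nat) : seq nat := [seq i <- g | i < 16]%N.
Definition blocks (g : seq nat) : seq nat := [seq i <- g | 16 <= i]%N.

(* [k < 60] codes the tetrad relation "points = blocks", [k + 60] its reverse. *)
Definition relation_lhs (k : nat) : seq nat :=
  if (k < 60)%N then points (nth [::] tetrads k) else blocks (nth [::] tetrads (k - 60)).
Definition relation_rhs (k : nat) : seq nat :=
  if (k < 60)%N then blocks (nth [::] tetrads k) else points (nth [::] tetrads (k - 60)).

(** Adding up the chosen relations gives an equality between the sums over l and over r. If outside
    Z no coordinate occurs more often in r than in l, the difference is a vanishing sum of
    nonnegative terms, and every coordinate with a strict excess is zero. A combination that fails
    the test adds nothing. *)
Definition close (Z : seq nat) (ks : seq nat) : seq nat :=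
  let l := flatten (map relation_lhs ks) in
  let r := flatten (map relation_rhs ks) in
  if all (fun i => (i \in Z) || (count_mem i r <= count_mem i l)%N) (iota 0 32)
  then Z ++ [seq i <- iota 0 32 | (i \notin Z) && (count_mem i r < count_mem i l)%N]
  else Z.

Definition act_word (w : seq nat) (i : nat) : nat :=
  foldr (fun k j => nth 0%N (nth [::] symmetries k) j) i w.

(** For an edge, the vanishing coordinates of the earlier face, moved by the word, must lie among
    those of the facet: the facet is then inside a settled face, and being settled passes to smaller
    faces. The ray has to be nonempty for x to have a smallest coordinate on it. *)
Definition check_node (faces : seq (seq nat)) (nd : node) : bool :=
  let: (Z0, certs, g, edges) := nd in
  let Z := foldl close Z0 certs in
  if edges is [::] then all (mem Z) (iota 0 32) else
  let ray := nth [::] rays g in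
  [&& (g < size rays)%N, ray != [::], size edges == size ray &
   all (fun pe : nat * (seq (seq nat) * nat * seq nat) =>
     let: (p, (certs, n, w)) := pe in
     let Zp := foldl close (p :: Z) certs in
     [&& (n < size faces)%N, all (fun k => k < size symmetries)%N w &
         all (fun i => act_word w i \in Zp) (nth [::] faces n)])
   (zip ray edges)].

Fixpoint check (faces : seq (seq nat)) (nds : seq node) : bool :=
  if nds is nd :: nds' then
    check_node faces nd && check (rcons faces nd.1.1.1) nds'
  else true.

(** The two sides may be kept or exchanged as a whole, since an exchange merely negates the tetrad
    relations. Sorting compares images as sets. *)
Definition is_symmetry (s : seq nat) : bool :=
  let pt i := (i < 16)%N in
  [&& perm_eq s (iota 0 32),
      all (fun i => pt (nth 0%N s i) == pt i) (iota 0 32) ||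
      all (fun i => pt (nth 0%N s i) == ~~ pt i) (iota 0 32),
      all (fun g => sort leq (map (nth 0%N s) g) \in tetrads) tetrads &
      all (fun g => sort leq (map (nth 0%N s) g) \in rays) rays].

(** The first condition makes a ray an increasing list of coordinates, so that it can serve as a
    set. By the second, the indicator of each ray satisfies the tetrad relations, and subtracting a
    multiple of a ray preserves them. *)
Definition check_rays : bool :=
  all (fun g => [seq i <- iota 0 32 | i \in g] == g) rays &&
  all (fun t => all (fun g => count (mem g) (points t) == count (mem g) (blocks t)) rays)
      tetrads.

(** * Soundness of the certificate *)

Section Cone.
Variable R : realFieldType.
Implicit Types (x y : nat -> R) (Z g : seq nat).

Definition side (i : nat) : R := (-1) ^+ (16 <= i)%N.

(** This replaces the condition that the last 16 coordinates be the image under B of the first 16.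
    In this form it treats points and blocks alike and is visibly invariant under the symmetries. *)
Definition balanced x : Prop :=
  forall g, g \in tetrads -> \sum_(i <- g) side i * x i = 0.

Definition nonneg_on_rays y : Prop :=
  forall g, g \in rays -> 0 <= \sum_(i <- g) y i.

(** The dual way of saying that the rays generate the face. The functional y ranges over all 32
    coordinates and is quantified inside, because a symmetry moves it together with x and may mix
    its two halves. *)
Definition settled Z : Prop := forall x y,
  balanced x -> (forall i, 0 <= x i) -> {in Z, forall i, x i = 0} ->
  nonneg_on_rays y -> 0 <= \sum_(i <- iota 0 32) y i * x i.

Lemma symmetriesP : all is_symmetry symmetries. Proof. by vm_compute. Qed.
Lemma raysP : check_rays. Proof. by vm_compute. Qed.
Lemma certificateP : check [::] certificate. Proof. by vm_compute. Qed.

Lemma ray_uniq g : g \in rays -> uniq g /\ {in g, forall i, (i < 32)%N}.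
Proof.
have /andP[/allP ok _] := raysP.
move=> /ok /eqP <-; split=> [|i]; first by rewrite filter_uniq ?iota_uniq.
by rewrite mem_filter mem_iota => /andP[].
Qed.

Lemma tetrad_ray g : g \in tetrads -> g \in rays.
Proof. by rewrite mem_cat => ->. Qed.

Lemma sum_split_side x g :
  \sum_(i <- g) side i * x i = \sum_(i <- points g) x i - \sum_(i <- blocks g) x i.
Proof.
rewrite !big_filter -sumrN (bigID (fun i => i < 16)%N) /=; congr (_ + _).
  by apply: eq_bigr => i i16; rewrite /side leqNgt i16 mul1r.
under eq_bigl do rewrite -leqNgt.
by apply: eq_bigr => i i16; rewrite /side i16 mulN1r.
Qed.

Lemma settled_symmetry s Z :
  is_symmetry s -> settled Z -> settled (map (nth 0%N s) Z).
Proof.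
move=> /and4P[s_perm s_side /allP s_tet /allP s_ray] set_Z x y bx x0 xZ gy.
have sum_map (F : nat -> R) g : \sum_(i <- g) F (nth 0%N s i) =
    \sum_(i <- sort leq (map (nth 0%N s) g)) F i.
  rewrite -(big_map (nth 0%N s) xpredT F); apply: perm_big.
  by rewrite perm_sym perm_sort.
have -> : \sum_(i <- iota 0 32) y i * x i =
    \sum_(i <- iota 0 32) y (nth 0%N s i) * x (nth 0%N s i).
  rewrite -(big_map (nth 0%N s) xpredT (fun i => y i * x i)).
  (* With 32 written as the size of s, the list of images of s becomes [mkseq] applied to [nth],
     which is s itself. *)
  apply: perm_big; rewrite -[32%N in X in perm_eq _ X](perm_size s_perm).
  by rewrite -/(mkseq _ _) mkseq_nth perm_sym.
apply: (set_Z (fun i => x (nth 0%N s i)) (fun i => y (nth 0%N s i))) => //.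
- move=> g gT; have g_lt : {in g, forall i, (i < 32)%N}.
    by have [] := ray_uniq (tetrad_ray gT).
  (* The scalar is -1 when s exchanges points and blocks. *)
  have [e sideE] : exists e : R, {in g, forall i, side i = e * side (nth 0%N s i)}.
    have /orP[/allP sP|/allP sP] := s_side; [exists 1|exists (-1)] => i ig;
      have := sP i; rewrite mem_iota g_lt // => /(_ isT)/eqP;
      rewrite /side !(leqNgt 16) => ->.
      by rewrite mul1r.
    by rewrite negbK; case: (i < 16)%N; rewrite ?expr0 ?expr1 ?mulN1r ?mulr1 ?opprK.
  rewrite (eq_big_seq (fun i => e * (side (nth 0%N s i) * x (nth 0%N s i)))); last first.
    by move=> i ig; rewrite sideE ?mulrA.
  rewrite -mulr_sumr (sum_map (fun i => side i * x i)).
  by rewrite bx ?mulr0 // s_tet.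
- by move=> i iZ; apply: xZ; apply: map_f.
- by move=> g gR; rewrite (sum_map y); apply: gy; apply: s_ray.
Qed.

Lemma settled_word w Z :
  all (fun k => k < size symmetries)%N w -> settled Z -> settled (map (act_word w) Z).
Proof.
move=> + set_Z; elim: w => [_|k w IHw /= /andP[k_lt w_lt]]; first by rewrite map_id.
have := settled_symmetry (s := nth [::] symmetries k) _ (IHw w_lt).
rewrite -map_comp; apply.
by apply: (allP symmetriesP); rewrite mem_nth.
Qed.

Lemma close_zero x Z ks :
  balanced x -> (forall i, 0 <= x i) -> {in Z, forall i, x i = 0} ->
  {in close Z ks, forall i, x i = 0}.
Proof.
move=> bx x0 xZ; rewrite /close; case: ifP => // /allP le_rl i.
set r := flatten _ in le_rl *; set l := flatten _ in le_rl *.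
rewrite mem_cat => /orP[/xZ //|].
rewrite mem_filter => /andP[/andP[iZ lt_rl] i32].
have rel k : k \in ks -> \sum_(j <- relation_lhs k) x j = \sum_(j <- relation_rhs k) x j.
  have tet n : \sum_(j <- points (nth [::] tetrads n)) x j =
               \sum_(j <- blocks (nth [::] tetrads n)) x j.
    (* An index beyond the list yields the empty tetrad, for which both sums are empty. *)
    have [n_lt|n_ge] := ltnP n (size tetrads); last by rewrite nth_default.
    by apply/eqP; rewrite -subr_eq0 -sum_split_side bx ?mem_nth.
  by rewrite /relation_lhs /relation_rhs; case: ifP => _ _; rewrite tet.
have lr : \sum_(j <- l) x j = \sum_(j <- r) x j.
  by rewrite !big_flatten !big_map; apply: eq_big_seq => k kks; exact: rel.
have lt32 n j : j \in nth [::] tetrads n -> (j < 32)%N.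
  have [n_lt|n_ge] := ltnP n (size tetrads); last by rewrite nth_default.
  by have [_] := ray_uniq (tetrad_ray (mem_nth [::] n_lt)); apply.
have rel_lt k j : (j \in relation_lhs k) || (j \in relation_rhs k) -> (j < 32)%N.
  rewrite /relation_lhs /relation_rhs; case: ifP => _; rewrite !mem_filter;
  by case/orP => /andP[_ /lt32].
have count_sum s : {in s, forall j, (j < 32)%N} ->
    \sum_(j <- s) x j = \sum_(j <- iota 0 32) (count_mem j s)%:R * x j.
  elim: s => [|a s IHs] s_lt.
    by rewrite big_nil big1 // => j _; rewrite mul0r.
  rewrite big_cons IHs => [|j js]; last by rewrite s_lt // inE js orbT.
  rewrite [RHS](eq_bigr (fun j => (a == j)%:R * x j + (count_mem j s)%:R * x j)).
    have a32 : a \in iota 0 32 by rewrite mem_iota /= s_lt // inE eqxx.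
    rewrite big_split /= [X in _ = X + _](bigD1_seq a a32 (iota_uniq 0 32)) /=.
    rewrite eqxx mul1r [X in _ = x a + X + _]big1 ?addr0 // => j.
    by rewrite eq_sym => /negPf ->; rewrite mul0r.
  by move=> j _; rewrite /= natrD mulrDl.
move: lr; rewrite !count_sum; first last.
- by move=> j /flatten_mapP[k _ jk]; rewrite (rel_lt k) ?jk.
- by move=> j /flatten_mapP[k _ jk]; rewrite (rel_lt k) ?jk ?orbT.
move=> /eqP; rewrite -subr_eq0 -sumrB (eq_bigr
  (fun j => ((count_mem j l)%:R - (count_mem j r)%:R) * x j)); last first.
  by move=> j _; rewrite mulrBl.
rewrite big_seq psumr_eq0 => [|j j32]; last first.
  have /orP[/xZ ->|le_j] := le_rl j j32; first by rewrite mulr0.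
  by rewrite mulr_ge0 // subr_ge0 ler_nat.
move=> /allP/(_ i i32); rewrite i32 /= mulf_eq0 => /orP[|/eqP //].
by rewrite subr_eq0 eqr_nat => /eqP cnt; rewrite cnt ltnn in lt_rl.
Qed.

Lemma closes_zero x Z certs :
  balanced x -> (forall i, 0 <= x i) -> {in Z, forall i, x i = 0} ->
  {in foldl close Z certs, forall i, x i = 0}.
Proof.
move=> bx x0; elim: certs Z => [|ks certs IHc] Z xZ //=.
by apply: IHc; apply: close_zero.
Qed.

(* Subtract the largest possible multiple of the ray [g]: some coordinate of
   the ray then vanishes. *)
Lemma settled_subtract Z g :
  g \in rays -> g != [::] -> {in g, forall p, settled (p :: Z)} -> settled Z.
Proof.
move=> gR g0 set_p x y bx x0 xZ gy.
have [p pg p_min] : exists2 p, p \in g & {in g, forall i, x p <= x i}.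
  elim: g g0 {gR set_p} => // a [|b g] IHg _.
    by exists a; rewrite ?inE // => i; rewrite inE => /eqP ->.
  have [//|p pg p_min] := IHg; case: (leP (x a) (x p)) => [ap|/ltW pa].
    exists a; first by rewrite inE eqxx.
    by move=> i; rewrite inE => /orP[/eqP -> //|/p_min]; apply: le_trans.
  exists p; first by rewrite inE pg orbT.
  by move=> i; rewrite inE => /orP[/eqP -> //|/p_min].
have [g_uniq g_lt] := ray_uniq gR.
pose x' i := x i - x p * (i \in g)%:R.
have x'0 i : 0 <= x' i.
  rewrite /x'; case: (boolP (i \in g)) => [/p_min|_]; last by rewrite mulr0 subr0.
  by rewrite mulr1 subr_ge0.
have -> : \sum_(i <- iota 0 32) y i * x i =
    \sum_(i <- iota 0 32) y i * x' i + x p * \sum_(i <- g) y i.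
  have -> : \sum_(i <- g) y i = \sum_(i <- iota 0 32) (i \in g)%:R * y i.
    under [RHS]eq_bigr do rewrite mulr_natl mulrb.
    rewrite -big_mkcond -big_filter; apply: perm_big; apply: uniq_perm => //.
      by rewrite filter_uniq ?iota_uniq.
    move=> i; rewrite mem_filter mem_iota /= add0n.
    by case: (boolP (i \in g)) => // /g_lt ->.
  by rewrite mulr_sumr -big_split; apply: eq_bigr => i _; rewrite /x' /=; ring.
rewrite addr_ge0 ?mulr_ge0 ?gy //; apply: (set_p p pg) => // [t tT|i].
  rewrite (eq_bigr (fun i => side i * x i - x p * (side i * (i \in g)%:R))); last first.
    by move=> i _; rewrite /x'; ring.
  rewrite sumrB bx // -mulr_sumr (sum_split_side (fun i => (i \in g)%:R)).
  have /andP[_ /allP/(_ t tT)/allP/(_ g gR)/eqP cnt] := raysP.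
  have cntE s : \sum_(i <- s) (i \in g)%:R = (count (mem g) s)%:R :> R.
    by elim: s => [|a s IHs]; rewrite ?big_nil // big_cons IHs -natrD.
  by rewrite !cntE cnt subrr mulr0 subr0.
rewrite inE => /orP[/eqP ->|iZ]; first by rewrite /x' pg mulr1 subrr.
apply/eqP; rewrite eq_le x'0 andbT /x' (xZ i iZ) sub0r oppr_le0.
by rewrite mulr_ge0.
Qed.

Lemma check_nodeP faces nd :
  {in faces, forall Z, settled Z} -> check_node faces nd -> settled nd.1.1.1.
Proof.
case: nd => [[[Z0 certs] g] edges] set_faces; rewrite /check_node.
cbv beta zeta match; rewrite -[X in settled X]/Z0; set Z := foldl close Z0 certs.
(* The certificates only add coordinates that vanish on the face anyway, so Z and Z0 describe the
   same face. *)
suff close_settled : settled Z -> settled Z0.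
  case: edges => [/allP Z_all|e0 edges'].
    apply: close_settled => x y bx x0 xZ gy.
    rewrite big_seq sumr_ge0 // => i /Z_all iZ.
    by rewrite (xZ i iZ) mulr0.
  set edges := e0 :: edges' => /and4P[g_lt g0 /eqP sz /allP ok].
  apply: close_settled; apply: (settled_subtract (mem_nth [::] g_lt) g0) => p pg.
  set ray := nth [::] rays g in g0 sz ok pg.
  pose k := index p ray; have k_lt : (k < size ray)%N by rewrite index_mem.
  have := ok (nth (0%N, e0) (zip ray edges) k).
  rewrite mem_nth ?size_zip ?sz ?minnn // => /(_ isT).
  rewrite nth_zip // nth_index //; case: (nth e0 edges k) => [[ecerts n] w].
  case/and3P => n_lt w_lt /allP sub x y bx x0 xZ gy.
  have set_n := settled_word w_lt (set_faces _ (mem_nth [::] n_lt)).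
  apply: set_n => // i /mapP[j jn ->].
  exact: (closes_zero bx x0 xZ) (sub j jn).
move=> set_Z x y bx x0 xZ0 gy; apply: set_Z => //.
exact: closes_zero.
Qed.

Lemma checkP faces nds :
  {in faces, forall Z, settled Z} -> check faces nds ->
  {in nds, forall nd : node, settled nd.1.1.1}.
Proof.
elim: nds faces => [|nd nds IHn] faces set_faces //= /andP[ok_nd ok_nds].
have set_nd := check_nodeP set_faces ok_nd.
have set_nds : {in nds, forall nd : node, settled nd.1.1.1}.
  apply: IHn ok_nds => Z; rewrite mem_rcons inE => /orP[/eqP -> //|].
  exact: set_faces.
by move=> nd'; rewrite inE => /orP[/eqP -> //|]; apply: set_nds.
Qed.

(** The last node of the certificate has no vanishing coordinate, so its face is the whole cone.
    Read for all y at once, this says that the rays generate the cone. *)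
Theorem nonneg_on_cone x y :
  balanced x -> (forall i, 0 <= x i) -> nonneg_on_rays y ->
  0 <= \sum_(i <- iota 0 32) y i * x i.
Proof.
have last_node : last ([::], [::], 0%N, [::]) certificate \in certificate.
  by rewrite -nth_last mem_nth.
have root : (last ([::], [::], 0%N, [::]) certificate).1.1.1 = [::] by vm_compute.
have := checkP (faces := [::]) _ certificateP last_node.
rewrite root => set_nil bx x0; apply: set_nil => //.
Qed.

End Cone.

(** * Duality *)

(* Fourier-Motzkin elimination; the variables are the elements of [r]. *)
Lemma farkas (R : realFieldType) (J : eqType) (r : seq J) (I : finType)
    (A : I -> J -> R) (b : I -> R) : uniq r ->
  (exists q : J -> R, forall i, 0 <= \sum_(j <- r) A i j * q j + b i) \/
  (exists u : I -> R, [/\ forall i, 0 <= u i,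
     forall j, j \in r -> \sum_i u i * A i j = 0 & \sum_i u i * b i < 0]).
Proof.
elim: r I A b => [|j r IHr] I A b /=.
  move=> _; case: (boolP [forall i, 0 <= b i]) => [/forallP b0|].
    by left; exists (fun=> 0) => i; rewrite big_nil add0r.
  move=> /forallPn[i0]; rewrite -ltNge => bi; right.
  have pick (F : I -> R) : \sum_k (k == i0)%:R * F k = F i0.
    by rewrite (bigD1 i0) //= eqxx mul1r big1 ?addr0 // => k /negPf ->; rewrite mul0r.
  by exists (fun k => (k == i0)%:R); split=> [k|//|]; rewrite ?ler0n ?pick.
move=> /andP[jr /IHr{}IHr]; pose a i := A i j.
(* Multipliers eliminating the variable j. A row i with positive and a row k with negative
   coefficient combine to [- a k] times row i plus [a i] times row k; a row with coefficient 0 is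
   kept; all other pairs give the zero row. The new rows are indexed by pairs, so the row type has
   to vary in the induction. *)
pose l i k : R := if (0 < a i) && (a k < 0) then - a k else (a i == 0)%:R.
pose m i k : R := if (0 < a i) && (a k < 0) then a i else 0.
have l0 i k : 0 <= l i k by rewrite /l; case: ifP => [/andP[_ /ltW]|//]; rewrite oppr_ge0.
have m0 i k : 0 <= m i k by rewrite /m; case: ifP => [/andP[/ltW]|].
have lm0 i k : l i k * a i + m i k * a k = 0.
  rewrite /l /m; case: ifP => _; first by ring.
  by case: (eqVneq (a i) 0) => [->|_]; rewrite ?mulr0 ?mul0r ?addr0.
have [[q qP]|[u [u0 uA ub]]] := IHr (I * I)%type
    (fun ik j' => l ik.1 ik.2 * A ik.1 j' + m ik.1 ik.2 * A ik.2 j')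
    (fun ik => l ik.1 ik.2 * b ik.1 + m ik.1 ik.2 * b ik.2).
  left; pose L i := \sum_(j' <- r) A i j' * q j' + b i.
  have lmL i k : 0 <= l i k * L i + m i k * L k.
    apply: le_trans (qP (i, k)) _; rewrite le_eqVlt; apply/orP; left; apply/eqP.
    rewrite /L !mulrDr !mulr_sumr addrACA -big_split /=; congr (_ + _).
    by apply: eq_bigr => j' _; ring.
  suff [v vP] : exists v, forall i, 0 <= a i * v + L i.
    exists (fun j' => if j' == j then v else q j') => i.
    rewrite big_cons eqxx -addrA; apply: le_trans (vP i) _; rewrite le_eqVlt /L.
    apply/orP; left; apply/eqP; congr (_ + (_ + _)); apply: eq_big_seq => j' j'r.
    by case: eqP => // j'j; rewrite -j'j j'r in jr.
  (* Rows with positive coefficient bound the eliminated variable from below, rows with negative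
     coefficient from above; the combined rows say that the bounds are compatible. *)
  have pair i k : 0 < a i -> a k < 0 -> - L i / a i <= - L k / a k.
    move=> ai ak; have := lmL i k; rewrite /l /m ai ak /= => le0.
    rewrite ler_pdivrMr // mulrAC ler_ndivlMr //; nra.
  have zero i : a i = 0 -> 0 <= L i.
    by move=> ai; have := lmL i i; rewrite /l /m ai ltxx /= eqxx mul1r mul0r addr0.
  (* The value is the largest lower bound, or else the smallest upper bound, or 0 if there is no
     bound at all. *)
  case: (pickP (fun i => 0 < a i)) => [i1 i1P|no_pos].
    pose i0 := [arg max_(i > i1 | 0 < a i) (- L i / a i)]%O.
    have [i0P i0max] : 0 < a i0 /\ forall i, 0 < a i -> - L i / a i <= - L i0 / a i0.
      by rewrite /i0; case: Order.TotalTheory.arg_maxP.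
    exists (- L i0 / a i0) => i; case: (ltrgtP (a i) 0) => [ai|ai|ai].
    - by have := pair _ _ i0P ai; rewrite ler_ndivlMr //; lra.
    - by have := i0max _ ai; rewrite ler_pdivrMr //; lra.
    - by rewrite ai mul0r add0r zero.
  case: (pickP (fun i => a i < 0)) => [i1 i1P|no_neg].
    pose i0 := [arg min_(i < i1 | a i < 0) (- L i / a i)]%O.
    have [i0P i0min] : a i0 < 0 /\ forall i, a i < 0 -> - L i0 / a i0 <= - L i / a i.
      by rewrite /i0; case: Order.TotalTheory.arg_minP.
    exists (- L i0 / a i0) => i; case: (ltrgtP (a i) 0) => [ai|ai|ai].
    - by have := i0min _ ai; rewrite ler_ndivlMr //; lra.
    - by rewrite no_pos in ai.
    - by rewrite ai mul0r add0r zero.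
  exists 0 => i; rewrite mulr0 add0r; apply: zero.
  by case: (ltrgtP (a i) 0) => // ai; [have := no_neg i | have := no_pos i]; rewrite ai.
(* Multipliers of pairs are carried back to single rows: row i enters the pairs (i, k) with weight l
   and the pairs (k, i) with weight m. *)
right; pose w i := \sum_k (u (i, k) * l i k + u (k, i) * m k i).
have wE (F : I -> R) : \sum_i w i * F i =
    \sum_ik u ik * (l ik.1 ik.2 * F ik.1 + m ik.1 ik.2 * F ik.2).
  rewrite [RHS](eq_bigr (fun ik =>
    u (ik.1, ik.2) * (l ik.1 ik.2 * F ik.1 + m ik.1 ik.2 * F ik.2))); last by case.
  rewrite -(pair_big xpredT xpredT (fun i k => u (i, k) * (l i k * F i + m i k * F k))) /=.
  transitivity (\sum_i \sum_k u (i, k) * l i k * F i + \sum_i \sum_k u (k, i) * m k i * F i).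
    rewrite -big_split; apply: eq_bigr => i _; rewrite /w mulr_suml -big_split.
    by apply: eq_bigr => k _; rewrite mulrDl.
  rewrite [X in _ + X]exchange_big /= -big_split; apply: eq_bigr => i _.
  by rewrite -big_split; apply: eq_bigr => k _ /=; ring.
exists w; split=> [i|j'|]; first by apply: sumr_ge0 => k _; rewrite addr_ge0 ?mulr_ge0.
  rewrite inE wE => /orP[/eqP ->|j'r]; last exact: uA.
  by rewrite big1 // => ik _; rewrite lm0 mulr0.
by rewrite wE.
Qed.

(** * The transform B and its cone *)

Section Twist.
Variable R : realFieldType.
Implicit Types P Q S W : 'M[R]_4.

(** The transform B: [spectral_transpose] without the reversal of the indices. In this form it
    commutes with all permutations of rows and of columns. *)
Definition twist Q : 'M[R]_4 := \matrix_(k, l)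
  (Q k l + 4^-1 * (\sum_i \sum_j Q i j) - 2^-1 * (\sum_j Q k j + \sum_i Q i l)).

Definition reindex_mx (f g : 'I_4 -> 'I_4) Q : 'M[R]_4 := \matrix_(k, l) Q (f k) (g l).

Lemma twist_reindex f g Q : injective f -> injective g ->
  twist (reindex_mx f g Q) = reindex_mx f g (twist Q).
Proof.
move=> fI gI; apply/matrixP => k l; rewrite !mxE.
congr (_ + _ * _ - _ * (_ + _)).
- rewrite [RHS](reindex_inj fI); apply: eq_bigr => i _.
  by rewrite [RHS](reindex_inj gI); apply: eq_bigr => j _; rewrite mxE.
- by rewrite [RHS](reindex_inj gI); apply: eq_bigr => j _; rewrite mxE.
- by rewrite [RHS](reindex_inj fI); apply: eq_bigr => i _; rewrite mxE.
Qed.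

Definition cell_sum (cs : seq (nat * nat)) Q : R := \sum_(c <- cs) Q (o c.1) (o c.2).

Definition swap_shape (sh : seq (nat * nat) * seq (nat * nat)) := (sh.2, sh.1).

Lemma sum_o (F : 'I_4 -> R) : \sum_i F i = F (o 0) + F (o 1) + F (o 2) + F (o 3).
Proof.
by rewrite !big_ord_recl big_ord0 addr0 !addrA; congr (F _ + F _ + F _ + F _);
  apply: val_inj; rewrite /= inordK.
Qed.

(** B is symmetric for the entrywise inner product and carries the indicator of [sh.1] to that of
    [sh.2]. This gives both the necessity of the inequalities and the tetrad relations. *)
Lemma cell_sum_twist sh Q :
  sh \in [:: tetrad_block; swap_shape tetrad_block; tetrad_diag; hexad_row; hexad_col] ->
  cell_sum sh.1 (twist Q) = cell_sum sh.2 Q.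
Proof.
have twE k l : twist Q k l = Q k l + 4^-1 * (\sum_i \sum_j Q i j)
    - 2^-1 * (\sum_j Q k j + \sum_i Q i l) by rewrite mxE.
rewrite !inE => /orP[/eqP|/orP[/eqP|/orP[/eqP|/orP[/eqP|/eqP]]]] ->;
by rewrite /cell_sum /= !big_cons !big_nil /= !twE !sum_o; field.
Qed.

Lemma cell_sum_ge0 cs Q : (forall k l, 0 <= Q k l) -> 0 <= cell_sum cs Q.
Proof. by move=> Q0; apply: sumr_ge0. Qed.

(** The numbering of coordinates fixed in [place], with Q on points and W on blocks. *)
Definition flatten2 Q W (i : nat) : R :=
  if (i < 16)%N then Q (o (i %/ 4)) (o (i %% 4))
  else W (o ((i - 16) %/ 4)) (o ((i - 16) %% 4)).

Lemma flatten2_l Q W (a b : 'I_4) : flatten2 Q W (4 * a + b)%N = Q a b.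
Proof.
rewrite /flatten2 ifT; last first.
  by case: a b => [[|[|[|[|a]]]] lt_a] // [[|[|[|[|b]]]] lt_b].
by rewrite mulnC divnMDl // modnMDl divn_small // modn_small // addn0 /o !inord_val.
Qed.

Lemma flatten2_r Q W (a b : 'I_4) : flatten2 Q W (16 + (4 * a + b))%N = W a b.
Proof.
rewrite /flatten2 ltnNge leq_addr /= addKn.
by rewrite mulnC divnMDl // modnMDl divn_small // modn_small // addn0 /o !inord_val.
Qed.

Lemma sum_flatten2 (F : nat -> R) : \sum_(i <- iota 0 32) F i =
  \sum_(a < 4) \sum_(b < 4) F (4 * a + b)%N + \sum_(a < 4) \sum_(b < 4) F (16 + (4 * a + b))%N.
Proof.
have -> : iota 0 32 = [seq (4 * a + b)%N | a <- index_iota 0 4, b <- index_iota 0 4] ++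
    [seq (16 + (4 * a + b))%N | a <- index_iota 0 4, b <- index_iota 0 4] by [].
rewrite big_cat !big_allpairs_dep !big_mkord.
by congr (_ + _); apply: eq_bigr => a _; rewrite big_mkord.
Qed.

Lemma perm_of_seq p : p \in perms4 -> exists s : 'S_4, forall i : 'I_4, nth 0%N p i = s i.
Proof.
rewrite mem_permutations => p4.
have p_lt (i : 'I_4) : (nth 0%N p i < 4)%N.
  have : nth 0%N p i \in p by rewrite mem_nth // (perm_size p4) size_iota.
  by rewrite (perm_mem p4) mem_iota.
have inj : injective (fun i => Ordinal (p_lt i)).
  move=> i j [] /eqP; rewrite nth_uniq ?(perm_uniq p4) ?iota_uniq //.
  - by move/eqP/val_inj.
  - by rewrite (perm_size p4) size_iota.
  - by rewrite (perm_size p4) size_iota.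
by exists (perm inj) => i; rewrite permE.
Qed.

Definition small_cells (cs : seq (nat * nat)) := all (fun c => (c.1 < 4) && (c.2 < 4))%N cs.

Lemma sum_place sh p q (F : nat -> R) (s1 s2 : 'S_4) :
  small_cells sh.1 -> small_cells sh.2 ->
  (forall i : 'I_4, nth 0%N p i = s1 i) -> (forall i : 'I_4, nth 0%N q i = s2 i) ->
  \sum_(i <- place sh p q) F i =
  \sum_(c <- sh.1) F (4 * s1 (o c.1) + s2 (o c.2))%N +
  \sum_(c <- sh.2) F (16 + (4 * s1 (o c.1) + s2 (o c.2)))%N.
Proof.
move=> /allP sm1 /allP sm2 pE qE.
have nthE r (s : 'S_4) n : (forall i : 'I_4, nth 0%N r i = s i) -> (n < 4)%N ->
    nth 0%N r n = s (o n) by move=> rE n4; rewrite -rE inordK.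
rewrite (perm_big _ (permEl (perm_sort _ _))) big_cat !big_map; congr (_ + _);
  apply: eq_big_seq => c.
- by move=> /sm1 /andP[c1 c2]; rewrite (nthE _ _ _ pE c1) (nthE _ _ _ qE c2).
- by move=> /sm2 /andP[c1 c2]; rewrite (nthE _ _ _ pE c1) (nthE _ _ _ qE c2).
Qed.

Lemma tetradP g : g \in tetrads -> exists sh p q,
  [/\ sh \in [:: tetrad_block; tetrad_diag], p \in perms4, q \in perms4 & g = place sh p q].
Proof.
(* The list is stored in evaluated form, and its description by shapes is recovered by
   computation. *)
have -> : tetrads = [seq place tetrad_block p q | p <- pair_splits, q <- pair_splits] ++
  [seq place tetrad_diag (iota 0 4) q | q <- perms4] by vm_compute.
have /allP pair_perm : all (mem perms4) pair_splits by vm_compute.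
rewrite mem_cat => /orP[/allpairsP[[p q] /= [/pair_perm pP /pair_perm qP ->]]|/mapP[q qP ->]].
  by exists tetrad_block, p, q; split.
by exists tetrad_diag, (iota 0 4), q; split.
Qed.

Lemma rayP g : g \in rays -> exists sh p q,
  [/\ sh \in [:: tetrad_block; tetrad_diag; hexad_row; hexad_col],
     p \in perms4, q \in perms4 & g = place sh p q].
Proof.
rewrite mem_cat => /orP[/tetradP[sh [p [q [shP pP qP ->]]]]|].
  exists sh, p, q; split=> //; move: shP; rewrite !inE.
  by case/orP => ->; rewrite ?orbT.
have -> : hexads = [seq place hexad_row p q | p <- point_splits, q <- perms4] ++
  [seq place hexad_col p q | p <- point_splits, q <- perms4] by vm_compute.
have /allP point_perm : all (mem perms4) point_splits by vm_compute.
rewrite mem_cat => /orP[] /allpairsP[[p q] /= [/point_perm pP qP ->]].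
  by exists hexad_row, p, q; split.
by exists hexad_col, p, q; split.
Qed.

Lemma nonneg_on_twist_cone S W :
  (forall sh, sh \in [:: tetrad_block; tetrad_diag; hexad_row; hexad_col] ->
     forall s1 s2 : 'S_4, 0 <= cell_sum sh.1 (reindex_mx s1 s2 S)) ->
  (forall k l, 0 <= W k l) -> (forall k l, 0 <= twist W k l) ->
  0 <= \sum_k \sum_l S k l * W k l.
Proof.
(* The functional is S on points and 0 on blocks, so on a ray it takes the sum of S over the points
   only. *)
move=> S_ge0 W0 tW0; have := @nonneg_on_cone R (flatten2 W (twist W)) (flatten2 S 0).
rewrite sum_flatten2 [X in _ + X]big1 ?addr0 => [|a _]; last first.
  by rewrite big1 // => b _; rewrite flatten2_r mxE mul0r.
under eq_bigr => a _ do under eq_bigr => b _ do rewrite !flatten2_l.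
have small sh : sh \in [:: tetrad_block; tetrad_diag; hexad_row; hexad_col] ->
    small_cells sh.1 /\ small_cells sh.2.
  by rewrite !inE => /orP[/eqP|/orP[/eqP|/orP[/eqP|/eqP]]] ->.
apply=> [g|i|g].
- move=> /tetradP[sh [p [q [shP /perm_of_seq[s1 pE] /perm_of_seq[s2 qE] ->]]]].
  have [sm1 sm2] : small_cells sh.1 /\ small_cells sh.2.
    by apply: small; move: shP; rewrite !inE => /orP[] ->; rewrite ?orbT.
  rewrite (sum_place _ sm1 sm2 pE qE).
  have side_l (a b : 'I_4) : side R (4 * a + b) = 1.
    by case: a b => [[|[|[|[|a]]]] lt_a] // [[|[|[|[|b]]]] lt_b].
  have side_r n : side R (16 + n) = -1 by rewrite /side leq_addr.
  rewrite (eq_bigr (fun c => reindex_mx s1 s2 W (o c.1) (o c.2))) => [|c _]; last first.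
    by rewrite side_l flatten2_l mxE mul1r.
  rewrite [X in _ + X](eq_bigr (fun c =>
      - twist (reindex_mx s1 s2 W) (o c.1) (o c.2))) => [|c _]; last first.
    rewrite side_r flatten2_r twist_reindex; try exact: perm_inj.
    by rewrite [reindex_mx _ _ _ _ _]mxE mulN1r.
  (* The tetrad relation compares the points of W with the blocks of B(W), hence the swapped
     shape. *)
  have := @cell_sum_twist (swap_shape sh) (reindex_mx s1 s2 W).
  rewrite sumrN /cell_sum /= => ->; first by rewrite subrr.
  by move: shP; rewrite !inE => /orP[/eqP ->|/eqP ->].
- by rewrite /flatten2; case: ifP.
- move=> /rayP[sh [p [q [shP /perm_of_seq[s1 pE] /perm_of_seq[s2 qE] ->]]]].
  have [sm1 sm2] := small _ shP; rewrite (sum_place _ sm1 sm2 pE qE).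
  rewrite [X in _ + X]big1 ?addr0 => [|c _]; last by rewrite flatten2_r mxE.
  have := S_ge0 _ shP s1 s2; congr (0 <= _); apply: eq_bigr => c _.
  by rewrite flatten2_l mxE.
Qed.

(** If S = P + B(Q), a cell sum of B(Q) is a cell sum of Q over the partner pattern, hence
    nonnegative. Conversely, Farkas is applied to the system Q >= 0, S - B(Q) >= 0 in the unknown Q:
    a refutation would be some W in the cone on which S is negative. *)
Lemma twist_decomposition S :
  (exists P Q, [/\ forall k l, 0 <= P k l, forall k l, 0 <= Q k l & S = P + twist Q]) <->
  (forall sh, sh \in [:: tetrad_block; tetrad_diag; hexad_row; hexad_col] ->
     forall s1 s2 : 'S_4, 0 <= cell_sum sh.1 (reindex_mx s1 s2 S)).
Proof.
split=> [[P [Q [P0 Q0 ->]]] sh shP s1 s2|S_ge0].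
  have -> : cell_sum sh.1 (reindex_mx s1 s2 (P + twist Q)) =
      cell_sum sh.1 (reindex_mx s1 s2 P) + cell_sum sh.1 (twist (reindex_mx s1 s2 Q)).
    rewrite twist_reindex; [|exact: perm_inj|exact: perm_inj].
    by rewrite /cell_sum -big_split; apply: eq_bigr => c _; rewrite !mxE.
  rewrite cell_sum_twist; last first.
    by move: shP; rewrite !inE => /orP[|/orP[|/orP[]]] ->; rewrite ?orbT.
  by rewrite addr_ge0 ?cell_sum_ge0 // => k l; rewrite mxE.
pose T (kl xy : 'I_4 * 'I_4) : R :=
  (kl == xy)%:R + 4^-1 - 2^-1 * ((kl.1 == xy.1)%:R + (kl.2 == xy.2)%:R).
have TE Q k l : \sum_xy T (k, l) xy * Q xy.1 xy.2 = twist Q k l.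
  have delta (A : finType) (a : A) (F : A -> R) : \sum_x (a == x)%:R * F x = F a.
    rewrite (bigD1 a) //= eqxx mul1r big1 ?addr0 // => x.
    by rewrite eq_sym => /negPf ->; rewrite mul0r.
  transitivity (\sum_xy ((k, l) == xy)%:R * Q xy.1 xy.2 + 4^-1 * (\sum_xy Q xy.1 xy.2) -
      2^-1 * (\sum_xy (k == xy.1)%:R * Q xy.1 xy.2 + \sum_xy (l == xy.2)%:R * Q xy.1 xy.2)).
    rewrite -big_split !mulr_sumr -big_split -sumrB; apply: eq_bigr => xy _.
    by rewrite /T /=; ring.
  rewrite (delta _ (k, l) (fun xy => Q xy.1 xy.2)) mxE.
  rewrite -(pair_bigA _ (fun x y => Q x y)) -(pair_bigA _ (fun x y => (k == x)%:R * Q x y)).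
  rewrite -(pair_bigA _ (fun x y => (l == y)%:R * Q x y)) /=; congr (_ + _ - _ * (_ + _)).
    by rewrite exchange_big; apply: eq_bigr => j _; rewrite delta.
  by apply: eq_bigr => i _; rewrite delta.
have T_sym kl xy : T kl xy = T xy kl.
  by rewrite /T ![_ == kl]eq_sym ![_ == kl.1]eq_sym ![_ == kl.2]eq_sym.
(* Rows tagged [true] express Q >= 0, rows tagged [false] express S - B(Q) >= 0. *)
have [[q qP]|[u [u0 uA ub]]] := @farkas R _ (enum {: 'I_4 * 'I_4}) (bool * ('I_4 * 'I_4))%type
   (fun i xy => if i.1 then (i.2 == xy)%:R else - T i.2 xy)
   (fun i => if i.1 then 0 else S i.2.1 i.2.2) (enum_uniq _).
  pose Q : 'M[R]_4 := \matrix_(k, l) q (k, l).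
  have Q0 k l : 0 <= Q k l.
    have := qP (true, (k, l)); rewrite /= addr0 big_enum /=.
    rewrite (bigD1 (k, l)) //= eqxx mul1r big1 ?addr0 ?mxE //.
    by move=> xy; rewrite eq_sym => /negPf ->; rewrite mul0r.
  exists (S - twist Q), Q; split=> //; last by rewrite subrK.
  move=> k l; have := qP (false, (k, l)); rewrite /= big_enum /= addrC.
  have -> : (S - twist Q) k l = S k l - twist Q k l by rewrite !mxE.
  congr (0 <= _); rewrite -TE -sumrN.
  by congr (_ + _); apply: eq_bigr => -[x y] _; rewrite mxE mulNr.
pose W : 'M[R]_4 := \matrix_(k, l) u (false, (k, l)).
have W0 k l : 0 <= W k l by rewrite mxE.
have sumb (F : bool * ('I_4 * 'I_4) -> R) :
    \sum_i F i = \sum_kl F (true, kl) + \sum_kl F (false, kl).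
  rewrite (eq_bigr (fun i => F (i.1, i.2))); last by case.
  by rewrite -(pair_bigA _ (fun b kl => F (b, kl))) /= big_bool.
(* The multipliers cancel each unknown, so by the symmetry of B the entry of B(W) equals the
   multiplier of the row Q k l >= 0. *)
have tW0 k l : 0 <= twist W k l.
  have := uA (k, l); rewrite mem_enum => /(_ isT); rewrite sumb /=.
  rewrite (bigD1 (k, l)) //= eqxx mulr1 big1 ?addr0 => [|xy /negPf ->]; last by rewrite mulr0.
  move=> /eqP; rewrite addr_eq0 => /eqP uE; have := u0 (true, (k, l)); rewrite uE -sumrN.
  congr (0 <= _); rewrite -TE; apply: eq_bigr => -[x y] _.
  by rewrite mxE T_sym /=; ring.
have := nonneg_on_twist_cone S_ge0 W0 tW0; rewrite leNgt => /negP[].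
move: ub; rewrite sumb /= big1 ?add0r => [|kl _]; last by rewrite mulr0.
congr (_ < 0); rewrite pair_bigA /=; apply: eq_bigr => -[k l] _.
by rewrite mxE mulrC.
Qed.

End Twist.

(** * Return to Pauli maps *)

Section Main.
Variable R : realType.
Implicit Types Q S mu : 'M[R]_4.

Lemma spectral_transposeE Q :
  spectral_transpose Q = twist (reindex_mx (@rev_ord 4) (@rev_ord 4) Q).
Proof.
rewrite twist_reindex; try exact: rev_ord_inj.
by apply/matrixP => k l; rewrite !mxE.
Qed.

Lemma reindex_rev_ordK Q :
  reindex_mx (@rev_ord 4) (@rev_ord 4) (reindex_mx (@rev_ord 4) (@rev_ord 4) Q) = Q.
Proof. by apply/matrixP => k l; rewrite !mxE !rev_ordK. Qed.

Lemma decomposable_cell_sums mu :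
  decomposable (pauli_map mu) <->
  (forall sh, sh \in [:: tetrad_block; tetrad_diag; hexad_row; hexad_col] ->
     forall s1 s2 : 'S_4, 0 <= cell_sum sh.1 (reindex_mx s1 s2 (spectral mu))).
Proof.
rewrite -twist_decomposition decomposable_pauli_map.
(* Reversing the indices of Q preserves nonnegativity and converts one transform into the other. *)
split=> -[P [Q [P0 Q0 ->]]]; exists P, (reindex_mx (@rev_ord 4) (@rev_ord 4) Q).
  by split=> // [k l|]; rewrite ?spectral_transposeE ?mxE.
by split=> // [k l|]; rewrite ?spectral_transposeE ?reindex_rev_ordK ?mxE.
Qed.

End Main.

Theorem mainTheorem13 (R : realType) (mu : 'M[R]_4) :
  let S := spectral mu in
  let ineq1 (s1 s2 : 'S_4) :=
    0 <= S (s1 (o 0)) (s2 (o 0)) + S (s1 (o 0)) (s2 (o 1))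
       + S (s1 (o 1)) (s2 (o 0)) + S (s1 (o 1)) (s2 (o 1)) in
  let ineq2 (s1 s2 : 'S_4) :=
    0 <= S (s1 (o 0)) (s2 (o 0)) + S (s1 (o 1)) (s2 (o 1))
       + S (s1 (o 2)) (s2 (o 2)) + S (s1 (o 3)) (s2 (o 3)) in
  let ineq3 (s1 s2 : 'S_4) :=
    0 <= S (s1 (o 0)) (s2 (o 0)) + S (s1 (o 1)) (s2 (o 1))
       + S (s1 (o 2)) (s2 (o 2)) + S (s1 (o 3)) (s2 (o 0))
       + S (s1 (o 3)) (s2 (o 1)) + S (s1 (o 3)) (s2 (o 2)) in
  let ineq4 (s1 s2 : 'S_4) :=
    0 <= S (s1 (o 0)) (s2 (o 0)) + S (s1 (o 1)) (s2 (o 1))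
       + S (s1 (o 2)) (s2 (o 2)) + S (s1 (o 0)) (s2 (o 3))
       + S (s1 (o 1)) (s2 (o 3)) + S (s1 (o 2)) (s2 (o 3)) in
  (decomposable (pauli_map mu) <->
     (forall s1 s2 : 'S_4, [/\ ineq1 s1 s2, ineq2 s1 s2, ineq3 s1 s2 & ineq4 s1 s2]))
  /\
  (positive_map (pauli_map mu) ->
     forall s1 s2 : 'S_4, ineq1 s1 s2 /\ ineq2 s1 s2).
Proof.
have cellE sh (s1 s2 : 'S_4) : cell_sum sh (reindex_mx s1 s2 (spectral mu)) =
    \sum_(c <- sh) spectral mu (s1 (o c.1)) (s2 (o c.2)).
  by apply: eq_bigr => c _; rewrite mxE.
move=> S ineq1 ineq2 ineq3 ineq4; split.
  rewrite decomposable_cell_sums; split=> [all_sh s1 s2|ineqs sh].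
    have get sh shP := all_sh sh shP s1 s2.
    split; [have := get tetrad_block isT|have := get tetrad_diag isT
      |have := get hexad_row isT|have := get hexad_col isT];
    by rewrite cellE !big_cons big_nil addr0 !addrA.
  rewrite !inE => /orP[/eqP ->|/orP[/eqP ->|/orP[/eqP ->|/eqP ->]]] s1 s2;
  by have [] := ineqs s1 s2; rewrite cellE !big_cons big_nil addr0 !addrA.
move=> pos s1 s2.
have o_neq : o 0 != o 1 by rewrite -val_eqE /= !inordK.
split; first by apply: positive_rectangle; rewrite ?(inj_eq perm_inj).
(* Products of permutations act from the left factor on, so after reindexing by s1 the m-th summand
   is the entry at s1 m and s2 m. *)
have := positive_permutation (s1^-1 * s2)%g pos.
rewrite (reindex_inj (@perm_inj _ s1)) sum_o /ineq2 -/S.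
by rewrite !permM !permK.
Qed.
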